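(* Let $p$ be a prime number, let $\mathbb{Z}_p$ be the compact group of $p$-adic integers, and let $\mathcal{V}_\infty$ be the orthogonal filtration of $\mathrm{C}(\mathbb{Z}_p)$ arising as the inductive limit of the word-length filtrations of the algebras $\mathrm{C}^*(\Gamma_{p^n})$, $n\in\mathbb{N}$ (see context). Then the corresponding quantum symmetry group $G$ of $(\mathrm{C}(\mathbb{Z}_p),\mathcal{V}_\infty)$ is the (classical compact) group $\mathbb{Z}_p\rtimes\mathbb{Z}/2\mathbb{Z}$, with the action of $\mathbb{Z}/2\mathbb{Z}$ on $\mathbb{Z}_p$ given by the inverse automorphism $t\mapsto -t$. Moreover the corresponding action of $G$ on the set $\mathbb{Z}_p$ is given by the formulas $$(k,0)\cdot t=k+t,\qquad (k,1)\cdot t=k-t,\qquad k,t\in\mathbb{Z}_p .$$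
   Context: All $\mathrm{C}^*$-algebras and $*$-homomorphisms are unital; $\otimes$ is the minimal tensor product, $\odot$ the algebraic one. A compact quantum group $\mathbb{G}$ is given by a $\mathrm{C}^*$-algebra $\mathrm{C}(\mathbb{G})$ with comultiplication $\Delta$ in the sense of Woronowicz; it is determined by its canonical dense Hopf $*$-algebra $\mathrm{Pol}(\mathbb{G})$. It is a classical compact group if $\mathrm{C}(\mathbb{G})$ is commutative. A morphism from $\mathbb{G}_1$ to $\mathbb{G}_2$ is a $*$-homomorphism $\gamma\colon\mathrm{C}(\mathbb{G}_2)\to\mathrm{C}(\mathbb{G}_1)$ intertwining comultiplications. An action of $\mathbb{G}$ on $\mathsf{A}$ is a $*$-homomorphism $\alpha\colon\mathsf{A}\to\mathsf{A}\otimes\mathrm{C}(\mathbb{G})$ with $(\alpha\otimes\mathrm{id})\circ\alpha=(\mathrm{id}\otimes\Delta)\circ\alpha$ and $\overline{\mathrm{Lin}}\,\alpha(\mathsf{A})(1\otimes\mathrm{C}(\mathbb{G}))=\mathsf{A}\otimes\mathrm{C}(\mathbb{G})$. Actions of a classical compact group $G$ on $\mathrm{C}(X)$, $X$ compact, correspond to continuous actions of $G$ on $X$. Orthogonal filtrations. An orthogonal filtration of $\mathsf{A}$ is a faithful state $\omega$ with a family $(V_i)_{i\in\mathcal{I}}$ of finite-dimensional subspaces such that $V_0=\mathbb{C}1$ for a distinguished index $0$, $\omega(a^*b)=0$ for $a\in V_i,b\in V_j$, $i\ne j$, and $\mathrm{Lin}\bigcup_iV_i$ is a dense $*$-subalgebra.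 The quantum symmetry group of $(\mathsf{A},(V_i))$ is the universal compact quantum group $\mathbb{G}_u$ with an action $\alpha_u$ on $\mathsf{A}$ satisfying $\alpha_u(V_i)\subset V_i\odot\mathrm{C}(\mathbb{G}_u)$ for all $i$: for any compact quantum group $\mathbb{G}$ with an action $\alpha$ with $\alpha(V_i)\subset V_i\odot\mathrm{C}(\mathbb{G})$ for all $i$ there is a unique morphism $\gamma\colon\mathrm{C}(\mathbb{G}_u)\to\mathrm{C}(\mathbb{G})$ with $\alpha=(\mathrm{id}\otimes\gamma)\circ\alpha_u$. (Existence is a theorem of Banica and Skalski.) The filtration $\mathcal{V}_\infty$. For $l\in\mathbb{N}$ let $\Gamma_l=\widehat{\mathbb{Z}/l\mathbb{Z}}$, a cyclic group of order $l$ (written additively) with canonical generator $e_l$; write $\lambda^{(l)}_t\in\mathrm{C}^*(\Gamma_l)\cong\mathrm{C}(\mathbb{Z}/l\mathbb{Z})$ for the element corresponding to $te_l$. The reductions $\mathbb{Z}/p^{n+1}\mathbb{Z}\to\mathbb{Z}/p^n\mathbb{Z}$ induce injective morphisms $\iota_n\colon\mathrm{C}^*(\Gamma_{p^n})\to\mathrm{C}^*(\Gamma_{p^{n+1}})$ with $\iota_n(\lambda^{(p^n)}_1)=\lambda^{(p^{n+1})}_p$, and $\mathrm{C}(\mathbb{Z}_p)$ is the inductive limit of this system. Let $\mathcal{V}_n$ be the filtration of $\mathrm{C}^*(\Gamma_{p^n})$, orthogonal with respect to the canonical trace, consisting of the spans of the sets of elements of $\Gamma_{p^n}$ of equal word-length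 with respect to the generating set $\{e_{p^n},-e_{p^n}\}$, i.e. of the subspaces $\mathrm{span}\{\lambda^{(p^n)}_t,\lambda^{(p^n)}_{-t}\}$. The filtration $\mathcal{V}_\infty$ consists of the images in $\mathrm{C}(\mathbb{Z}_p)$ of all subspaces belonging to $\mathcal{V}_n$, $n\in\mathbb{N}$; equivalently, of the subspaces $\mathrm{span}\{\chi,\overline{\chi}\}$ for $\chi$ a continuous character of $\mathbb{Z}_p$. It is orthogonal with respect to the state given by the Haar measure of $\mathbb{Z}_p$. *)

(* Defs.v *)
From HB Require Import structures.
From mathcomp Require Import all_boot all_order all_algebra.
From mathcomp Require Import all_classical all_reals all_analysis.
From mathcomp Require Import complex.
Set Implicit Arguments.
Unset Strict Implicit.
Unset Printing Implicit Defensive.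
Import Order.TTheory GRing.Theory Num.Theory.
Import numFieldNormedType.Exports ComplexField.Normc.
Local Open Scope ring_scope.
Local Open Scope classical_set_scope.
Local Open Scope complex_scope.

HB.mixin Record Algebra_isCStar (R : realType) A & GRing.Algebra R[i] A := {
  star : A -> A;
  cnorm : A -> R;
  starD : {morph star : x y / x + y};
  starZ : forall (c : R[i]) (x : A), star (c *: x) = c^* *: star x;
  starM : forall x y : A, star (x * y) = star y * star x;
  starK : involutive star;
  cnorm0_eq0 : forall x : A, cnorm x = 0 -> x = 0;
  cnormD : forall x y : A, cnorm (x + y) <= cnorm x + cnorm y;
  cnormZ : forall (c : R[i]) (x : A), cnorm (c *: x) = normc c * cnorm x;
  cnormM : forall x y : A, cnorm (x * y) <= cnorm x * cnorm y;
  cnorm_starM : forall x : A, cnorm (star x * x) = cnorm x ^+ 2;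
  cnorm_complete : forall u : nat -> A,
    (forall e : R, 0 < e -> exists N : nat, forall m n : nat,
       (N <= m)%N -> (N <= n)%N -> cnorm (u m - u n) < e) ->
    exists l : A, forall e : R, 0 < e -> exists N : nat, forall n : nat,
       (N <= n)%N -> cnorm (u n - l) < e
}.

#[short(type="cstarType")]
HB.structure Definition CStar (R : realType) :=
  {A of GRing.Algebra R[i] A & Algebra_isCStar R A}.

Section CStarTheory.
Variable R : realType.
Local Notation C := R[i].

Definition lin (V : lmodType C) (S : set V) : set V :=
  [set x | exists (n : nat) (c : 'I_n -> C) (v : 'I_n -> V),
     (forall i, S (v i)) /\ x = \sum_i c i *: v i].

Definition cdense (A : cstarType R) (S : set A) : Prop :=
  forall (x : A) (e : R), 0 < e -> exists2 y, S y & cnorm (x - y) < e.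

Definition star_hom (A B : cstarType R) (f : A -> B) : Prop :=
  [/\ linear f, f 1 = 1, {morph f : x y / x * y} & {morph f : x / star x}].

Definition is_state (A : cstarType R) (phi : A -> C) : Prop :=
  [/\ scalar phi, phi 1 = 1 & forall a : A, 0 <= phi (star a * a)].

Definition is_faithful (A : cstarType R) (phi : A -> C) : Prop :=
  forall a : A, phi (star a * a) = 0 -> a = 0.

(* A finite sequence of pairs stands for the sum of the corresponding
   elementary tensors in the algebraic tensor product of A and B. *)
Definition ftmul (A B : cstarType R) (x y : seq (A * B)) : seq (A * B) :=
  [seq (u.1 * v.1, u.2 * v.2) | u <- x, v <- y].

(* (phi (x) psi)(z^* z), i.e. the square of the norm of the class of z in the
   tensor product of the GNS spaces of phi and psi. *)
Definition gns_sq (A B : cstarType R) (phi : A -> C) (psi : B -> C)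
    (z : seq (A * B)) : C :=
  \sum_(u <- z) \sum_(v <- z) phi (star u.1 * v.1) * psi (star u.2 * v.2).

(* M bounds the norm of x in the representation pi_phi (x) pi_psi on the tensor
   product of the GNS spaces, for all pairs of states.  Since the direct sum of
   all GNS representations is faithful, the least such M >= 0 is the spatial
   (= minimal) C*-norm of x. *)
Definition spatial_bound (A B : cstarType R) (x : seq (A * B)) (M : R) : Prop :=
  forall (phi : A -> C) (psi : B -> C), is_state phi -> is_state psi ->
  forall y : seq (A * B),
    gns_sq phi psi (ftmul x y) <= (M ^+ 2)%:C * gns_sq phi psi y.

(* The minimal tensor product of A and B: a completion of the algebraic tensor
   product for the spatial norm (unique up to a unique isomorphism).  The field
   tens_free says that the algebraic tensor product embeds. *)
Record mintensor (A B : cstarType R) := MinTensor {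
  mintensor_alg :> cstarType R;
  tens : A -> B -> mintensor_alg;
  tens_linl : forall b : B, linear (tens^~ b);
  tens_linr : forall a : A, linear (tens a);
  tens1 : tens 1 1 = 1;
  tensM : forall a a' b b', tens a b * tens a' b' = tens (a * a') (b * b');
  tens_star : forall a b, star (tens a b) = tens (star a) (star b);
  tens_free : forall (n : nat) (a : 'I_n -> A) (b : 'I_n -> B),
    (forall c : 'I_n -> C, \sum_i c i *: a i = 0 -> forall i, c i = 0) ->
    \sum_i tens (a i) (b i) = 0 -> forall i, b i = 0;
  tens_dense :
    cdense (lin [set tens a b | a in [set: A] & b in [set: B]]);
  tens_norm : forall (x : seq (A * B)) (M : R), 0 <= M ->
    cnorm (\sum_(u <- x) tens u.1 u.2) <= M <-> spatial_bound x M
}.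

Definition tensor_map (A B A' B' : cstarType R)
    (T : mintensor A B) (T' : mintensor A' B')
    (f : A -> A') (g : B -> B') (h : T -> T') : Prop :=
  star_hom h /\ forall a b, h (tens T a b) = tens T' (f a) (g b).

Definition associator (A B D : cstarType R)
    (T : mintensor A B) (T3 : mintensor T D)
    (S : mintensor B D) (S3 : mintensor A S) (s : T3 -> S3) : Prop :=
  star_hom s /\
  forall a b d, s (tens T3 (tens T a b) d) = tens S3 a (tens S b d).

(* (alpha (x) id) o alpha = (id (x) Delta) o alpha, the two iterated tensor
   products being identified by the associator. *)
Definition coassociative (A B : cstarType R)
    (T : mintensor A B) (D : mintensor B B)
    (alpha : A -> T) (Delta : B -> D) : Prop :=
  exists (T3 : mintensor T B) (S3 : mintensor A D)
    (alpha_id : T -> T3) (id_Delta : T -> S3) (s : T3 -> S3),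
  [/\ tensor_map alpha id alpha_id, tensor_map id Delta id_Delta,
      associator s & forall a, s (alpha_id (alpha a)) = id_Delta (alpha a)].

Record cqg := CQG {
  cqg_alg :> cstarType R;
  cqg_tens : mintensor cqg_alg cqg_alg;
  comul : cqg_alg -> cqg_tens;
  comul_hom : star_hom comul;
  comul_coassoc : coassociative comul comul;
  comul_densel : cdense
    (lin [set comul a * tens cqg_tens b 1 | a in setT & b in setT]);
  comul_denser : cdense
    (lin [set comul a * tens cqg_tens 1 b | a in setT & b in setT])
}.

Definition cqg_morphism (G1 G2 : cqg) (gamma : G2 -> G1) : Prop :=
  star_hom gamma /\
  exists2 gamma2 : cqg_tens G2 -> cqg_tens G1,
    tensor_map gamma gamma gamma2 &
    forall a, comul (gamma a) = gamma2 (comul a).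

Record qaction (A : cstarType R) (G : cqg) := QAction {
  act_tens : mintensor A G;
  act_map :> A -> act_tens;
  act_hom : star_hom act_map;
  act_coassoc : coassociative act_map (@comul G);
  act_dense : cdense
    (lin [set act_map a * tens act_tens 1 b | a in setT & b in setT])
}.

(* beta = (id (x) gamma) o alpha *)
Definition factors_through (A : cstarType R) (G H : cqg)
    (alpha : qaction A G) (beta : qaction A H) (gamma : G -> H) : Prop :=
  exists2 h : act_tens alpha -> act_tens beta,
    tensor_map id gamma h & forall a, beta a = h (alpha a).

Definition orthogonal_filtration (A : cstarType R) (omega : A -> C)
    (I : Type) (V : I -> set A) : Prop :=
  [/\ is_state omega /\ is_faithful omega,
      forall i, exists s : seq A, V i = lin [set` s],
      exists i0, V i0 = lin [set 1],
      forall i j, i <> j -> forall a b, V i a -> V j b ->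
        omega (star a * b) = 0 &
      let L := lin (\bigcup_i V i) in
      [/\ cdense L, forall a b, L a -> L b -> L (a * b) &
          forall a, L a -> L (star a)]].

Definition preserves (A : cstarType R) (I : Type) (V : I -> set A)
    (G : cqg) (alpha : qaction A G) : Prop :=
  forall i v, V i v ->
    lin [set tens (act_tens alpha) w b | w in V i & b in setT] (alpha v).

Definition is_quantum_symmetry_group (A : cstarType R) (I : Type)
    (V : I -> set A) (Gu : cqg) (alphau : qaction A Gu) : Prop :=
  preserves V alphau /\
  forall (G : cqg) (alpha : qaction A G), preserves V alpha ->
    exists! gamma : Gu -> G,
      cqg_morphism gamma /\ factors_through alphau alpha gamma.

End CStarTheory.

HB.mixin Record isCompactHausdorff X & PointedTopological X := {
  compact_space : compact [set: X];
  hausdorff_axiom : hausdorff_space X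
}.

#[short(type="compactType")]
HB.structure Definition CompactHausdorff :=
  {X of PointedTopological X & isCompactHausdorff X}.

HB.mixin Record isTopologicalGroup X & PointedTopological X & Group X := {
  mulg_continuous : continuous (fun u : X * X => (u.1 * u.2)%g);
  invg_continuous : continuous (fun x : X => (x^-1)%g)
}.

#[short(type="compactGroupType")]
HB.structure Definition CompactGroup :=
  {X of CompactHausdorff X & Group X & isTopologicalGroup X}.

HB.instance Definition _ := Pointed.on bool.
HB.instance Definition _ (X Y : ptopologicalType) := Pointed.on (X * Y)%type.

Lemma hausdorff_prod (X Y : topologicalType) :
  hausdorff_space X -> hausdorff_space Y -> hausdorff_space (X * Y)%type.
Proof.
move=> hX hY [x y] [x' y'] cl; congr (_, _).
- apply: hX => A B Ax Bx'.
  have [[a b] [/= [Aa _] [Ba _]]] := cl (A `*` setT) (B `*` setT)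
    ltac:(by exists (A, setT) => //=; split => //; exact: filterT)
    ltac:(by exists (B, setT) => //=; split => //; exact: filterT).
  by exists a.
- apply: hY => A B Ay By'.
  have [[a b] [/= [_ Ab] [_ Bb]]] := cl (setT `*` A) (setT `*` B)
    ltac:(by exists (setT, A) => //=; split => //; exact: filterT)
    ltac:(by exists (setT, B) => //=; split => //; exact: filterT).
  by exists b.
Qed.

HB.instance Definition _ := isCompactHausdorff.Build bool bool_compact
  (@discrete_hausdorff bool).

Lemma compact_prod (X Y : compactType) : compact [set: X * Y].
Proof.
by rewrite -setXTT; apply: compact_setX; exact: compact_space.
Qed.

HB.instance Definition _ (X Y : compactType) :=
  isCompactHausdorff.Build (X * Y)%type (@compact_prod X Y)
    (hausdorff_prod (@hausdorff_axiom X) (@hausdorff_axiom Y)).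

Section ContinuousFunctions.
Variables (R : realType) (X : compactType).
Local Notation C := R[i].

Record cfun := CFun {
  cfun_fun :> X -> C;
  cfun_continuous : continuous (cfun_fun : X -> C^o)
}.

Lemma cfunP (f g : cfun) : (forall x, f x = g x) -> f = g.
Proof.
case: f g => [f cf] [g cg] /= /funext fg; rewrite fg in cf *.
by congr CFun; exact: Prop_irrelevance.
Qed.

HB.instance Definition _ := gen_eqMixin cfun.
HB.instance Definition _ := gen_choiceMixin cfun.

Lemma cfun_cst_subproof (c : C) : continuous ((fun=> c) : X -> C^o).
Proof. by move=> x; exact: cvg_cst. Qed.
Definition cfun_cst c := CFun (@cfun_cst_subproof c).

Lemma cfun_add_subproof (f g : cfun) :
  continuous (fun x => f x + g x : C^o).
Proof.
move=> x; exact: (cvgD (@cfun_continuous f x) (@cfun_continuous g x)).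
Qed.
Definition cfun_add f g := CFun (@cfun_add_subproof f g).

Lemma cfun_mul_subproof (f g : cfun) :
  continuous (fun x => f x * g x : C^o).
Proof.
move=> x.
exact: (@cvgM C X _ _ f g _ _ (@cfun_continuous f x) (@cfun_continuous g x)).
Qed.
Definition cfun_mul f g := CFun (@cfun_mul_subproof f g).

Lemma cfun_conj_subproof (f : cfun) : continuous (fun x => (f x)^* : C^o).
Proof.
move=> x; apply/cvgrPdist_lt => e e0.
have /cvgrPdist_lt/(_ e e0) := @cfun_continuous f x.
apply: filterS => t; rewrite -rmorphB /=.
by case: (f x - f t) => a b; rewrite !normc_def /= sqrrN.
Qed.
Definition cfun_conj f := CFun (@cfun_conj_subproof f).

Definition cfun_opp f := cfun_mul (cfun_cst (-1)) f.
Definition cfun_scale c f := cfun_mul (cfun_cst c) f.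

Fact cfun_addA : associative cfun_add.
Proof. by move=> f g h; apply: cfunP => x /=; rewrite addrA. Qed.
Fact cfun_addC : commutative cfun_add.
Proof. by move=> f g; apply: cfunP => x /=; rewrite addrC. Qed.
Fact cfun_add0 : left_id (cfun_cst 0) cfun_add.
Proof. by move=> f; apply: cfunP => x /=; rewrite add0r. Qed.
Fact cfun_addN : left_inverse (cfun_cst 0) cfun_opp cfun_add.
Proof. by move=> f; apply: cfunP => x /=; rewrite mulN1r addNr. Qed.
HB.instance Definition _ :=
  GRing.isZmodule.Build cfun cfun_addA cfun_addC cfun_add0 cfun_addN.

Fact cfun_mulA : associative cfun_mul.
Proof. by move=> f g h; apply: cfunP => x /=; rewrite mulrA. Qed.
Fact cfun_mul1 : left_id (cfun_cst 1) cfun_mul.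
Proof. by move=> f; apply: cfunP => x /=; rewrite mul1r. Qed.
Fact cfun_mulr1 : right_id (cfun_cst 1) cfun_mul.
Proof. by move=> f; apply: cfunP => x /=; rewrite mulr1. Qed.
Fact cfun_mulDl : left_distributive cfun_mul cfun_add.
Proof. by move=> f g h; apply: cfunP => x /=; rewrite mulrDl. Qed.
Fact cfun_mulDr : right_distributive cfun_mul cfun_add.
Proof. by move=> f g h; apply: cfunP => x /=; rewrite mulrDr. Qed.
Fact cfun_1neq0 : cfun_cst 1 != cfun_cst 0.
Proof.
by apply/eqP => /(congr1 (@^~ point \o cfun_fun)) /eqP; rewrite /= oner_eq0.
Qed.
HB.instance Definition _ := GRing.Zmodule_isNzRing.Build cfun
  cfun_mulA cfun_mul1 cfun_mulr1 cfun_mulDl cfun_mulDr cfun_1neq0.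

Fact cfun_scaleA (a b : C) f : cfun_scale a (cfun_scale b f) =
  cfun_scale (a * b) f.
Proof. by apply: cfunP => x /=; rewrite mulrA. Qed.
Fact cfun_scale1 : left_id 1 cfun_scale.
Proof. by move=> f; apply: cfunP => x /=; rewrite mul1r. Qed.
Fact cfun_scaleDr : right_distributive cfun_scale +%R.
Proof. by move=> c f g; apply: cfunP => x /=; rewrite mulrDr. Qed.
Fact cfun_scaleDl f : {morph cfun_scale^~ f : a b / a + b}.
Proof. by move=> a b; apply: cfunP => x /=; rewrite mulrDl. Qed.
HB.instance Definition _ := GRing.Zmodule_isLmodule.Build C cfun
  cfun_scaleA cfun_scale1 cfun_scaleDr cfun_scaleDl.

Fact cfun_scaleAl (c : C) (f g : cfun) : c *: (f * g) = (c *: f) * g.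
Proof. by apply: cfunP => x /=; rewrite mulrA. Qed.
HB.instance Definition _ := GRing.Lmodule_isLalgebra.Build C cfun cfun_scaleAl.

Fact cfun_scaleAr (c : C) (f g : cfun) : c *: (f * g) = f * (c *: g).
Proof. by apply: cfunP => x /=; rewrite mulrCA. Qed.
HB.instance Definition _ := GRing.Lalgebra_isAlgebra.Build C cfun cfun_scaleAr.

Definition cfun_norm (f : cfun) : R := sup (range (fun x => normc (f x))).

Lemma normcE (c : C) : `|c| = (normc c)%:C. Proof. by []. Qed.

Lemma normc_triangle (a b : C) : normc (a + b) <= normc a + normc b.
Proof. by rewrite -lecR rmorphD /= -!normcE ler_normD. Qed.

Lemma normcC (a : C) : normc a^* = normc a.
Proof. by case: a => a b /=; rewrite sqrrN. Qed.

Lemma normcN (a : C) : normc (- a) = normc a.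
Proof. by case: a => a b /=; rewrite !sqrrN. Qed.

Lemma normc_continuous (f : cfun) : continuous (fun x => normc (f x)).
Proof.
move=> x; apply/cvgrPdist_lt => e e0.
have e0' : 0 < e%:C :> C by rewrite ltcR.
have /cvgrPdist_lt/(_ _ e0') := @cfun_continuous f x.
apply: filterS => t; rewrite normcE ltcR; apply: le_lt_trans.
rewrite ler_norml lerBlDr lerNl opprB lerBlDr; apply/andP; split.
  by rewrite -[normc (f x - f t)]normcN opprB;
    apply: le_trans (normc_triangle _ _); rewrite subrK.
by apply: le_trans (normc_triangle _ _); rewrite subrK.
Qed.

Lemma cfun_norm_has_sup (f : cfun) : has_sup (range (fun x => normc (f x))).
Proof.
split; first by exists (normc (f point)), point.
have [c _ cM] := @compact_EVT_max X R (fun x => normc (f x)) setT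
  (ex_intro _ point I) (@compact_space X)
  (continuous_subspaceT (@normc_continuous f)).
by exists (normc (f c)) => _ [x _ <-]; apply: cM; rewrite inE.
Qed.

Lemma le_cfun_norm (f : cfun) x : normc (f x) <= cfun_norm f.
Proof. by apply: sup_upper_bound; [exact: cfun_norm_has_sup | exists x]. Qed.

Lemma cfun_norm_le (f : cfun) M : (forall x, normc (f x) <= M) ->
  cfun_norm f <= M.
Proof.
move=> fM; apply: ge_sup; first by case: (cfun_norm_has_sup f).
by move=> _ [x _ <-].
Qed.

Lemma normc_ge0 (c : C) : 0 <= normc c.
Proof. by rewrite -ler0c -normcE normr_ge0. Qed.

Lemma cfun_norm_ge0 (f : cfun) : 0 <= cfun_norm f.
Proof. exact: le_trans (normc_ge0 _) (le_cfun_norm f point). Qed.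

Fact cfun_norm0_eq0 (f : cfun) : cfun_norm f = 0 -> f = 0.
Proof.
move=> f0; apply: cfunP => x; apply: (@eq0_normc R (f x)); apply/eqP.
by rewrite eq_le normc_ge0 andbT -f0 le_cfun_norm.
Qed.

Fact cfun_normD (f g : cfun) : cfun_norm (f + g) <= cfun_norm f + cfun_norm g.
Proof.
apply: cfun_norm_le => x; apply: le_trans (normc_triangle _ _) _.
by apply: lerD; exact: le_cfun_norm.
Qed.

Fact cfun_normM (f g : cfun) : cfun_norm (f * g) <= cfun_norm f * cfun_norm g.
Proof.
apply: cfun_norm_le => x /=; rewrite normcM.
by apply: ler_pM; rewrite ?normc_ge0 ?le_cfun_norm.
Qed.

Fact cfun_normZ (c : C) (f : cfun) : cfun_norm (c *: f) = normc c * cfun_norm f.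
Proof.
apply/eqP; rewrite eq_le; apply/andP; split.
  apply: cfun_norm_le => x /=; rewrite normcM.
  by apply: ler_wpM2l; rewrite ?normc_ge0 ?le_cfun_norm.
have [->|c0] := eqVneq (normc c) 0; first by rewrite mul0r cfun_norm_ge0.
have cp : 0 < normc c by rewrite lt_neqAle eq_sym c0 normc_ge0.
rewrite mulrC -ler_pdivlMr //; apply: cfun_norm_le => x.
rewrite ler_pdivlMr // mulrC -normcM.
exact: (le_cfun_norm (c *: f)).
Qed.

Fact cfun_norm_conjM (f : cfun) :
  cfun_norm (cfun_conj f * f) = cfun_norm f ^+ 2.
Proof.
apply/eqP; rewrite eq_le; apply/andP; split.
  apply: le_trans (cfun_normM _ _) _; rewrite expr2.
  apply: ler_wpM2r; first exact: cfun_norm_ge0.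
  by apply: cfun_norm_le => x /=; rewrite normcC le_cfun_norm.
rewrite -[leRHS]sqr_sqrtr ?cfun_norm_ge0 //.
rewrite lerXn2r ?nnegrE ?sqrtr_ge0 ?cfun_norm_ge0 //.
apply: cfun_norm_le => x; rewrite -[leLHS]ger0_norm ?normc_ge0 // -sqrtr_sqr.
rewrite ler_sqrt ?cfun_norm_ge0 //.
by apply: le_trans (le_cfun_norm _ x) => /=; rewrite normcM normcC expr2.
Qed.

Lemma normc_Re (c : C) : `|complex.Re c| <= normc c.
Proof.
case: c => a b /=; rewrite -sqrtr_sqr ler_sqrt ?addr_ge0 ?sqr_ge0 //.
by rewrite lerDl sqr_ge0.
Qed.

Lemma normc_Im (c : C) : `|complex.Im c| <= normc c.
Proof.
case: c => a b /=; rewrite -sqrtr_sqr ler_sqrt ?addr_ge0 ?sqr_ge0 //.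
by rewrite lerDr sqr_ge0.
Qed.

Lemma normc_le_ReIm (c : C) :
  normc c <= `|complex.Re c| + `|complex.Im c|.
Proof.
case: c => a b /=.
rewrite -[leRHS]ger0_norm ?addr_ge0 // -sqrtr_sqr ler_sqrt ?sqr_ge0 //.
by rewrite sqrrD !real_normK ?num_real // addrAC lerDl mulrn_wge0 ?mulr_ge0.
Qed.

Lemma real_cauchy_cvg (u : nat -> R) :
  (forall e, 0 < e -> exists N, forall m n, (N <= m)%N -> (N <= n)%N ->
     `|u m - u n| < e) ->
  exists l, forall e, 0 < e -> exists N, forall n, (N <= n)%N ->
     `|u n - l| < e.
Proof.
move=> cu; have : cvg (u @ \oo).
  apply/cauchy_cvgP/cauchy_exP => e e0; have [N NP] := cu _ e0.
  exists (u N); exists N => // n /= Nn.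
  exact: (NP _ _ (leqnn N) Nn).
move=> /cvg_ex[l /cvgrPdist_lt ul]; exists l => e e0.
have [N _ NP] := ul _ e0; exists N => n Nn.
by rewrite distrC; exact: NP.
Qed.

Fact cfun_norm_complete (u : nat -> cfun) :
  (forall e : R, 0 < e -> exists N : nat, forall m n : nat,
     (N <= m)%N -> (N <= n)%N -> cfun_norm (u m - u n) < e) ->
  exists l : cfun, forall e : R, 0 < e -> exists N : nat, forall n : nat,
     (N <= n)%N -> cfun_norm (u n - l) < e.
Proof.
move=> cu.
have lP x : exists l : C, forall e, 0 < e -> exists N, forall n, (N <= n)%N ->
    normc (u n x - l) < e.
  have subE m n : (u m - u n) x = u m x - u n x :> C by rewrite /= mulN1r.
  have [|a aP] := @real_cauchy_cvg (fun n => complex.Re (u n x)).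
    move=> e /cu[N NP]; exists N => m n Nm Nn; apply: le_lt_trans (NP m n Nm Nn).
    apply: le_trans (le_cfun_norm _ x); rewrite subE -raddfB.
    exact: normc_Re.
  have [|b bP] := @real_cauchy_cvg (fun n => complex.Im (u n x)).
    move=> e /cu[N NP]; exists N => m n Nm Nn; apply: le_lt_trans (NP m n Nm Nn).
    apply: le_trans (le_cfun_norm _ x); rewrite subE -raddfB.
    exact: normc_Im.
  exists (a +i* b) => e e0.
  have e20 : 0 < e / 2 by rewrite divr_gt0.
  have [N1 N1P] := aP _ e20; have [N2 N2P] := bP _ e20.
  exists (maxn N1 N2) => n; rewrite geq_max => /andP[nN1 nN2].
  apply: le_lt_trans (normc_le_ReIm _) _; rewrite (splitr e).
  move: (N1P _ nN1) (N2P _ nN2); case: (u n x) => /= c d.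
  exact: ltrD.
pose l x := projT1 (cid (lP x)).
have lxP x : forall e, 0 < e -> exists N, forall n, (N <= n)%N ->
  normc (u n x - l x) < e := projT2 (cid (lP x)).
have ul e : 0 < e -> exists N, forall n, (N <= n)%N ->
    forall x, normc (u n x - l x) <= e.
  move=> e0; have e20 : 0 < e / 2 by rewrite divr_gt0.
  have [N NP] := cu _ e20; exists N => n Nn x.
  have [M MP] := lxP x _ e20.
  rewrite -(subrK (u (maxn M N) x) (u n x)) -addrA (splitr e).
  apply: le_trans (normc_triangle _ _) _; apply: lerD.
    apply/ltW/(le_lt_trans _ (NP n (maxn M N) Nn (leq_maxr _ _))).
    by apply: le_trans (le_cfun_norm _ x); rewrite /= mulN1r.
  exact/ltW/MP/leq_maxl.
have cl : continuous (l : X -> C^o).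
  move=> x; apply/cvgrPdist_lt => -[e d] /=; rewrite ltcE /= => /andP[/eqP-> e0].
  have e30 : 0 < e / 3 by rewrite divr_gt0.
  have [N NP] := ul _ e30.
  have e30' : 0 < (e / 3)%:C :> C by rewrite ltcR.
  have /cvgrPdist_lt/(_ _ e30') := @cfun_continuous (u N) x.
  apply: filterS => t; rewrite !normcE !ltcR => ut.
  have -> : l x - l t =
      - (u N x - l x) + ((u N x - u N t) + (u N t - l t)).
    by rewrite opprB !addrA !subrK.
  have -> : e = e / 3 + (e / 3 + e / 3).
    rewrite -!mulrDl (_ : e + (e + e) = e * 3) ?mulfK ?pnatr_eq0 //.
    by rewrite mulr_natr !mulrS mulr0n addr0.
  apply: le_lt_trans (normc_triangle _ _) _; apply: ler_ltD.
    by rewrite normcN NP.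
  apply: le_lt_trans (normc_triangle _ _) _; apply: ltr_leD => //.
  exact: NP.
exists (CFun cl) => e e0; have e20 : 0 < e / 2 by rewrite divr_gt0.
have [N NP] := ul _ e20; exists N => n Nn.
apply: (@le_lt_trans _ _ (e / 2)); last by rewrite gtr_pMr // invf_lt1 // ltr1n.
by apply: cfun_norm_le => x /=; rewrite mulN1r; exact: NP.
Qed.

Fact cfun_conjD : {morph cfun_conj : f g / f + g}.
Proof. by move=> f g; apply: cfunP => x /=; rewrite rmorphD. Qed.
Fact cfun_conjZ (c : C) (f : cfun) : cfun_conj (c *: f) = c^* *: cfun_conj f.
Proof. by apply: cfunP => x /=; rewrite rmorphM. Qed.
Fact cfun_conjM (f g : cfun) : cfun_conj (f * g) = cfun_conj g * cfun_conj f.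
Proof. by apply: cfunP => x /=; rewrite rmorphM mulrC. Qed.
Fact cfun_conjK : involutive cfun_conj.
Proof. by move=> f; apply: cfunP => x /=; rewrite conjcK. Qed.

HB.instance Definition _ := Algebra_isCStar.Build R cfun
  cfun_conjD cfun_conjZ cfun_conjM cfun_conjK
  cfun_norm0_eq0 cfun_normD cfun_normZ cfun_normM cfun_norm_conjM
  cfun_norm_complete.

End ContinuousFunctions.

(* Only the levels Z/p^(n+1) are used: Z/p^0 is trivial and does not affect the
   limit, and 'Z_1 would denote Z/2. *)
Definition zred (p n : nat) (k : 'Z_(p ^ n.+2)) : 'Z_(p ^ n.+1) :=
  (k : nat)%:R.

Record padic (p : nat) (hp : prime p) := Padic {
  residue : forall n, 'Z_(p ^ n.+1);
  residueP : forall n, zred (residue n.+1) = residue n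
}.

Section PadicIntegers.
Variables (p : nat) (hp : prime p).
Local Notation Zp := (padic hp).

Lemma padicP (x y : Zp) : (forall n, residue x n = residue y n) -> x = y.
Proof.
case: x y => [x xP] [y yP] /= xy.
have {}xy : x = y by exact: functional_extensionality_dep.
by rewrite xy in xP *; congr Padic; exact: Prop_irrelevance.
Qed.

HB.instance Definition _ := gen_eqMixin Zp.
HB.instance Definition _ := gen_choiceMixin Zp.

Lemma ppow_gt1 n : (1 < p ^ n.+1)%N.
Proof. by rewrite -(exp1n n.+1) ltn_exp2r // prime_gt1. Qed.

Lemma zredD n (x y : 'Z_(p ^ n.+2)) : zred (x + y) = zred x + zred y.
Proof.
have addE m (a b : 'Z_(p ^ m.+1)) :
    nat_of_ord (a + b) = ((a + b) %% p ^ m.+1)%N.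
  transitivity ((a + b) %% (Zp_trunc (p ^ m.+1)).+2)%N; first by [].
  by congr (_ %% _)%N; exact: Zp_cast (ppow_gt1 m).
have redE (a : 'Z_(p ^ n.+2)) : nat_of_ord (zred a) = (a %% p ^ n.+1)%N.
  by rewrite /zred val_Zp_nat // ppow_gt1.
apply: ord_inj; rewrite redE !addE !redE modnDm modn_dvdm //.
by rewrite dvdn_exp2l.
Qed.

Lemma zred0 n : zred (0 : 'Z_(p ^ n.+2)) = 0.
Proof. by []. Qed.

Lemma zredN n (x : 'Z_(p ^ n.+2)) : zred (- x) = - zred x.
Proof. by apply/eqP; rewrite -addr_eq0 -zredD addNr zred0. Qed.

Lemma padic_zero_subproof n : zred (0 : 'Z_(p ^ n.+2)) = 0.
Proof. exact: zred0. Qed.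
Definition padic_zero : Zp := Padic hp padic_zero_subproof.

Lemma padic_add_subproof (x y : Zp) n :
  zred (residue x n.+1 + residue y n.+1) = residue x n + residue y n.
Proof. by rewrite zredD !residueP. Qed.
Definition padic_add (x y : Zp) : Zp := Padic hp (padic_add_subproof x y).

Lemma padic_opp_subproof (x : Zp) n : zred (- residue x n.+1) = - residue x n.
Proof. by rewrite zredN residueP. Qed.
Definition padic_opp (x : Zp) : Zp := Padic hp (padic_opp_subproof x).

Fact padic_addA : associative padic_add.
Proof. by move=> x y z; apply: padicP => n /=; rewrite addrA. Qed.
Fact padic_addC : commutative padic_add.
Proof. by move=> x y; apply: padicP => n /=; rewrite addrC. Qed.
Fact padic_add0 : left_id padic_zero padic_add.
Proof. by move=> x; apply: padicP => n /=; rewrite add0r. Qed.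
Fact padic_addN : left_inverse padic_zero padic_opp padic_add.
Proof. by move=> x; apply: padicP => n /=; rewrite addNr. Qed.
HB.instance Definition _ :=
  GRing.isZmodule.Build Zp padic_addA padic_addC padic_add0 padic_addN.

HB.instance Definition _ := isPointed.Build Zp 0.

Definition residues (x : Zp) :
  prod_topology (fun n => discrete_topology 'Z_(p ^ n.+1)) := residue x.

HB.instance Definition _ := Topological.copy Zp (initial_topology residues).

Lemma residue_continuous n :
  continuous (fun x : Zp => residue x n : discrete_topology 'Z_(p ^ n.+1)).
Proof.
move=> x; pose K n := discrete_topology 'Z_(p ^ n.+1).
have := @continuous_comp Zp (prod_topology K) (K n) residues (proj n) x
  (@initial_continuous Zp (prod_topology K) residues x)
  (@proj_continuous _ K n (residues x)).
by apply.
Qed.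

Lemma nbhs_residue (x : Zp) n :
  nbhs x [set y : Zp | residue y n = residue x n].
Proof.
exact (@residue_continuous n x _
  (@discrete_set1 (discrete_topology 'Z_(p ^ n.+1)) (residue x n))).
Qed.

Lemma padic_continuousP (T : topologicalType) (f : T -> Zp) :
  (forall t n, \forall s \near t, residue (f s) n = residue (f t) n) ->
  continuous f.
Proof.
move=> ft; pose K n := discrete_topology 'Z_(p ^ n.+1).
apply: (@continuous_comp_initial Zp T (prod_topology K) residues).
move=> t; apply/cvg_sup => n; apply/cvg_image.
  rewrite predeqE => k; split=> // _.
  by exists (dfwith (residues (f t)) n k); rewrite ?dfwithin.
move=> U /principal_filterP Un.
exists (@^~ n @^-1` U).
  apply: filterS (ft t n) => s /= sn.
  by move: Un; rewrite /= /residues sn.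
rewrite predeqE => k; split=> [[x Ux <-]//|Uk].
by exists (dfwith (residues (f t)) n k); rewrite /= ?dfwithin.
Qed.

Lemma padic_hausdorff : hausdorff_space Zp.
Proof.
move=> x y cl; apply: padicP => n.
have [z [/= <- <-]] := cl _ _ (nbhs_residue x n) (nbhs_residue y n).
by [].
Qed.

Lemma padic_compact : compact [set: Zp].
Proof.
pose K n := discrete_topology 'Z_(p ^ n.+1).
have nbhsK (f : prod_topology K) n : nbhs f [set g : prod_topology K | g n = f n].
  exact (@proj_continuous _ K n f _ (@discrete_set1 (K n) (f n))).
have rcl : closed (range residues : set (prod_topology K)).
  move=> f clf.
  have fP n : zred (f n.+1) = f n.
    have [_ [[x _ <-] /= [xn xSn]]] := clf _ (filterI (nbhsK f n) (nbhsK f n.+1)).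
    by rewrite -xn -xSn; exact: residueP.
  by exists (Padic hp fP).
have Kc : compact [set: prod_topology K].
  have := @tychonoff nat K (fun n => [set: K n])
    (fun n => @finite_compact (K n) setT (@finite_finset 'Z_(p ^ n.+1) setT)).
  by congr compact; rewrite predeqE.
have rc : compact (range residues : set (prod_topology K)).
  by apply: (subclosed_compact rcl Kc).
move=> F PF _.
have FR : (residues @ F) (range residues).
  by apply: (@filterS _ F _ setT) => [y _|]; [exists y | exact: filterT].
have [_ [[x _ <-] clx]] := rc _ (fmap_proper_filter residues PF) FR.
exists x; split => // A B FA [_ [[W oW <-] Wx WB]].
have FRA : (residues @ F) (residues @` A).
  by apply: (@filterS _ F _ A) => [y Ay|]; [exists y | exact: FA].
have [_ [[y Ay <-] Wy]] := clx _ _ FRA (open_nbhs_nbhs (conj oW Wx)).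
by exists y; split => //; exact: WB.
Qed.

HB.instance Definition _ :=
  isCompactHausdorff.Build Zp padic_compact padic_hausdorff.

(* Z/2 is represented by bool, with true the generator, which acts on Z_p by
   the inverse automorphism. *)
Definition flip (e : bool) (t : Zp) : Zp := if e then - t else t.

Definition padic_sdprod : Type := (Zp * bool)%type.
HB.instance Definition _ :=
  CompactHausdorff.copy padic_sdprod (Zp * bool)%type.

Definition sd_mul (g h : padic_sdprod) : padic_sdprod :=
  (g.1 + flip g.2 h.1, g.2 (+) h.2).
Definition sd_one : padic_sdprod := (0, false).
Definition sd_inv (g : padic_sdprod) : padic_sdprod :=
  (- flip g.2 g.1, g.2).

Fact sd_mulA : associative sd_mul.
Proof.
move=> [k e] [l f] [m h]; rewrite /sd_mul /= addbA; congr (_, _).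
by case: e f => -[] /=; rewrite ?opprD ?opprK !addrA.
Qed.
Fact sd_mul1 : left_id sd_one sd_mul.
Proof. by move=> [k e]; rewrite /sd_mul /= add0r. Qed.
Fact sd_mulr1 : right_id sd_one sd_mul.
Proof. by move=> [k []]; rewrite /sd_mul /= ?oppr0 addr0. Qed.
Fact sd_mulV : left_inverse sd_one sd_inv sd_mul.
Proof. by move=> [k []]; rewrite /sd_mul /sd_one /= ?opprK ?subrr ?addNr. Qed.
Fact sd_mulrV : right_inverse sd_one sd_inv sd_mul.
Proof. by move=> [k []]; rewrite /sd_mul /sd_one /= ?opprK ?subrr. Qed.
HB.instance Definition _ := isGroup.Build padic_sdprod
  sd_mulA sd_mul1 sd_mulr1 sd_mulV sd_mulrV.

Lemma sd_continuousP (T : topologicalType) (f : T -> padic_sdprod) :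
  (forall t n, \forall s \near t,
     residue (f s).1 n = residue (f t).1 n /\ (f s).2 = (f t).2) ->
  continuous f.
Proof.
move=> fP t U [[A B] /= [At /principal_filterP Bt] AB].
have c1 : continuous (fst \o f).
  by apply: padic_continuousP => s n; apply: filterS (fP s n) => r [].
have c1t : nbhs t (fun s => A (f s).1) := c1 t _ At.
rewrite /nbhs /=; apply: filterS2 c1t (fP t 0%N) => s As [_ fs].
by apply: AB; split => //=; rewrite fs.
Qed.

Lemma sd_nbhs (g : padic_sdprod) n :
  nbhs g [set h : padic_sdprod | residue h.1 n = residue g.1 n /\ h.2 = g.2].
Proof.
exists ([set x | residue x n = residue g.1 n], [set g.2]).
  by split; [exact: nbhs_residue | exact: discrete_set1].
by move=> [].
Qed.

Fact sd_mul_continuous :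
  continuous (fun u : padic_sdprod * padic_sdprod => (u.1 * u.2)%g).
Proof.
apply: sd_continuousP => -[g h] n.
exists ([set g' : padic_sdprod | residue g'.1 n = residue g.1 n /\ g'.2 = g.2],
        [set h' : padic_sdprod | residue h'.1 n = residue h.1 n /\ h'.2 = h.2]).
  by split; exact: sd_nbhs.
move=> [[x b] [y c]] /= [[xg ->] [yh ->]]; split => //.
by case: g h xg yh => [k []] [l f] /= -> ->.
Qed.

Fact sd_inv_continuous : continuous (fun g : padic_sdprod => g^-1%g).
Proof.
apply: sd_continuousP => g n; apply: filterS (sd_nbhs g n) => -[x b] /= [xg ->].
by split => //; case: g xg => [k []] /= ->.
Qed.

HB.instance Definition _ := isTopologicalGroup.Build padic_sdprod
  sd_mul_continuous sd_inv_continuous.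

End PadicIntegers.

Section Filtration.
Variables (R : realType) (p : nat) (hp : prime p).
Local Notation C := R[i].
Local Notation Zp := (padic hp).

(* The dual group of Z/p^(n+1) is identified with 'Z_(p ^ n.+1) by means of its
   canonical generator; [lambda n t] is the function on Z/p^(n+1) given by the
   character t. *)
Definition lambda n (t s : 'Z_(p ^ n.+1)) : C :=
  let theta : R := 2 * pi * (t * s)%N%:R / (p ^ n.+1)%:R in
  cos theta +i* sin theta.

Lemma pullback_subproof n (f : 'Z_(p ^ n.+1) -> C) :
  continuous ((fun x : Zp => f (residue x n)) : Zp -> C^o).
Proof.
move=> x; apply/(@cvgrPdist_lt C C^o Zp (nbhs x) (nbhs_filter x)) => e e0.
apply: (@filterS _ _ (nbhs_filter x) [set y : Zp | residue y n = residue x n]).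
  by move=> y /= ->; rewrite subrr normr0.
exact: nbhs_residue.
Qed.

(* The embedding C(Z/p^(n+1)) -> C(Z_p) induced by Z_p -> Z/p^(n+1). *)
Definition pullback n (f : 'Z_(p ^ n.+1) -> C) : cfun R Zp :=
  CFun (@pullback_subproof n f).

Definition is_word (G : zmodType) (S : seq G) (k : nat) (t : G) : Prop :=
  exists w : seq G, [/\ size w = k, {subset w <= S} & \sum_(s <- w) s = t].

Definition word_length (G : zmodType) (S : seq G) (t : G) (k : nat) : Prop :=
  is_word S k t /\ forall j, is_word S j t -> (k <= j)%N.

(* The image in C(Z_p) of the subspace of V_(n+1) spanned by the elements of
   word-length k. *)
Definition V_level n (k : nat) : set (cfun R Zp) :=
  lin [set pullback (@lambda n t) |
       t in [set t | word_length [:: 1; - 1] t k]].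

Definition V_inf_subspaces : set (set (cfun R Zp)) :=
  [set W | exists n k,
     (exists t : 'Z_(p ^ n.+1), word_length [:: 1; - 1] t k) /\
     W = V_level n k].

(* The family is indexed by its own members, since each subspace occurs at
   infinitely many levels. *)
Definition V_inf (i : set_type V_inf_subspaces) : set (cfun R Zp) := set_val i.

Definition is_haar_state (omega : cfun R Zp -> C) : Prop :=
  is_state omega /\
  forall (k : Zp) (f g : cfun R Zp),
    (forall t, g t = f (k + t)) -> omega g = omega f.

End Filtration.

Section Classical.
Variable R : realType.

Definition star_iso (A B : cstarType R) (f : A -> B) : Prop :=
  star_hom f /\ bijective f.

(* theta identifies C(G) with C(X), and Delta with f |-> ((x, y) |-> f (xy)),
   where C(G) (x) C(G) is identified with C(X * X). *)
Definition is_classical_group (X : compactGroupType) (G : cqg R)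
    (theta : G -> cfun R X) : Prop :=
  star_iso theta /\
  exists theta2 : cqg_tens G -> cfun R (X * X)%type,
  [/\ star_iso theta2,
      forall a b x y, theta2 (tens (cqg_tens G) a b) (x, y) =
        theta a x * theta b y &
      forall a x y, theta2 (comul a) (x, y) = theta a (x * y)%g].

(* alpha is the action induced by the left action [act] of X on Y; with the
   above formula for Delta, the left action has to enter through inverses for
   alpha to satisfy (alpha (x) id) o alpha = (id (x) Delta) o alpha. *)
Definition corresponds_to_action (X : compactGroupType) (G : cqg R)
    (theta : G -> cfun R X) (Y : compactType) (act : X -> Y -> Y)
    (alpha : qaction (cfun R Y) G) : Prop :=
  exists theta' : act_tens alpha -> cfun R (Y * X)%type,
  [/\ star_iso theta',
      forall f a y x, theta' (tens (act_tens alpha) f a) (y, x) =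
        f y * theta a x &
      forall f y x, theta' (alpha f) (y, x) = f (act (x^-1)%g y)].

End Classical.

(* Main.v *)
Require Import Defs.
From HB Require Import structures.
From mathcomp Require Import all_boot all_order all_algebra.
From mathcomp Require Import all_classical all_reals all_analysis.
From mathcomp Require Import complex.
Set Implicit Arguments.
Unset Strict Implicit.
Unset Printing Implicit Defensive.
Import Order.TTheory GRing.Theory Num.Theory.
Import numFieldNormedType.Exports ComplexField.Normc.
Local Open Scope ring_scope.
Local Open Scope classical_set_scope.
Local Open Scope complex_scope.

(* For a character chi of Z_p of order at least 8 an action preserving the
   filtration has the form alpha(chi) = chi (x) a + chi^* (x) b.  Comparing
   coefficients in alpha(chi) alpha(chi)^* = 1 = alpha(chi)^* alpha(chi) and using
   that alpha(chi^2) has no component along 1, one finds that a and b are normal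
   partial isometries with mutually orthogonal supports q = a a^* and
   1 - q = b b^*.  Hence a^* + b is a unitary commuting with the projection q.
   As chi runs through a compatible system of characters of orders p^(n+1), these
   unitaries define a homomorphism from C(Z_p) by finite Fourier analysis, while q
   does not depend on chi and defines one from C({0, 1}).  Their product is the
   required homomorphism from C(Z_p x| Z/2), and coassociativity of alpha gives the
   comultiplication of a and b.  The spaces involved are profinite, so that all
   density and extension arguments reduce to locally constant functions. *)

(** * C*-algebras and star-homomorphisms *)

(** The unitary is [star a + b] and not [a + b] because left actions enter the coaction through
    inverses. In the model, chi(t - k) = chi(t) conj(chi(k)) and chi(k - t) = conj(chi(t)) chi(k),
    so [a] is conj(chi) on the component [false], [b] is chi on the component [true], and
    [star a + b] is chi on both. The bound 8 = 2^3 guarantees, for every prime including 2, that the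
    order of chi does not divide 4. Then 1, chi^2 and chi^-2 are independent, so the products of the
    expansions of alpha(chi) and its adjoint can be compared coefficientwise. This explains the
    index shift: [chi n.+2] has order p^(n+3), and every other character is a power of one of these.
    The universal property ranges over arbitrary compact quantum groups, so homomorphisms must be
    built from a concrete C(X) into an abstract noncommutative algebra. For profinite X such a map
    amounts to a compatible system of finite partitions of 1 into orthogonal projections.
    Boundedness is automatic, since unitaries have norm 1; this stands in for spectral theory.
    Compatibility with the comultiplications and with the actions is then checked on the
    coefficients alone, as they generate. *)

Section CStarBasics.
Variable R : realType.
Local Notation C := R[i].
Variable A : cstarType R.
Implicit Types x y : A.

Lemma cnorm0 : cnorm (0 : A) = 0.
Proof. by rewrite -(scale0r (0 : A)) cnormZ normc0 mul0r. Qed.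

Lemma cnormN x : cnorm (- x) = cnorm x.
Proof. by rewrite -scaleN1r cnormZ normcN normc1 mul1r. Qed.

Lemma cnorm_ge0 x : 0 <= cnorm x.
Proof.
have := cnormD x (- x); rewrite subrr cnorm0 cnormN -mulr2n.
by rewrite pmulrn_lge0.
Qed.

Lemma cnormB x y : cnorm (x - y) = cnorm (y - x).
Proof. by rewrite -cnormN opprB. Qed.

Lemma cnorm_dist y x z : cnorm (x - z) <= cnorm (x - y) + cnorm (y - z).
Proof. by rewrite -[x in x - z](subrK y) -addrA cnormD. Qed.

Lemma star0 : star (0 : A) = 0.
Proof. by apply: (@addrI _ (star 0)); rewrite -starD !addr0. Qed.

Lemma star1 : star (1 : A) = 1.
Proof.
have := starM (star 1 : A) 1.
by rewrite mulr1 starK mulr1.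
Qed.

Lemma starN x : star (- x) = - star x.
Proof. by apply/eqP; rewrite -addr_eq0 -starD addNr star0. Qed.

Lemma starB x y : star (x - y) = star x - star y.
Proof. by rewrite starD starN. Qed.

Lemma starX x n : star (x ^+ n) = star x ^+ n.
Proof.
by elim: n => [|n IH]; rewrite ?expr0 ?star1 // exprS starM IH -exprSr.
Qed.

Lemma star_sum (I : Type) (r : seq I) (P : pred I) (F : I -> A) :
  star (\sum_(i <- r | P i) F i) = \sum_(i <- r | P i) star (F i).
Proof. by apply: (big_morph _ starD star0). Qed.

Lemma cnorm_star_le x : cnorm x <= cnorm (star x).
Proof.
have [->|x0] := eqVneq x 0; first by rewrite star0.
have xp : 0 < cnorm x.
  by rewrite lt_neqAle cnorm_ge0 andbT eq_sym; apply: contra x0 =>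
    /eqP/cnorm0_eq0 ->.
by have := cnormM (star x) x; rewrite cnorm_starM expr2 ler_pM2r.
Qed.

Lemma cnorm_star x : cnorm (star x) = cnorm x.
Proof.
by apply/eqP; rewrite eq_le cnorm_star_le -{2}[x]starK cnorm_star_le.
Qed.

Lemma cnorm1 : cnorm (1 : A) = 1.
Proof.
have := cnorm_starM (1 : A); rewrite star1 mul1r => /eqP.
rewrite eq_sym expr2 -subr_eq0 -{3}[cnorm 1]mulr1 -mulrBr mulf_eq0 subr_eq0.
case/orP => /eqP // /cnorm0_eq0 /eqP; by rewrite oner_eq0.
Qed.

Lemma cnorm_sum (I : Type) (r : seq I) (P : pred I) (F : I -> A) :
  cnorm (\sum_(i <- r | P i) F i) <= \sum_(i <- r | P i) cnorm (F i).
Proof.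
elim/big_rec2: _ => [|i y x Pi xy]; first by rewrite cnorm0.
by apply: le_trans (cnormD _ _) _; rewrite lerD2l.
Qed.

Lemma cnorm_unitary x : star x * x = 1 -> cnorm x = 1.
Proof.
move=> xx; have /eqP := cnorm_starM x.
rewrite xx cnorm1 eq_sym sqrf_eq1 => /orP[/eqP->//|/eqP x1].
by have := cnorm_ge0 x; rewrite x1 lerNr oppr0 ler10.
Qed.

Definition ccvg (u : nat -> A) (l : A) :=
  forall e : R, 0 < e -> exists N : nat, forall n : nat,
    (N <= n)%N -> cnorm (u n - l) < e.

Lemma ccvg_uniq u l l' : ccvg u l -> ccvg u l' -> l = l'.
Proof.
move=> ul ul'; apply/eqP; rewrite -subr_eq0; apply/eqP/cnorm0_eq0/eqP.
rewrite eq_le cnorm_ge0 andbT; apply/ler_addgt0Pr => e e0; rewrite add0r.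
have e2 : 0 < e / 2 by rewrite divr_gt0.
have [N NP] := ul _ e2; have [N' NP'] := ul' _ e2.
have -> : l - l' = (u (maxn N N') - l') - (u (maxn N N') - l).
  by rewrite opprB [RHS]addrC addrA subrK.
apply: le_trans (cnormD _ _) _; rewrite cnormN (splitr e).
by apply: lerD; apply/ltW; rewrite ?NP ?NP' ?leq_maxl ?leq_maxr.
Qed.

Lemma ccvg_cst l : ccvg (fun=> l) l.
Proof. by move=> e e0; exists 0%N => n _; rewrite subrr cnorm0. Qed.

Lemma ccvgD u v l m : ccvg u l -> ccvg v m -> ccvg (fun n => u n + v n) (l + m).
Proof.
move=> ul vm e e0; have e2 : 0 < e / 2 by rewrite divr_gt0.
have [N NP] := ul _ e2; have [N' NP'] := vm _ e2.
exists (maxn N N') => n; rewrite geq_max => /andP[nN nN'].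
rewrite opprD addrACA (splitr e).
by apply: le_lt_trans (cnormD _ _) _; rewrite ltrD ?NP ?NP'.
Qed.

Lemma ccvg_bound u l K : (forall e : R, 0 < e -> exists N : nat, forall n : nat,
    (N <= n)%N -> cnorm (u n - l) <= K * e) -> ccvg u l.
Proof.
move=> ul e e0.
have K0 : 0 < `|K| + 1 by rewrite ltr_wpDl.
have [N NP] := ul (e / (`|K| + 1)) (divr_gt0 e0 K0).
exists N => n /NP /le_lt_trans; apply.
rewrite mulrA ltr_pdivrMr // mulrC ltr_pM2l //.
by apply: (le_lt_trans (ler_norm K)); rewrite ltrDl.
Qed.

Lemma ccvg_cnorm u l M : ccvg u l -> (forall n, cnorm (u n) <= M) ->
  cnorm l <= M.
Proof.
move=> ul uM; apply/ler_addgt0Pr => e e0.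
have [N /(_ N (leqnn _)) NP] := ul _ e0.
have -> : l = u N - (u N - l) by rewrite opprB addrC subrK.
by apply: le_trans (cnormD _ _) _; rewrite cnormN lerD // ltW.
Qed.

Lemma ccvgMl x u l : ccvg u l -> ccvg (fun n => x * u n) (x * l).
Proof.
move=> ul; apply: (@ccvg_bound _ _ (cnorm x)) => e e0.
have [N NP] := ul _ e0; exists N => n nN; rewrite -mulrBr.
by apply: le_trans (cnormM _ _) _; rewrite ler_wpM2l ?cnorm_ge0 // ltW ?NP.
Qed.

Lemma ccvg_star u l : ccvg u l -> ccvg (fun n => star (u n)) (star l).
Proof.
move=> ul e e0; have [N NP] := ul _ e0; exists N => n nN.
by rewrite -starB cnorm_star NP.
Qed.

Lemma ccvgMr x u l : ccvg u l -> ccvg (fun n => u n * x) (l * x).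
Proof.
move=> ul; rewrite -[l * x]starK starM.
have := ccvg_star (ccvgMl (star x) (ccvg_star ul)).
by congr ccvg; apply: funext => n; rewrite starM !starK.
Qed.

Lemma ccvgZ (c : C) u l : ccvg u l -> ccvg (fun n => c *: u n) (c *: l).
Proof.
move=> ul; rewrite -mulr_algl.
have := @ccvgMl (c *: 1) _ _ ul; congr ccvg; apply: funext => n.
by rewrite mulr_algl.
Qed.

Lemma ccvgM u v l m : ccvg u l -> ccvg v m ->
  ccvg (fun n => u n * v n) (l * m).
Proof.
move=> ul vm; apply: (@ccvg_bound _ _ (cnorm m + 1 + cnorm l)) => e e0.
have [N NP] := ul _ e0; have [N' NP'] := vm _ e0.
have [N1 N1P] := vm _ ltr01.
exists (maxn (maxn N N') N1) => n; rewrite !geq_max => /andP[/andP[nN nN'] nN1].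
have -> : u n * v n - l * m = (u n - l) * v n + l * (v n - m).
  by rewrite mulrBl mulrBr addrA subrK.
apply: le_trans (cnormD _ _) _; rewrite [leRHS]mulrDl lerD //.
  rewrite mulrC; apply: le_trans (cnormM _ _) _.
  apply: ler_pM; rewrite ?cnorm_ge0 //; first by rewrite ltW ?NP.
  rewrite -[v n](subrK m) addrC; apply: le_trans (cnormD _ _) _.
  by rewrite lerD2l ltW ?N1P.
by apply: le_trans (cnormM _ _) _; rewrite ler_wpM2l ?cnorm_ge0 // ltW ?NP'.
Qed.

End CStarBasics.

Section StarHom.
Variables (R : realType) (A B : cstarType R) (f : A -> B).
Local Notation C := R[i].
Hypothesis fh : star_hom f.

Lemma shom_add x y : f (x + y) = f x + f y.
Proof. by case: fh => fl _ _ _; have := fl 1 x y; rewrite !scale1r. Qed.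

Lemma shom_0 : f 0 = 0.
Proof. by apply: (@addrI _ (f 0)); rewrite -shom_add !addr0. Qed.

Lemma shom_scale (c : C) x : f (c *: x) = c *: f x.
Proof. by case: fh => fl _ _ _; have := fl c x 0; rewrite !addr0 shom_0 addr0.
  Qed.

Lemma shom_opp x : f (- x) = - f x.
Proof. by rewrite -scaleN1r shom_scale scaleN1r. Qed.

Lemma shom_sub x y : f (x - y) = f x - f y.
Proof. by rewrite shom_add shom_opp. Qed.

Lemma shom_sum (I : Type) (r : seq I) (P : pred I) (F : I -> A) :
  f (\sum_(i <- r | P i) F i) = \sum_(i <- r | P i) f (F i).
Proof. exact: (big_morph _ shom_add shom_0). Qed.

Lemma shom1 : f 1 = 1. Proof. by case: fh. Qed.

Lemma shom_mul x y : f (x * y) = f x * f y.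
Proof. by case: fh => _ _ fm _; exact: fm. Qed.

Lemma shom_star x : f (star x) = star (f x).
Proof. by case: fh => _ _ _ fs; exact: fs. Qed.

Lemma shom_exp x n : f (x ^+ n) = f x ^+ n.
Proof. by elim: n => [|n IH]; rewrite ?expr0 ?shom1 // !exprS shom_mul IH. Qed.

End StarHom.

Lemma shom_comp (R : realType) (A B D : cstarType R) (g : B -> D) (f : A -> B) :
  star_hom g -> star_hom f -> star_hom (g \o f).
Proof.
move=> gh fh; split => /=.
- by move=> c x y /=; rewrite (shom_add fh) (shom_scale fh) (shom_add gh)
  (shom_scale gh).
- by rewrite (shom1 fh) (shom1 gh).
- by move=> x y /=; rewrite (shom_mul fh) (shom_mul gh).
- by move=> x /=; rewrite (shom_star fh) (shom_star gh).
Qed.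

Lemma shom_id (R : realType) (A : cstarType R) : star_hom (@id A).
Proof. by []. Qed.

Section Lin.
Variables (R : realType) (V : lmodType R[i]) (S : set V).

Lemma lin_subset (x : V) : S x -> lin S x.
Proof.
by move=> Sx; exists 1%N, (fun=> 1), (fun=> x); rewrite big_ord1 scale1r.
Qed.

Lemma lin0 : lin S 0.
Proof. by exists 0%N, (fun=> 0), (fun=> 0); rewrite big_ord0;
  split => // -[]. Qed.

Lemma linD x y : lin S x -> lin S y -> lin S (x + y).
Proof.
move=> [n [c [v [Sv ->]]]] [m [d [w [Sw ->]]]].
exists (n + m)%N, (fun i => match fintype.split i with inl j => c j | inr j => d
  j end),
  (fun i => match fintype.split i with inl j => v j | inr j => w j end); split.
  by move=> i; case: (fintype.split i).
rewrite big_split_ord /=; congr (_ + _); apply: eq_bigr => i _.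
  by rewrite (unsplitK (inl i)).
by rewrite (unsplitK (inr i)).
Qed.

Lemma linZ (c : R[i]) x : lin S x -> lin S (c *: x).
Proof.
move=> [n [d [v [Sv ->]]]]; exists n, (fun i => c * d i), v; split => //.
by rewrite scaler_sumr; apply: eq_bigr => i _; rewrite scalerA.
Qed.

Lemma lin_sum (I : Type) (r : seq I) (P : pred I) (F : I -> V) :
  (forall i, P i -> lin S (F i)) -> lin S (\sum_(i <- r | P i) F i).
Proof. by move=> h; apply: big_ind => //; [exact: lin0 | exact: linD]. Qed.

Lemma lin_ind (K : V -> Prop) : K 0 -> (forall x y, K x -> K y -> K (x + y)) ->
  (forall c x, K x -> K (c *: x)) -> (forall x, S x -> K x) ->
  forall x, lin S x -> K x.
Proof.
move=> K0 KD KZ KS x [n [c [v [Sv ->]]]].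
by apply: big_ind => // i _; apply/KZ/KS.
Qed.

End Lin.

Lemma lin_mono (R : realType) (V : lmodType R[i]) (S S' : set V) :
  S `<=` lin S' -> lin S `<=` lin S'.
Proof.
move=> SS' x; apply: lin_ind => //.
- exact: lin0.
- by move=> *; exact: linD.
- by move=> *; exact: linZ.
Qed.

(** * Continuous functions: positivity, states and contractivity of homomorphisms *)

Section CfunTools.
Variable R : realType.
Local Notation C := R[i].

Section Comp.
Variables (X Y : compactType) (h : X -> Y).
Hypothesis hc : continuous h.

Lemma cfun_comp_subproof (f : cfun R Y) : continuous
  ((fun x => f (h x)) : X -> C^o).
Proof.
move=> x; exact: cvg_comp _ _ (@hc x) (@cfun_continuous R Y f (h x)).
Qed.
Definition cfun_comp (f : cfun R Y) : cfun R X := CFun (@cfun_comp_subproof f).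

Lemma cfun_comp_hom : star_hom cfun_comp.
Proof. by split=> [c f g||f g|f]; apply: cfunP. Qed.
End Comp.

Section Pointwise.
Variable X : compactType.
Implicit Types f g : cfun R X.

Lemma cfunDE f g x : (f + g) x = f x + g x. Proof. by []. Qed.
Lemma cfunNE f x : (- f) x = - f x. Proof. exact: mulN1r. Qed.
Lemma cfunBE f g x : (f - g) x = f x - g x. Proof. by rewrite cfunDE cfunNE.
  Qed.
Lemma cfunME f g x : (f * g) x = f x * g x. Proof. by []. Qed.
Lemma cfun1E x : (1 : cfun R X) x = 1. Proof. by []. Qed.
Lemma cfunZE c f x : (c *: f) x = c * f x. Proof. by []. Qed.
Lemma cfun_starE f x : star f x = conjc (f x). Proof. by []. Qed.
Lemma cfun_sumE (I : Type) (r : seq I) (P : pred I) (F : I -> cfun R X) x :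
  (\sum_(i <- r | P i) F i) x = \sum_(i <- r | P i) F i x.
Proof. exact: (big_morph (fun f : cfun R X => f x) (fun f g => erefl) erefl).
  Qed.
Lemma cfunXE f n x : (f ^+ n) x = f x ^+ n.
Proof. by elim: n => [//|n IH]; rewrite !exprS cfunME IH. Qed.

Lemma cfun_le_cnorm f x : normc (f x) <= cnorm f.
Proof. exact: le_cfun_norm. Qed.

Lemma cfun_cnorm_le f M : (forall x, normc (f x) <= M) -> cnorm f <= M.
Proof. exact: cfun_norm_le. Qed.

Lemma cfun_real_subproof (r : X -> R) : continuous r ->
  continuous ((fun x => (r x)%:C) : X -> C^o).
Proof.
move=> rc x; apply/(@cvgrPdist_lt C C^o) => -[e d] /=.
rewrite ltcE /= => /andP[/eqP-> e0].
have /cvgrPdist_lt/(_ _ e0) := rc x; apply: filterS => t.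
by rewrite -rmorphB normc_def /= expr0n addr0 sqrtr_sqr ltcR.
Qed.
Definition cfun_real (r : X -> R) (rc : continuous r) : cfun R X :=
  CFun (cfun_real_subproof rc).

Lemma sqrt_comp_continuous (r : X -> R) : continuous r ->
  continuous (fun x => Num.sqrt (r x)).
Proof.
move=> rc x.
exact: (@continuous_comp X R R r (@Num.sqrt R) x (rc x)
  (@sqrt_continuous R (r x))).
Qed.

Lemma conjc_mul_norm (c : C) : conjc c * c = (normc c ^+ 2)%:C.
Proof. by rewrite mulrC -[conjc c]/(Num.conj c) -normCK Defs.normcE rmorphXn.
  Qed.

Lemma normc_real (r : R) : normc r%:C = `|r|.
Proof. by rewrite /= expr0n addr0 sqrtr_sqr. Qed.

(** The witness is the square root of |f|. A state is only assumed positive on elements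
    [star a * a]; this extends its positivity to all nonnegative functions. *)
Lemma cfun_sqrt f : (forall x, 0 <= f x) -> exists g, f = star g * g.
Proof.
move=> f0; exists (cfun_real (sqrt_comp_continuous (@normc_continuous R X f))).
apply: cfunP => x; rewrite cfunME cfun_starE conjc_mul_norm /= expr0n addr0.
rewrite sqrtr_sqr (ger0_norm (sqrtr_ge0 _)) sqr_sqrtr ?normc_ge0 //.
by rewrite -Defs.normcE ger0_norm.
Qed.

Lemma state_cfun_ge0 (phi : cfun R X -> C) f : is_state phi ->
  (forall x, 0 <= f x) -> 0 <= phi f.
Proof. by move=> [_ _ p0] /cfun_sqrt[g ->]; exact: p0. Qed.

Lemma eval_state (x : X) : is_state (fun f : cfun R X => f x).
Proof.
split=> // f; rewrite cfunME cfun_starE conjc_mul_norm.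
by rewrite ler0c sqr_ge0.
Qed.

(* For [h = f^* f] with [|f| <= 1], [h] is the real part of the unitary
   [h + i sqrt(1 - h^2)], whose image has norm 1. *)
Lemma shom_cfun_le1 (B : cstarType R) (phi : cfun R X -> B) f :
  star_hom phi -> cnorm f <= 1 -> cnorm (phi f) <= 1.
Proof.
move=> ph f1.
pose r x := normc (f x) ^+ 2.
have rc : continuous r.
  move=> x; rewrite /r; under eq_fun do rewrite expr2.
  exact: (cvgM (@normc_continuous R X f x) (@normc_continuous R X f x)).
have r1 x : 0 <= r x <= 1.
  by rewrite /r sqr_ge0 /= expr_le1 ?normc_ge0 //
    (le_trans (cfun_le_cnorm f x)).
pose s x := 1 - r x ^+ 2.
have sc : continuous s.
  move=> x; rewrite /s; under eq_fun do rewrite expr2.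
  by apply: cvgB; [exact: cvg_cst | exact: (cvgM (rc x) (rc x))].
pose w := cfun_real rc + 'i%C *: cfun_real (sqrt_comp_continuous sc).
have wE x : w x = r x +i* Num.sqrt (s x).
  by rewrite /w cfunDE cfunZE /=; apply/eqP; rewrite eq_complex /=; simpc.
have wu : star w * w = 1.
  apply: cfunP => x; rewrite cfunME cfun_starE conjc_mul_norm wE cfun1E /=.
  rewrite [in Num.sqrt (s x) ^+ 2]sqr_sqrtr; last first.
    by rewrite subr_ge0 expr_le1 //; case/andP: (r1 x).
  by rewrite addrC subrK sqrtr1 expr1n.
have hw : star f * f = 2^-1 *: (w + star w).
  apply: cfunP => x; rewrite cfunME cfun_starE conjc_mul_norm -/(r x).
  rewrite cfunZE cfunDE cfun_starE wE.
  have -> : (r x +i* Num.sqrt (s x)) + conjc (r x +i* Num.sqrt (s x)) = 2 *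
    (r x)%:C.
    by rewrite mulr_natl mulr2n; apply/eqP; rewrite eq_complex /= subrr addr0
      !eqxx.
  by rewrite mulKf ?pnatr_eq0.
have pw : cnorm (phi w) = 1.
  by apply: cnorm_unitary; rewrite -(shom_star ph) -(shom_mul ph) wu (shom1 ph).
rewrite -(@expr_le1 _ 2) ?cnorm_ge0 // -cnorm_starM -(shom_star ph)
  -(shom_mul ph).
rewrite hw (shom_scale ph) (shom_add ph) (shom_star ph) cnormZ.
have -> : normc (2^-1 : C) = 2^-1.
  have -> : (2^-1 : C) = (2^-1)%:C by rewrite fmorphV rmorph_nat.
  by rewrite normc_real ger0_norm ?invr_ge0.
rewrite mulrC ler_pdivrMr // mul1r.
by apply: le_trans (cnormD _ _) _; rewrite cnorm_star pw.
Qed.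

(** By homogeneity this reduces to the unit ball. It holds for any C*-algebra [B] as target, and it
    supplies the bound under which maps given on locally constant functions extend to C(X). *)
Lemma shom_cfun_cnorm (B : cstarType R) (phi : cfun R X -> B) f :
  star_hom phi -> cnorm (phi f) <= cnorm f.
Proof.
move=> ph; have [/cnorm0_eq0->|f0] := eqVneq (cnorm f) 0.
  by rewrite (shom_0 ph) !cnorm0.
have fp : 0 < cnorm f by rewrite lt_neqAle eq_sym f0 cnorm_ge0.
have nV : normc ((cnorm f)^-1%:C : C) = (cnorm f)^-1.
  by rewrite normc_real ger0_norm // invr_ge0 ltW.
have := @shom_cfun_le1 B phi (((cnorm f)^-1)%:C *: f) ph.
rewrite (shom_scale ph) !cnormZ nV mulVf // => /(_ (lexx _)).
by rewrite mulrC ler_pdivrMr // mul1r.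
Qed.

End Pointwise.
End CfunTools.

(** * Profinite spaces *)

(* A presentation of [X] as the inverse limit of the finite sets [lfin n]. *)
Record levels (X : compactType) := Levels {
  lfin : nat -> finType;
  lproj : forall n, X -> lfin n;
  ldown : forall n, lfin n.+1 -> lfin n;
  lproj_down : forall n x, ldown (lproj n.+1 x) = lproj n x;
  lproj_surj : forall n s, exists x, lproj n x = s;
  lproj_nbhs : forall n x, nbhs x [set y | lproj n y = lproj n x];
  lproj_base : forall x U, nbhs x U ->
    exists n, [set y | lproj n y = lproj n x] `<=` U
}.

Section Levels.
Variables (R : realType) (X : compactType) (L : levels X).
Local Notation C := R[i].

Lemma lproj_le m n x y : (m <= n)%N ->
  lproj L n x = lproj L n y -> lproj L m x = lproj L m y.
Proof.
move=> /subnK <-; elim: (n - m)%N => [//|k IH].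
by rewrite addSn => e; apply: IH; rewrite -[LHS]lproj_down -[RHS]lproj_down e.
Qed.

Definition lrep n (s : lfin L n) : X := projT1 (cid (lproj_surj s)).

Lemma lrepK n (s : lfin L n) : lproj L n (lrep s) = s.
Proof. exact: projT2 (cid (lproj_surj s)). Qed.

Lemma lstep_subproof n (c : lfin L n -> C) :
  continuous ((fun x => c (lproj L n x)) : X -> C^o).
Proof.
move=> x; apply/(@cvgrPdist_lt C C^o X (nbhs x) (nbhs_filter x)) => e e0.
apply: (@filterS _ _ (nbhs_filter x) [set y | lproj L n y = lproj L n x]).
  by move=> y /= ->; rewrite subrr normr0.
exact: lproj_nbhs.
Qed.

Definition lstep n (c : lfin L n -> C) : cfun R X := CFun (@lstep_subproof n c).

Definition lapprox n (f : cfun R X) : cfun R X :=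
  lstep (fun s : lfin L n => f (lrep s)).

Lemma lstep_down n (c : lfin L n -> C) :
  lstep c = lstep (fun s => c (ldown s)).
Proof. by apply: cfunP => x /=; rewrite lproj_down. Qed.

(** Uniform continuity by compactness. If every level had a bad pair, the first points of these
    pairs would cluster at some x; a fibre around x on which f stays within e/2 of f(x) then
    contains both points of a late pair. *)
Lemma cfun_level_uniform (f : cfun R X) (e : R) : 0 < e ->
  exists n, forall x y, lproj L n x = lproj L n y -> normc (f x - f y) < e.
Proof.
move=> e0; apply: contrapT => /forallNP nun.
have {}nun n : exists u : X * X, lproj L n u.1 = lproj L n u.2 /\
    e <= normc (f u.1 - f u.2).
  have /existsNP[x /existsNP[y /not_implyP[xy /negP]]] := nun n.
  by rewrite -leNgt => fe; exists (x, y).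
pose u n := projT1 (cid (nun n)).
have uP n : lproj L n (u n).1 = lproj L n (u n).2 /\
    e <= normc (f (u n).1 - f (u n).2) := projT2 (cid (nun n)).
have [x [_ clx]] := @compact_space X ((fun n => (u n).1) @ \oo) _ filterT.
have e2 : 0 < (e / 2)%:C :> C by rewrite ltcR divr_gt0.
have /cvgrPdist_lt/(_ _ e2)/(@lproj_base _ L)[m mP] := @cfun_continuous R X f x.
have Fm : ((fun n => (u n).1) @ \oo) [set (u n).1 | n in [set n | (m <= n)%N]].
  by exists m => // n /= mn; exists n.
have [_ [[n /= mn <-] /= xn]] := clx _ _ Fm (lproj_nbhs L m x).
have [un] := uP n; apply/negP; rewrite -ltNge.
have un2 : lproj L m (u n).2 = lproj L m x.
  by rewrite -xn; apply/esym/(lproj_le mn).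
have := mP _ xn; have := mP _ un2; rewrite /= !Defs.normcE !ltcR => u2 u1.
have -> : f (u n).1 - f (u n).2 = - (f x - f (u n).1) + (f x - f (u n).2).
  by rewrite opprB addrA subrK.
rewrite (splitr e); apply: le_lt_trans (normc_triangle _ _) _.
by rewrite normcN ltrD.
Qed.

Lemma lapprox_cvg (f : cfun R X) : ccvg (fun n => lapprox n f) f.
Proof.
apply: (@ccvg_bound _ _ _ _ 1) => e e0; rewrite mul1r.
have [N NP] := cfun_level_uniform f e0; exists N => n Nn.
apply: cfun_cnorm_le => x; rewrite cfunBE; apply/ltW/NP => /=.
by apply: (lproj_le Nn); rewrite lrepK.
Qed.

Section Extension.
Variable B : cstarType R.

Definition lsum n (v : lfin L n -> B) (f : cfun R X) : B :=
  \sum_s f (lrep s) *: v s.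

Lemma lsum_lstep n (v : lfin L n -> B) c : lsum v (lstep c) = \sum_s c s *: v s.
Proof. by apply: eq_bigr => s _; rewrite /= lrepK. Qed.

Lemma lsum_lin n (v : lfin L n -> B) a f g :
  lsum v (a *: f + g) = a *: lsum v f + lsum v g.
Proof.
rewrite /lsum scaler_sumr -big_split /=; apply: eq_bigr => s _.
by rewrite scalerDl scalerA.
Qed.

Lemma lsumB n (v : lfin L n -> B) f g : lsum v (f - g) = lsum v f - lsum v g.
Proof. by rewrite addrC -scaleN1r lsum_lin scaleN1r addrC. Qed.

Variable v : forall n, lfin L n -> B.
Hypothesis v_down : forall n s, v s = \sum_(t | ldown t == s :> lfin L n) v t.
Hypothesis v_bound : forall n f, cnorm (lsum (@v n) f) <= cnorm f.

(** Additivity along [ldown] makes the value on a locally constant function independent of the level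
    at which it is computed, so the sequence of level sums is eventually constant there. *)
Lemma lsum_lstep_le m n (c : lfin L m -> C) : (m <= n)%N ->
  lsum (@v n) (lstep c) = \sum_s c s *: v s.
Proof.
move=> mn; rewrite -(subnK mn); move: (n - m)%N => k {n mn}.
elim: k m c => [|k IH] m c; first exact: lsum_lstep.
rewrite lstep_down addSnnS IH.
rewrite (partition_big (@ldown _ L m) predT) //=; apply: eq_bigr => s _.
by rewrite v_down scaler_sumr; apply: eq_bigr => t /eqP ->.
Qed.

(* The values [v n s] prescribe a bounded linear map on the indicators of the
   fibres of [lproj L n], which span a dense subspace. *)
Lemma level_extension : exists Phi : cfun R X -> B,
  (forall f, ccvg (fun n => lsum (@v n) f) (Phi f)) /\
  forall n (c : lfin L n -> C), Phi (lstep c) = \sum_s c s *: v s.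
Proof.
have cau f : exists l, ccvg (fun n => lsum (@v n) f) l.
  apply: cnorm_complete => e e0; have e2 : 0 < e / 2 by rewrite divr_gt0.
  have [N NP] := lapprox_cvg f e2.
  have H n : (N <= n)%N -> cnorm (lsum (@v n) f - lsum (@v N) f) < e / 2.
    (* Sampling f at level N is the same as applying the level-n sum to the approximant of f, so
       [v_bound] turns uniform approximation into a Cauchy estimate. *)
    move=> Nn; have -> : lsum (@v N) f = lsum (@v n) (lapprox N f).
      by rewrite lsum_lstep_le.
    by rewrite -lsumB; apply: le_lt_trans (v_bound _ _) _; rewrite cnormB NP.
  exists N => m n Nm Nn; rewrite (splitr e).
  apply: le_lt_trans (cnorm_dist (lsum (@v N) f) _ _) _.
  by rewrite ltrD ?H // cnormB H.
exists (fun f => projT1 (cid (cau f))); split.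
  by move=> f; exact: projT2 (cid (cau f)).
move=> n c; apply: ccvg_uniq (projT2 (cid (cau (lstep c)))) _ => e e0.
by exists n => m nm; rewrite lsum_lstep_le // subrr cnorm0.
Qed.

End Extension.
End Levels.

Section LevelHom.
Variables (R : realType) (X : compactType) (L : levels X).
Local Notation C := R[i].

Definition lind n (s : lfin L n) : cfun R X := lstep (fun t => (t == s)%:R).

Lemma lstep_lind n (c : lfin L n -> C) : lstep c = \sum_s c s *: lind s.
Proof.
apply: cfunP => x; rewrite cfun_sumE (bigD1 (lproj L n x)) //= eqxx mulr1.
rewrite big1 ?addr0 // => s /negPf sx.
by rewrite [_ == s]eq_sym sx mulr0.
Qed.

Lemma lindM n (s t : lfin L n) : lind s * lind t = if s == t then lind s else 0.
Proof.
apply: cfunP => x; rewrite cfunME /=.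
case: (eqVneq s t) => [<-|st] /=; first by rewrite -natrM mulnb andbb.
case: eqP => [->|_]; last by rewrite mul0r.
by rewrite (negPf st) mulr0.
Qed.

Lemma lind_star n (s : lfin L n) : star (lind s) = lind s.
Proof. by apply: cfunP => x; rewrite cfun_starE /= conjc_nat. Qed.

Lemma lind_sum n : \sum_(s : lfin L n) lind s = 1.
Proof.
have -> : (1 : cfun R X) = lstep (fun _ : lfin L n => 1) by exact: cfunP.
by rewrite lstep_lind; apply: eq_bigr => s _; rewrite scale1r.
Qed.

Lemma lind_down n (s : lfin L n) : lind s = \sum_(t | ldown t == s) lind t.
Proof.
rewrite {1}/lind lstep_down lstep_lind [RHS]big_mkcond.
by apply: eq_bigr => t _; case: eqP => _ /=; rewrite ?scale1r ?scale0r.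
Qed.

Section Ext.
Variable B : cstarType R.

Lemma shom_lapprox (phi : cfun R X -> B) f : star_hom phi ->
  ccvg (fun n => phi (lapprox L n f)) (phi f).
Proof.
move=> ph e e0; have [N NP] := lapprox_cvg L f e0; exists N => n /NP.
by rewrite -(shom_sub ph); apply: le_lt_trans; exact: shom_cfun_cnorm.
Qed.

Lemma shom_level_ext (phi psi : cfun R X -> B) : star_hom phi -> star_hom psi ->
  (forall n (s : lfin L n), phi (lind s) = psi (lind s)) ->
  forall f, phi f = psi f.
Proof.
move=> ph qh pq f; apply: (ccvg_uniq (shom_lapprox f ph)).
have := shom_lapprox f qh; congr ccvg; apply: funext => n.
rewrite /lapprox lstep_lind (shom_sum ph) (shom_sum qh).
by apply: eq_bigr => s _; rewrite (shom_scale ph) (shom_scale qh) pq.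
Qed.

Lemma shom_level_commute (phi : cfun R X -> B) z : star_hom phi ->
  (forall n (s : lfin L n), phi (lind s) * z = z * phi (lind s)) ->
  forall f, phi f * z = z * phi f.
Proof.
move=> ph pz f; apply: (ccvg_uniq (ccvgMr z (shom_lapprox f ph))).
have := ccvgMl z (shom_lapprox f ph); congr ccvg; apply: funext => n.
rewrite /lapprox lstep_lind (shom_sum ph) mulr_suml mulr_sumr.
apply: eq_bigr => s _.
by rewrite (shom_scale ph) -scalerAl -scalerAr pz.
Qed.

Lemma level_hom (v : forall n, lfin L n -> B) :
  (forall n s, v n s = \sum_(t | ldown t == s) v n.+1 t) ->
  (forall n s t, v n s * v n t = if s == t then v n s else 0) ->
  (forall n s, star (v n s) = v n s) -> (forall n, \sum_s v n s = 1) ->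
  exists Phi : cfun R X -> B, star_hom Phi /\
  forall n s, Phi (lind s) = v n s.
Proof.
move=> vd vM vs v1.
(* Each level sum samples f at representatives and combines orthogonal projections of sum 1, so it
   is a homomorphism on all of C(X). The bound required by [level_extension] is then the
   contractivity of homomorphisms. *)
have vh n : star_hom (lsum (v n)).
  split.
  - by move=> a f g; exact: lsum_lin.
  - by rewrite /lsum -[RHS](v1 n); apply: eq_bigr => s _; rewrite scale1r.
  - move=> f g; rewrite /lsum mulr_suml; apply: eq_bigr => s _.
    rewrite mulr_sumr (bigD1 s) //= big1 ?addr0.
      by rewrite -scalerAl -scalerAr vM eqxx scalerA.
    move=> t ts; rewrite -scalerAl -scalerAr vM eq_sym (negPf ts).
    by rewrite !scaler0.
  - move=> f; rewrite /lsum star_sum; apply: eq_bigr => s _.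
    by rewrite starZ vs.
have [|Phi [Pc Ps]] := level_extension vd.
  by move=> n f; exact: shom_cfun_cnorm (vh n).
exists Phi; split; last first.
  move=> n s; rewrite Ps (bigD1 s) //= eqxx scale1r big1 ?addr0 // => t /negPf
    ->.
  by rewrite scale0r.
split.
- move=> a f g; apply: (ccvg_uniq (Pc _)).
  have := ccvgD (ccvgZ a (Pc f)) (Pc g); congr ccvg; apply: funext => n.
  by rewrite (shom_add (vh n)) (shom_scale (vh n)).
- apply: (ccvg_uniq (Pc _)); have := ccvg_cst (1 : B).
  by congr ccvg; apply: funext => n; rewrite (shom1 (vh n)).
- move=> f g; apply: (ccvg_uniq (Pc _)).
  have := ccvgM (Pc f) (Pc g); congr ccvg; apply: funext => n.
  by rewrite (shom_mul (vh n)).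
- move=> f; apply: (ccvg_uniq (Pc _)).
  have := ccvg_star (Pc f); congr ccvg; apply: funext => n.
  by rewrite (shom_star (vh n)).
Qed.

End Ext.
End LevelHom.

Section ProductLevels.
Variables (X Y : compactType) (L : levels X) (M : levels Y).

Definition prod_lfin n : finType := (lfin L n * lfin M n)%type.
Definition prod_lproj n (u : X * Y) : prod_lfin n :=
  (lproj L n u.1, lproj M n u.2).
Definition prod_ldown n (s : prod_lfin n.+1) : prod_lfin n :=
  (ldown s.1, ldown s.2).

Lemma prod_lproj_down n u : prod_ldown (prod_lproj n.+1 u) = prod_lproj n u.
Proof. by rewrite /prod_ldown /= !lproj_down. Qed.

Lemma prod_lproj_surj n s : exists u, prod_lproj n u = s.
Proof.
by exists (lrep s.1, lrep s.2); rewrite /prod_lproj !lrepK; case: s.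
Qed.

Lemma prod_lproj_nbhs n u : nbhs u [set w | prod_lproj n w = prod_lproj n u].
Proof.
exists ([set y | lproj L n y = lproj L n u.1],
        [set y | lproj M n y = lproj M n u.2]).
  by split; exact: lproj_nbhs.
by move=> w /= [w1 w2]; rewrite /prod_lproj w1 w2.
Qed.

Lemma prod_lproj_base u U : nbhs u U ->
  exists n, [set w | prod_lproj n w = prod_lproj n u] `<=` U.
Proof.
move=> [[P Q] /= [/(lproj_base L)[n nP] /(lproj_base M)[m mQ]] PQ].
exists (maxn n m) => w /= [w1 w2]; apply: PQ; split => /=.
  by apply: nP; apply: lproj_le w1; exact: leq_maxl.
by apply: mQ; apply: lproj_le w2; exact: leq_maxr.
Qed.

Definition prod_levels : levels (X * Y)%type :=
  Levels prod_lproj_down prod_lproj_surj prod_lproj_nbhs prod_lproj_base.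

End ProductLevels.

Section ProductHom.
Variables (R : realType) (X Y : compactType) (L : levels X) (M : levels Y).
Local Notation C := R[i].

Lemma fst_cts : continuous (fst : X * Y -> X).
Proof. by move=> u; exact: cvg_fst. Qed.
Lemma snd_cts : continuous (snd : X * Y -> Y).
Proof. by move=> u; exact: cvg_snd. Qed.

Definition cfun_fst : cfun R X -> cfun R (X * Y)%type := cfun_comp fst_cts.
Definition cfun_snd : cfun R Y -> cfun R (X * Y)%type := cfun_comp snd_cts.
Definition cfun_tens (f : cfun R X) (g : cfun R Y) := cfun_fst f * cfun_snd g.

Lemma cfun_tensE f g x y : cfun_tens f g (x, y) = f x * g y.
Proof. by []. Qed.

Lemma lind_prod n (s : lfin L n) (t : lfin M n) :
  lind R ((s, t) : lfin (prod_levels L M) n) = cfun_tens (lind R s) (lind R t).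
Proof.
by apply: cfunP => -[x y] /=; rewrite -natrM mulnb.
Qed.

Lemma shom_prod_ext (B : cstarType R) (phi psi : cfun R (X * Y)%type -> B) :
  star_hom phi -> star_hom psi ->
  (forall f g, phi (cfun_tens f g) = psi (cfun_tens f g)) ->
  forall f, phi f = psi f.
Proof.
move=> ph qh pq; apply: (@shom_level_ext _ _ (prod_levels L M)) => // n [s t].
by rewrite lind_prod.
Qed.

(* C(X * Y) is the maximal tensor product of C(X) and C(Y). *)
Lemma prod_hom (B : cstarType R) (phi : cfun R X -> B) (psi : cfun R Y -> B) :
  star_hom phi -> star_hom psi -> (forall f g, phi f * psi g = psi g * phi f) ->
  exists Phi : cfun R (X * Y)%type -> B, star_hom Phi /\
    forall f g, Phi (cfun_tens f g) = phi f * psi g.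
Proof.
move=> ph qh pq.
pose v n (u : lfin (prod_levels L M) n) := phi (lind R u.1) * psi (lind R u.2).
have [||||Phi [Ph PE]] := @level_hom _ _ (prod_levels L M) B v.
- move=> n [s t]; rewrite /v /= lind_down [in psi _]lind_down.
  rewrite (shom_sum ph) (shom_sum qh) big_distrlr /= pair_big_dep /=.
  apply: eq_bigl => -[a b]; by rewrite /= xpair_eqE.
- move=> n [s t] [s' t']; rewrite /v /= mulrA -[_ * psi _ * phi _]mulrA -pq.
  rewrite mulrA -(shom_mul ph) -mulrA -(shom_mul qh) !lindM xpair_eqE.
  by case: eqP => _ /=; case: eqP => _ //; rewrite ?(shom_0 ph) ?(shom_0 qh)
    ?mul0r ?mulr0.
- by move=> n u; rewrite /v starM -(shom_star ph) -(shom_star qh) !lind_star pq.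
- move=> n; rewrite -(pair_bigA _ (fun s t => phi (lind R s) * psi (lind R t)))
  /=.
  rewrite -big_distrlr /= -(shom_sum ph) -(shom_sum qh) !lind_sum.
  by rewrite (shom1 ph) (shom1 qh) mulr1.
exists Phi; split => // f g; rewrite /cfun_tens (shom_mul Ph).
have fh := cfun_comp_hom R fst_cts : star_hom cfun_fst.
have sh := cfun_comp_hom R snd_cts : star_hom cfun_snd.
congr (_ * _).
  apply: (@shom_level_ext _ _ L _ (Phi \o cfun_fst) phi) => //.
    exact: shom_comp.
  (* Splitting the unit of the other factor into indicators of the same level n writes the function
     as a sum of indicators of product fibres, where [Phi] is known. *)
  move=> n s /=; rewrite -[cfun_fst _]mulr1 -(shom1 sh) -(lind_sum _ M n).
  rewrite (shom_sum sh) mulr_sumr (shom_sum Ph).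
  under eq_bigr do rewrite -/(cfun_tens _ _) -lind_prod PE /v /=.
  by rewrite -mulr_sumr -(shom_sum qh) lind_sum (shom1 qh) mulr1.
apply: (@shom_level_ext _ _ M _ (Phi \o cfun_snd) psi) => //.
  exact: shom_comp.
move=> n s /=; rewrite -[cfun_snd _]mul1r -(shom1 fh) -(lind_sum _ L n).
rewrite (shom_sum fh) mulr_suml (shom_sum Ph).
under eq_bigr do rewrite -/(cfun_tens _ _) -lind_prod PE /v /=.
by rewrite -mulr_suml -(shom_sum ph) lind_sum (shom1 ph) mul1r.
Qed.

Definition tensors : set (cfun R (X * Y)%type) :=
  [set cfun_tens f g | f in [set: cfun R X] & g in [set: cfun R Y]].

Lemma tensors_dense : cdense (lin tensors).
Proof.
move=> f e e0; have [N /(_ N (leqnn _)) NP] := lapprox_cvg (prod_levels L M) f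
  e0.
exists (lapprox (prod_levels L M) N f); last by rewrite cnormB.
rewrite /lapprox lstep_lind; apply: lin_sum => -[s t] _; apply/linZ/lin_subset.
by rewrite lind_prod; exists (lind R s) => //; exists (lind R t).
Qed.

End ProductHom.

(** * Minimal tensor products of commutative C*-algebras *)

Section States.
Variables (R : realType) (A : cstarType R) (phi : A -> R[i]).
Hypothesis phiS : is_state phi.

Lemma state_add x y : phi (x + y) = phi x + phi y.
Proof. by case: phiS => pl _ _; have := pl 1 x y; rewrite scale1r mul1r. Qed.

Lemma state_0 : phi 0 = 0.
Proof. by apply: (@addrI _ (phi 0)); rewrite -state_add !addr0. Qed.

Lemma state_scale c x : phi (c *: x) = c * phi x.
Proof. by case: phiS => pl _ _; have := pl c x 0; rewrite !addr0 state_0 addr0.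
  Qed.

Lemma state_sum (I : Type) (r : seq I) (P : pred I) (F : I -> A) :
  phi (\sum_(i <- r | P i) F i) = \sum_(i <- r | P i) phi (F i).
Proof. exact: (big_morph _ state_add state_0). Qed.
End States.

Section CfunTensor.
Variables (R : realType) (X Y : compactType).
Local Notation C := R[i].

Definition slice (z : seq (cfun R X * cfun R Y)) (s : X) : cfun R Y :=
  \sum_(u <- z) u.1 s *: u.2.

Lemma slice_ftmul x y s : slice (ftmul x y) s = slice x s * slice y s.
Proof.
rewrite /slice /ftmul big_allpairs_dep mulr_suml; apply: eq_bigr => u _.
rewrite mulr_sumr; apply: eq_bigr => v _ /=.
by rewrite -scalerAl -scalerAr scalerA.
Qed.

(* (phi (x) psi)(z^* z) is obtained by applying [psi] to the slices of z^* z and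
   then [phi]; this yields the positivity of phi (x) psi without Riesz. *)
Lemma gns_sq_slice phi psi z : is_state phi -> is_state psi ->
  exists H : cfun R X, gns_sq phi psi z = phi H /\
    forall s, H s = psi (star (slice z s) * slice z s).
Proof.
move=> ph qh; exists (\sum_(u <- z) \sum_(v <- z)
  psi (star u.2 * v.2) *: (star u.1 * v.1)); split.
  rewrite /gns_sq (state_sum ph); apply: eq_bigr => u _.
  rewrite (state_sum ph); apply: eq_bigr => v _.
  by rewrite (state_scale ph) mulrC.
move=> s; rewrite cfun_sumE /slice star_sum mulr_suml (state_sum qh).
apply: eq_bigr => u _; rewrite cfun_sumE mulr_sumr (state_sum qh).
apply: eq_bigr => v _; rewrite starZ -scalerAl -scalerAr scalerA.
by rewrite (state_scale qh) cfunZE cfunME cfun_starE mulrC.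
Qed.

Lemma cfun_tens_slice (x : seq (cfun R X * cfun R Y)) s t :
  (\sum_(u <- x) cfun_tens u.1 u.2) (s, t) = slice x s t.
Proof. by rewrite !cfun_sumE; apply: eq_bigr. Qed.

(** The spatial norm is the supremum norm on X * Y. In one direction the pointwise inequality |x
    y|^2 <= M^2 |y|^2 is integrated slice by slice against the two states; in the other, evaluations
    at s and t are used as states, with 1 (x) 1 as test vector. *)
Lemma cfun_tens_norm (x : seq (cfun R X * cfun R Y)) (M : R) : 0 <= M ->
  cnorm (\sum_(u <- x) cfun_tens u.1 u.2) <= M <-> spatial_bound x M.
Proof.
move=> M0; split=> [xM phi psi ph qh y|xM].
  have [H [-> HE]] := gns_sq_slice (ftmul x y) ph qh.
  have [K [-> KE]] := gns_sq_slice y ph qh.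
  rewrite -subr_ge0 -(state_scale ph) -[- _]mulN1r -(state_scale ph)
    -(state_add ph).
  apply: state_cfun_ge0 => // s; rewrite cfunDE !cfunZE mulN1r HE KE.
  rewrite -(state_scale qh) -[- _]mulN1r -(state_scale qh) -(state_add qh).
  apply: state_cfun_ge0 => // t; rewrite cfunDE !cfunZE mulN1r slice_ftmul.
  rewrite !cfunME !cfun_starE !conjc_mul_norm cfunME normcM exprMn.
  rewrite subr_ge0 -rmorphM lecR ler_wpM2r ?sqr_ge0 //.
  rewrite lerXn2r ?nnegrE ?normc_ge0 // -cfun_tens_slice.
  by apply: le_trans xM; exact: cfun_le_cnorm.
apply: cfun_cnorm_le => -[s t]; rewrite cfun_tens_slice.
have es := eval_state R s; have et := eval_state R t.
have := xM _ _ es et [:: (1, 1)].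
have [H [-> ->]] := gns_sq_slice (ftmul x [:: (1, 1)]) es et.
have -> : gns_sq (fun f : cfun R X => f s) (fun g : cfun R Y => g t)
    [:: (1, 1)] = 1.
  rewrite /gns_sq !big_seq1 !cfunME !cfun_starE !cfun1E.
  by rewrite -[conjc 1]/(Num.conj 1) rmorph1 !mulr1.
have s1 : slice [:: (1, 1)] s = 1 :> cfun R Y by rewrite /slice big_seq1
  scale1r.
rewrite slice_ftmul s1 !mulr1 cfunME cfun_starE conjc_mul_norm lecR.
by rewrite ler_pXn2r ?nnegrE ?normc_ge0.
Qed.

Lemma cfun_tens_linl (g : cfun R Y) : linear (@cfun_tens R X Y ^~ g).
Proof.
move=> c f f'; apply: cfunP => x.
by rewrite cfunDE cfunZE /= mulrDl mulrA.
Qed.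

Lemma cfun_tens_linr (f : cfun R X) : linear (@cfun_tens R X Y f).
Proof.
move=> c g g'; apply: cfunP => x.
by rewrite cfunDE cfunZE /= mulrDr mulrCA.
Qed.

Lemma cfun_tens1 : cfun_tens 1 1 = 1 :> cfun R (X * Y)%type.
Proof. by apply: cfunP => x /=; rewrite mulr1. Qed.

Lemma cfun_tensM (f f' : cfun R X) (g g' : cfun R Y) :
  cfun_tens f g * cfun_tens f' g' = cfun_tens (f * f') (g * g').
Proof. by apply: cfunP => x /=; rewrite mulrACA. Qed.

Lemma cfun_tens_star (f : cfun R X) (g : cfun R Y) :
  star (cfun_tens f g) = cfun_tens (star f) (star g).
Proof. by apply: cfunP => x; rewrite cfun_starE rmorphM. Qed.

(** Freezing the second variable at y gives a linear relation between the [a i] with the scalars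
    [b i y] as coefficients. *)
Lemma cfun_tens_free n (a : 'I_n -> cfun R X) (b : 'I_n -> cfun R Y) :
  (forall c : 'I_n -> C, \sum_i c i *: a i = 0 -> forall i, c i = 0) ->
  \sum_i cfun_tens (a i) (b i) = 0 -> forall i, b i = 0.
Proof.
move=> af ab i; apply: cfunP => y; apply: (af (fun j => b j y)).
apply: cfunP => x; rewrite cfun_sumE.
transitivity ((\sum_j cfun_tens (a j) (b j)) (x, y)); last by rewrite ab.
rewrite cfun_sumE; apply: eq_bigr => j _.
by rewrite cfunZE cfun_tensE mulrC.
Qed.

Variables (L : levels X) (M : levels Y).

Definition cfun_mintensor : mintensor (cfun R X) (cfun R Y) :=
  MinTensor cfun_tens_linl cfun_tens_linr cfun_tens1 cfun_tensM cfun_tens_star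
    cfun_tens_free (tensors_dense L M) cfun_tens_norm.

End CfunTensor.

(** Every f is (f o k') o k, and composition with k does not increase the norm, so it carries one
    dense span to another. It is applied to the shear maps of a group action, which turn elementary
    tensors into the products occurring in the density conditions. *)
Lemma dense_comp (R : realType) (X : compactType) (k k' : X -> X)
    (kc : continuous k) (kc' : continuous k') (S S' : set (cfun R X)) :
  cancel k k' -> cdense (lin S) -> (forall f, S f -> S' (cfun_comp kc f)) ->
  cdense (lin S').
Proof.
move=> kK Sd SS' f e e0; have [g Sg fg] := Sd (cfun_comp kc' f) e e0.
have ch := cfun_comp_hom R kc.
exists (cfun_comp kc g).
  elim/lin_ind: Sg {fg} => [|x y|c x|x Sx].
  - by rewrite (shom_0 ch); exact: lin0.
  - by rewrite (shom_add ch); exact: linD.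
  - by rewrite (shom_scale ch); exact: linZ.
  - exact/lin_subset/SS'.
apply: le_lt_trans fg; apply: cfun_cnorm_le => x.
have := cfun_le_cnorm (cfun_comp kc' f - g) (k x).
by rewrite !cfunBE /= kK.
Qed.

(** * Classical compact groups and their actions *)

Section ClassicalCoaction.
Variables (R : realType) (X : compactGroupType) (Y : compactType).
Variables (L : levels X) (M : levels Y).
Variable m : Y * X -> Y.
Hypothesis mc : continuous m.
Hypothesis mM : forall y g h, m (m (y, g), h) = m (y, (g * h)%g).

Lemma mulg_cts : continuous (fun u : X * X => (u.1 * u.2)%g).
Proof. exact: mulg_continuous. Qed.

Lemma pair_continuous (Z U V : topologicalType) (f : Z -> U) (g : Z -> V) :
  continuous f -> continuous g -> continuous (fun z => (f z, g z)).
Proof. by move=> fc gc z; apply: cvg_pair; [exact: fc | exact: gc]. Qed.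

Lemma fun_comp_cts (U V W : topologicalType) (f : U -> V) (g : V -> W) :
  continuous f -> continuous g -> continuous (fun u => g (f u)).
Proof. by move=> fc gc u; exact: cvg_comp _ _ (fc u) (gc (f u)). Qed.

Lemma classical_coassociative :
  @coassociative R (cfun R Y) (cfun R X) (cfun_mintensor R M L)
    (cfun_mintensor R L L) (cfun_comp mc) (cfun_comp mulg_cts).
Proof.
have f1 : continuous (fun u : Y * X * X => (m u.1, u.2)).
  apply: pair_continuous; last exact: snd_cts.
  exact: fun_comp_cts (@fst_cts _ _) mc.
have f2 : continuous (fun u : Y * (X * X) => (u.1, (u.2.1 * u.2.2)%g)).
  apply: pair_continuous; first exact: fst_cts.
  exact: fun_comp_cts (@snd_cts _ _) mulg_cts.
(* Composition is contravariant: the associator to functions on Y * (X * X) is composition with the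
   rebracketing that starts from Y * (X * X). *)
have f3 : continuous (fun u : Y * (X * X) => ((u.1, u.2.1), u.2.2)).
  apply: pair_continuous; last exact: fun_comp_cts (@snd_cts _ _)
    (@snd_cts _ _).
  apply: pair_continuous; first exact: fst_cts.
  exact: fun_comp_cts (@snd_cts _ _) (@fst_cts _ _).
exists (cfun_mintensor R (prod_levels M L) L),
       (cfun_mintensor R M (prod_levels L L)),
       (cfun_comp f1), (cfun_comp f2), (cfun_comp f3); split.
- by split; [exact: cfun_comp_hom | move=> f g; exact: cfunP].
- by split; [exact: cfun_comp_hom | move=> f g; exact: cfunP].
- split; first exact: cfun_comp_hom.
  by move=> f g h; apply: cfunP => x; rewrite /= mulrA.
- move=> f; apply: cfunP => -[y [g h]] /=; by rewrite mM.
Qed.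

End ClassicalCoaction.

Section ClassicalCqg.
Variables (R : realType) (X : compactGroupType) (Y : compactType).
Variables (L : levels X) (M : levels Y).
Local Notation mulg_cts := (@mulg_cts X).

Lemma invg_cts : continuous (fun x : X => (x^-1)%g).
Proof. exact: invg_continuous. Qed.

Section RightAction.
Variable m : Y * X -> Y.
Hypothesis mc : continuous m.
Hypothesis mM : forall y g h, m (m (y, g), h) = m (y, (g * h)%g).
Hypothesis m1 : forall y, m (y, 1%g) = y.

(** Composing a (x) b with the shear (y, x) |-> (m(y, x), x) gives exactly alpha(a)(1 (x) b); group
    inverses provide the inverse shear. *)
Lemma classical_dense : cdense (lin
  [set cfun_comp mc a * cfun_tens 1 b | a in [set: cfun R Y] & b in
    [set: cfun R X]]).
Proof.
have kc : continuous (fun u : Y * X => (m u, u.2)).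
  by apply: pair_continuous => //; exact: snd_cts.
have kc' : continuous (fun u : Y * X => (m (u.1, (u.2^-1)%g), u.2)).
  apply: pair_continuous; last exact: snd_cts.
  apply: fun_comp_cts mc; apply: pair_continuous; first exact: fst_cts.
  exact: fun_comp_cts (@snd_cts _ _) invg_cts.
apply: (@dense_comp _ _ _ _ kc kc' _ _ _ (tensors_dense M L)).
  by move=> [y x] /=; rewrite mM mulgV m1.
move=> _ [a _ [b _ <-]]; exists a => //; exists b => //.
apply: cfunP => -[y x]; rewrite cfunME /= mul1r.
exact: erefl.
Qed.

End RightAction.

Lemma classical_densel : cdense (lin
  [set cfun_comp mulg_cts a * cfun_tens b 1 | a in [set: cfun R X] & b in
    [set: cfun R X]]).
Proof.
have kc : continuous (fun u : X * X => (u.1, (u.1 * u.2)%g)).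
  by apply: pair_continuous; [exact: fst_cts | exact: mulg_cts].
have kc' : continuous (fun u : X * X => (u.1, (u.1^-1 * u.2)%g)).
  apply: pair_continuous; first exact: fst_cts.
  apply: (@fun_comp_cts _ _ _ (fun u : X * X => ((u.1^-1)%g, u.2)) _ _
    mulg_cts).
  apply: pair_continuous; last exact: snd_cts.
  exact: fun_comp_cts (@fst_cts _ _) invg_cts.
apply: (@dense_comp _ _ _ _ kc kc' _ _ _ (tensors_dense L L)).
  by move=> [x y] /=; rewrite mulgA mulVg mul1g.
move=> _ [b _ [a _ <-]]; exists a => //; exists b => //.
by apply: cfunP => -[x y]; rewrite cfunME /= mulr1 mulrC.
Qed.

Lemma classical_comul_coassoc :
  @coassociative R (cfun R X) (cfun R X) (cfun_mintensor R L L)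
    (cfun_mintensor R L L) (cfun_comp mulg_cts) (cfun_comp mulg_cts).
Proof.
by apply: classical_coassociative => x y z /=; rewrite mulgA.
Qed.

Lemma classical_comul_denser : cdense (lin
  [set cfun_comp mulg_cts a * cfun_tens 1 b | a in [set: cfun R X] & b in
    [set: cfun R X]]).
Proof.
have kc : continuous (fun u : X * X => ((u.1 * u.2)%g, u.2)).
  by apply: pair_continuous; [exact: mulg_cts | exact: snd_cts].
have kc' : continuous (fun u : X * X => ((u.1 * u.2^-1)%g, u.2)).
  apply: pair_continuous; last exact: snd_cts.
  apply: (@fun_comp_cts _ _ _ (fun u : X * X => (u.1, (u.2^-1)%g)) _ _
    mulg_cts).
  apply: pair_continuous; first exact: fst_cts.
  exact: fun_comp_cts (@snd_cts _ _) invg_cts.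
apply: (@dense_comp _ _ _ _ kc kc' _ _ _ (tensors_dense L L)).
  by move=> [x y] /=; rewrite -mulgA mulgV mulg1.
move=> _ [a _ [b _ <-]]; exists a => //; exists b => //.
by apply: cfunP => -[x y]; rewrite cfunME /= mul1r.
Qed.

Definition classical_cqg : cqg R :=
  @CQG R (cfun R X) (cfun_mintensor R L L) (cfun_comp mulg_cts)
    (cfun_comp_hom R mulg_cts) classical_comul_coassoc
    classical_densel classical_comul_denser.

Lemma classical_cqg_is_classical :
  @is_classical_group R X classical_cqg id.
Proof.
split; first by split; [exact: shom_id | exists id].
exists id; split=> //; by split; [exact: shom_id | exists id].
Qed.

Variables (m : Y * X -> Y) (mc : continuous m).
Hypothesis mM : forall y g h, m (m (y, g), h) = m (y, (g * h)%g).
Hypothesis m1 : forall y, m (y, 1%g) = y.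

Definition classical_action : qaction (cfun R Y) classical_cqg :=
  @QAction R (cfun R Y) classical_cqg (cfun_mintensor R M L) (cfun_comp mc)
    (cfun_comp_hom R mc) (classical_coassociative R L M mc mM)
    (classical_dense mc mM m1).

Lemma classical_action_corresponds (act : X -> Y -> Y) :
  (forall x y, m (y, x) = act (x^-1)%g y) ->
  @corresponds_to_action R X classical_cqg id Y act classical_action.
Proof.
move=> mE; exists id; split => //; first by split; [exact: shom_id | exists id].
by move=> f y x /=; rewrite mE.
Qed.

End ClassicalCqg.

Lemma bool_levels_surj (n : nat) (s : bool) : exists x : bool, x = s.
Proof. by exists s. Qed.

Lemma bool_levels_nbhs (n : nat) (b : bool) : nbhs b [set c : bool | c = b].
Proof. exact: discrete_set1. Qed.

Lemma bool_levels_base (b : bool) U : nbhs b U ->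
  exists n : nat, [set c : bool | c = b] `<=` U.
Proof. by move=> bU; exists 0%N => _ ->; exact: nbhs_singleton. Qed.

Definition bool_levels : levels bool :=
  @Levels bool (fun=> bool) (fun _ b => b) (fun _ b => b) (fun _ _ => erefl)
    bool_levels_surj bool_levels_nbhs bool_levels_base.

Section PadicLevels.
Variables (p : nat) (hp : prime p).
Local Notation Zp := (padic hp).

Lemma residue_le m n (x y : Zp) : (m <= n)%N ->
  residue x n = residue y n -> residue x m = residue y m.
Proof.
move=> /subnK <-; elim: (n - m)%N => [//|k IH].
by rewrite addSn => e; apply: IH; rewrite -[LHS]residueP -[RHS]residueP e.
Qed.

Lemma padic_nat_subproof (k n : nat) :
  zred (k%:R : 'Z_(p ^ n.+2)) = (k%:R : 'Z_(p ^ n.+1)).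
Proof.
apply: ord_inj; rewrite /zred !val_Zp_nat ?(ppow_gt1 hp) //.
by rewrite modn_dvdm // dvdn_exp2l.
Qed.
Definition padic_nat (k : nat) : Zp := Padic hp (padic_nat_subproof k).

Lemma residue_surj n (s : 'Z_(p ^ n.+1)) : exists x : Zp, residue x n = s.
Proof. by exists (padic_nat s); rewrite /= natr_Zp. Qed.

(** By compactness: if each residue fibre of x contained a point outside U, these points would have
    a cluster point with the same residues as x, hence equal to x, although U is a neighbourhood of
    x that all of them avoid. *)
Lemma padic_base (x : Zp) U : nbhs x U ->
  exists n, [set y : Zp | residue y n = residue x n] `<=` U.
Proof.
move=> xU; apply: contrapT => /forallNP nU.
have {}nU n : exists y : Zp, residue y n = residue x n /\ ~ U y.
  by have /existsNP[y /not_implyP[yx Uy]] := nU n; exists y.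
pose u n := projT1 (cid (nU n)).
have uP n : residue (u n) n = residue x n /\ ~ U (u n) := projT2 (cid (nU n)).
have [y [_ cly]] := @padic_compact p hp (u @ \oo) _ filterT.
have Fm m : (u @ \oo) [set u n | n in [set n | (m <= n)%N]].
  by exists m => // n /= mn; exists n.
have yx : y = x.
  apply: padicP => m; have [_ [[n /= mn <-] /= <-]] := cly _ _ (Fm m)
    (nbhs_residue y m).
  by apply: (residue_le mn); case: (uP n).
rewrite {}yx in cly; have [_ [[n _ <-]]] := cly _ _ (Fm 0%N) xU.
by case: (uP n).
Qed.

Definition padic_levels : levels Zp :=
  @Levels Zp (fun n => 'Z_(p ^ n.+1)) (fun n x => residue x n)
    (fun n => @zred p n)
    (fun n x => residueP x n) residue_surj (fun n x => nbhs_residue x n)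
      padic_base.

Definition sd_levels : levels (padic_sdprod hp) :=
  prod_levels padic_levels bool_levels.

End PadicLevels.

(** * Characters of the p-adic integers *)

Section Cis.
Variable R : realType.
Local Notation C := R[i].

Definition cis (a : R) : C := cos a +i* sin a.

Lemma cis0 : cis 0 = 1. Proof. by rewrite /cis cos0 sin0. Qed.

Lemma cisD a b : cis (a + b) = cis a * cis b.
Proof. by rewrite /cis cosD sinD; simpc; rewrite [sin a * _ + _]addrC. Qed.

Lemma cisX a n : cis a ^+ n = cis (a * n%:R).
Proof.
elim: n => [|n IH]; first by rewrite mulr0 cis0.
by rewrite exprS IH -cisD -natr1 mulrDr mulr1 addrC.
Qed.

Lemma cis_conj a : conjc (cis a) * cis a = 1.
Proof.
by rewrite conjc_mul_norm /= sqr_sqrtr ?addr_ge0 ?sqr_ge0 // cos2Dsin2.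
Qed.

Lemma cis_2pi : cis (2 * pi) = 1.
Proof. by rewrite mulr_natl /cis cos2pi sin2pi. Qed.

(** Since cos a = 1 - 2 sin^2(a/2), and a/2 lies strictly between 0 and pi, where the sine is
    positive. *)
Lemma cis_neq1 a : 0 < a < 2 * pi -> cis a != 1.
Proof.
move=> /andP[a0 a2]; apply/eqP => /eqP; rewrite eq_complex /= =>
  /andP[/eqP ca _].
have s0 : 0 < sin (a / 2).
  by apply: sin_gt0_pi; rewrite divr_gt0 //= ltr_pdivrMr // mulrC.
have := cosD (a / 2) (a / 2); rewrite -splitr ca -!expr2 => /eqP.
rewrite cos2sin2 -addrA -opprD -mulr2n -subr_eq0 opprB addrC subrK.
by rewrite mulrn_eq0 sqrf_eq0 /= gt_eqF.
Qed.

End Cis.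

(** * Roots of unity and spectral projections of unitaries of finite order *)

Section Fourier.
Variables (R : realType) (p : nat) (hp : prime p).
Local Notation C := R[i].
Local Notation Zp := (padic hp).

Lemma ppow_gt0 n : (0 < p ^ n)%N.
Proof. by rewrite expn_gt0 prime_gt0. Qed.

Lemma Zp_ord n : (Zp_trunc (p ^ n.+1)).+2 = (p ^ n.+1)%N.
Proof. exact: Zp_cast (ppow_gt1 hp n). Qed.

Definition omega n : C := cis (2 * pi / (p ^ n.+1)%:R).

Lemma ppow_neq0 n : (p ^ n)%:R != 0 :> R.
Proof. by rewrite pnatr_eq0 -lt0n ppow_gt0. Qed.

Lemma omega_prim n : (p ^ n.+1).-primitive_root (omega n).
Proof.
apply/andP; split; first exact: ppow_gt0.
apply/forallP => i; rewrite unity_rootE /omega cisX.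
case: (eqVneq i.+1 (p ^ n.+1)%N) => [->|iN].
  by rewrite divfK ?ppow_neq0 // cis_2pi eqxx.
have iN' : (i.+1 < p ^ n.+1)%N by rewrite ltn_neqAle iN ltn_ord.
have pN : 0 < (p ^ n.+1)%:R :> R by rewrite ltr0n ppow_gt0.
rewrite eqbF_neg; apply: cis_neq1; rewrite mulr_gt0 ?divr_gt0 ?mulr_gt0
  ?pi_gt0 //=.
by rewrite mulrAC ltr_pdivrMr // ltr_pM2l ?mulr_gt0 ?pi_gt0 // ltr_nat.
Qed.

Lemma omega_conj n : conjc (omega n) * omega n = 1.
Proof. exact: cis_conj. Qed.

Lemma omegaX_conj n k : conjc (omega n) ^+ k * omega n ^+ k = 1.
Proof. by rewrite -exprMn omega_conj expr1n. Qed.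

Lemma omega_expS n : omega n.+1 ^+ p = omega n.
Proof.
rewrite /omega cisX; congr cis; rewrite -mulrA; congr (_ * _).
rewrite (expnS p n.+1) natrM invfM mulrAC mulVf ?mul1r //.
by have := ppow_neq0 1; rewrite expn1.
Qed.

Lemma omega_exp_mod n k : omega n ^+ (k %% p ^ n.+1) = omega n ^+ k.
Proof. exact: prim_expr_mod (omega_prim n) k. Qed.

Lemma omega_inj n (s t : 'Z_(p ^ n.+1)) :
  (omega n ^+ s == omega n ^+ t) = (s == t).
Proof.
rewrite (eq_prim_root_expr (omega_prim n)) !modn_small //.
  by rewrite -[X in (_ < X)%N]Zp_ord ltn_ord.
by rewrite -[X in (_ < X)%N]Zp_ord ltn_ord.
Qed.

(** Telescoping, valid in a noncommutative ring: for scalars it gives the orthogonality of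
    characters, for elements of a C*-algebra the eigenvalue equation of [fproj]. *)
Lemma geom_fix (B : pzRingType) (W : B) n : W ^+ (p ^ n.+1) = 1 ->
  W * (\sum_(i : 'Z_(p ^ n.+1)) W ^+ i) = \sum_(i : 'Z_(p ^ n.+1)) W ^+ i.
Proof.
move=> WN; apply/eqP; rewrite -subr_eq0 -{2}[\sum_i _]mul1r -mulrBl -subrX1.
by rewrite Zp_ord WN subrr.
Qed.

Lemma geom_sum n (z : C) : z ^+ (p ^ n.+1) = 1 ->
  \sum_(i : 'Z_(p ^ n.+1)) z ^+ i = (z == 1)%:R * (p ^ n.+1)%:R.
Proof.
move=> zN; case: (eqVneq z 1) => [->|z1].
  by under eq_bigr do rewrite expr1n; rewrite mul1r sumr_const card_ord Zp_ord.
apply/eqP; rewrite mul0r.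
have /eqP := geom_fix zN; rewrite -subr_eq0 -{2}[\sum_i _]mul1r -mulrBl.
by rewrite mulf_eq0 subr_eq0 (negPf z1).
Qed.

Section Spectral.
Variable B : cstarType R.

(* The spectral projection of [U] for the eigenvalue [omega n ^+ s]. *)
Definition fproj n (U : B) (s : 'Z_(p ^ n.+1)) : B :=
  ((p ^ n.+1)%:R : C)^-1 *: \sum_(i : 'Z_(p ^ n.+1))
    (conjc (omega n) ^+ s *: U) ^+ i.

Lemma ppowC_neq0 n : (p ^ n)%:R != 0 :> C.
Proof. by rewrite pnatr_eq0 -lt0n ppow_gt0. Qed.

Lemma omegaX_neq0 n k : omega n ^+ k != 0.
Proof.
by apply: contra_eq_neq (omegaX_conj n k) => ->; rewrite mulr0 eq_sym oner_eq0.
Qed.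

Lemma conj_omegaX n k : conjc (omega n) ^+ k = (omega n ^+ k)^-1.
Proof.
by apply: (mulIf (omegaX_neq0 n k)); rewrite omegaX_conj mulVf ?omegaX_neq0.
Qed.

Lemma conj_omega_exp1 n k : (conjc (omega n) ^+ k) ^+ (p ^ n.+1) = 1.
Proof.
by rewrite conj_omegaX exprVn exprAC (prim_expr_order (omega_prim n)) expr1n
  invr1.
Qed.

(** On Q the element U acts from the left as a scalar, so the average becomes a scalar geometric sum
    whose ratio is 1 exactly when s = r. *)
Lemma fproj_eigen n (U Q : B) (s r : 'Z_(p ^ n.+1)) :
  U * Q = omega n ^+ r *: Q -> fproj U s * Q = (s == r)%:R *: Q.
Proof.
move=> UQ; rewrite /fproj -scalerAl mulr_suml.
set z := conjc (omega n) ^+ s * omega n ^+ r.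
have WQ i : (conjc (omega n) ^+ s *: U) ^+ i * Q = z ^+ i *: Q.
  elim: i => [|i IH]; first by rewrite !expr0 mul1r scale1r.
  by rewrite exprSr -mulrA -scalerAl UQ scalerA -scalerAr IH scalerA -exprS.
under eq_bigr do rewrite WQ.
rewrite -scaler_suml geom_sum; last first.
  by rewrite exprMn conj_omega_exp1 exprAC (prim_expr_order (omega_prim n))
    expr1n mulr1.
rewrite scalerA mulrCA mulVf ?ppowC_neq0 // mulr1.
have -> : (z == 1) = (s == r) => //.
rewrite /z conj_omegaX -(inj_eq (mulfI (omegaX_neq0 n s))).
by rewrite mulVKf ?omegaX_neq0 // mulr1 eq_sym omega_inj.
Qed.

Variables (n : nat) (U : B).
Hypotheses (UN : U ^+ (p ^ n.+1) = 1) (UU : star U * U = 1).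

Lemma fproj_eq (s : 'Z_(p ^ n.+1)) : U * fproj U s = omega n ^+ s *: fproj U s.
Proof.
rewrite /fproj; set W := conjc _ ^+ s *: U.
have WN : W ^+ (p ^ n.+1) = 1 by rewrite exprZn UN conj_omega_exp1 scale1r.
have -> : U = omega n ^+ s *: W by rewrite scalerA mulrC omegaX_conj scale1r.
rewrite -scalerAl -scalerAr; congr (_ *: (_ *: _)).
exact: geom_fix.
Qed.

Lemma fprojM (s t : 'Z_(p ^ n.+1)) :
  fproj U s * fproj U t = if s == t then fproj U s else 0.
Proof.
rewrite (fproj_eigen s (fproj_eq t)).
by case: eqP => [->|_]; rewrite ?scale1r ?scale0r.
Qed.

Lemma star_unitary_root : star U = U ^+ (p ^ n.+1).-1.
Proof.
rewrite -[LHS]mulr1 -UN -[in LHS](prednK (ppow_gt0 n.+1)) exprS mulrA UU.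
by rewrite mul1r.
Qed.

Lemma fproj_comm (Z : B) (s : 'Z_(p ^ n.+1)) : U * Z = Z * U ->
  fproj U s * Z = Z * fproj U s.
Proof.
move=> UZ; rewrite /fproj -scalerAl -scalerAr; congr (_ *: _).
rewrite mulr_suml mulr_sumr; apply: eq_bigr => i _.
have : GRing.comm Z (conjc (omega n) ^+ s *: U).
  by rewrite /GRing.comm -scalerAl -scalerAr UZ.
by move=> /(@commrX _ _ _ i) ->.
Qed.

(** With P the projection, [star P] is again an eigenvector of the normal element U for the same
    eigenvalue. Hence [P * star P = star P], and the left-hand side is self-adjoint. *)
Lemma fproj_star (s : 'Z_(p ^ n.+1)) : star (fproj U s) = fproj U s.
Proof.
have UsU : U * star U = star U * U.
  by rewrite star_unitary_root -exprS -exprSr.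
have H : U * star (fproj U s) = omega n ^+ s *: star (fproj U s).
  have E : star (fproj U s) = conjc (omega n ^+ s) *: (star (fproj U s) * U).
    have E1 : star (fproj U s) * star U = conjc (omega n ^+ s) *:
      star (fproj U s).
      by rewrite -starM fproj_eq starZ.
    by rewrite scalerAl -E1 -mulrA UU mulr1.
  have Us : star U * fproj U s = fproj U s * star U.
    by apply/esym/fproj_comm.
  have E2 : star (fproj U s) * U = U * star (fproj U s).
    by have := congr1 star Us; rewrite !starM !starK.
  rewrite {2}E scalerA E2.
  by rewrite rmorphXn mulrC omegaX_conj scale1r.
have E := fproj_eigen s H; rewrite eqxx scale1r in E.
have := congr1 star E; rewrite starM starK => E'.
by rewrite -[RHS]E' E.
Qed.

Lemma fproj_sum : \sum_(s : 'Z_(p ^ n.+1)) fproj U s = 1.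
Proof.
have H (i : 'Z_(p ^ n.+1)) : \sum_(s : 'Z_(p ^ n.+1))
  (conjc (omega n) ^+ s *: U) ^+ i =
    (i == 0)%:R *: ((p ^ n.+1)%:R *: (1 : B)).
  case: (eqVneq i 0) => [->|i0].
    by rewrite scale1r scaler_nat sumr_const card_ord Zp_ord.
  rewrite scale0r; under eq_bigr do rewrite exprZn -exprM mulnC exprM.
  rewrite -scaler_suml geom_sum ?conj_omega_exp1 // conj_omegaX invr_eq1.
  by rewrite -(expr0 (omega n)) (omega_inj i 0) (negPf i0) mul0r scale0r.
rewrite /fproj -scaler_sumr exchange_big; under eq_bigr do rewrite H.
rewrite -scaler_suml scalerA mulrC -scalerA [X in _ *: X]scalerA.
rewrite mulVf ?ppowC_neq0 // scale1r (bigD1 0) //= big1 ?addr0 ?scale1r //.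
by move=> i /negPf ->.
Qed.

End Spectral.

(** Decompose 1 into the spectral projections of U: on the one with index t, U^p acts by
    [omega n.+1 ^+ (p * t)], which is [omega n ^+ zred t]. *)
Lemma fproj_down (B : cstarType R) n (U : B) (s : 'Z_(p ^ n.+1)) :
  U ^+ (p ^ n.+2) = 1 -> star U * U = 1 ->
  fproj (U ^+ p) s = \sum_(t : 'Z_(p ^ n.+2) | zred t == s) fproj U t.
Proof.
move=> UN UU; rewrite -[LHS]mulr1 -(fproj_sum n.+1 U) mulr_sumr [RHS]big_mkcond.
apply: eq_bigr => t _.
have H k : U ^+ k * fproj U t = omega n.+1 ^+ (t * k) *: fproj U t.
  elim: k => [|k IH]; first by rewrite muln0 !expr0 mul1r scale1r.
  by rewrite exprS -mulrA IH -scalerAr (fproj_eq UN) scalerA mulnSr exprD.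
rewrite (@fproj_eigen _ n _ _ s (zred t)); last first.
  rewrite H mulnC exprM omega_expS; congr (_ *: _).
  by rewrite /zred val_Zp_nat ?(ppow_gt1 hp) // omega_exp_mod.
by rewrite eq_sym; case: eqP => _; rewrite ?scale1r ?scale0r.
Qed.

End Fourier.

Section Characters.
Variables (R : realType) (p : nat) (hp : prime p).
Local Notation C := R[i].
Local Notation Zp := (padic hp).

Lemma lambdaE n (t s : 'Z_(p ^ n.+1)) :
  lambda R t s = omega R p n ^+ (t * s).
Proof.
by rewrite /lambda /omega cisX /cis mulrAC.
Qed.

(** A generator of the group of characters that factor through Z/p^(n+1); the choices are
    compatible, in that the p-th power of [chi n.+1] is [chi n]. *)
Definition chi n : cfun R Zp := pullback hp (@lambda R p n 1).

Lemma chiE n (x : Zp) : chi n x = omega R p n ^+ (residue x n).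
Proof. by rewrite /chi /= lambdaE mul1n. Qed.

Lemma pullback_chi n (t : 'Z_(p ^ n.+1)) :
  pullback hp (@lambda R p n t) = chi n ^+ t.
Proof.
by apply: cfunP => x; rewrite cfunXE chiE /= lambdaE mulnC exprM.
Qed.

Lemma chi_order n : chi n ^+ (p ^ n.+1) = 1.
Proof.
apply: cfunP => x; rewrite cfunXE chiE exprAC.
by rewrite (prim_expr_order (omega_prim R hp n)) expr1n.
Qed.

Lemma chi_exp_mod n k : chi n ^+ (k %% p ^ n.+1) = chi n ^+ k.
Proof. by rewrite {2}(divn_eq k (p ^ n.+1)) exprD mulnC exprM chi_order expr1n
  mul1r. Qed.

Lemma chi_unitary n : star (chi n) * chi n = 1.
Proof.
apply: cfunP => x; rewrite cfunME cfun_starE chiE.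
by have := omegaX_conj R p n (residue x n); rewrite -[conjc _ ^+ _]rmorphXn.
Qed.

Lemma chi_down n : chi n.+1 ^+ p = chi n.
Proof.
apply: cfunP => x; rewrite cfunXE !chiE exprAC omega_expS //.
by rewrite -(residueP x n) /zred val_Zp_nat ?(ppow_gt1 hp) // omega_exp_mod.
Qed.

Lemma chi_down_iter n k : chi (n + k) ^+ (p ^ k) = chi n.
Proof.
elim: k => [|k IH]; first by rewrite addn0 expr1.
by rewrite addnS expnS exprM chi_down.
Qed.

(** Fourier inversion on Z/p^(n+1). It translates statements about indicators of fibres, which
    govern homomorphisms out of C(Z_p), into statements about the single unitary [chi n]. *)
Lemma lind_padic n (s : 'Z_(p ^ n.+1)) :
  @lind R Zp (padic_levels hp) n s = fproj (chi n) s.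
Proof.
apply: cfunP => x; rewrite /fproj cfunZE cfun_sumE.
set z := conjc (omega R p n) ^+ s * omega R p n ^+ residue x n.
rewrite (eq_bigr (fun i : 'Z_(p ^ n.+1) => z ^+ i)); last first.
  by move=> i _; rewrite cfunXE cfunZE chiE.
rewrite geom_sum //; last first.
  rewrite exprMn conj_omega_exp1 // exprAC.
  by rewrite (prim_expr_order (omega_prim R hp n)) expr1n mulr1.
rewrite mulrCA mulVf ?ppowC_neq0 // mulr1 /=.
have -> : (z == 1) = (residue x n == s) => //.
rewrite /z conj_omegaX -(inj_eq (mulfI (omegaX_neq0 R p n s))).
by rewrite mulVKf ?omegaX_neq0 // mulr1 omega_inj.
Qed.

Lemma fproj_hom (A B : cstarType R) (phi : A -> B) n (U : A) (s : 'Z_(p ^ n.+1))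
  :
  star_hom phi -> phi (fproj U s) = fproj (phi U) s.
Proof.
move=> ph; rewrite /fproj (shom_scale ph) (shom_sum ph); congr (_ *: _).
by apply: eq_bigr => i _; rewrite (shom_exp ph) (shom_scale ph).
Qed.

Section Hom.
Variable B : cstarType R.

Lemma padic_hom_ext (phi psi : cfun R Zp -> B) :
  star_hom phi -> star_hom psi ->
  (forall n, phi (chi n.+2) = psi (chi n.+2)) -> forall f, phi f = psi f.
Proof.
move=> ph qh pq; apply: (@shom_level_ext _ _ (padic_levels hp)) => // n s.
rewrite lind_padic !fproj_hom // -(chi_down_iter n 2) (shom_exp ph)
  (shom_exp qh).
by rewrite addn2 pq.
Qed.

Lemma padic_hom_comm (phi : cfun R Zp -> B) z : star_hom phi ->
  (forall n, phi (chi n) * z = z * phi (chi n)) ->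
  forall f, phi f * z = z * phi f.
Proof.
move=> ph pz; apply: (@shom_level_commute _ _ (padic_levels hp)) => // n s.
by rewrite lind_padic fproj_hom // fproj_comm.
Qed.

Lemma padic_hom (V : nat -> B) : (forall n, V n ^+ (p ^ n.+1) = 1) ->
  (forall n, star (V n) * V n = 1) -> (forall n, V n.+1 ^+ p = V n) ->
  exists Phi : cfun R Zp -> B, star_hom Phi /\ forall n, Phi (chi n) = V n.
Proof.
move=> VN VU Vd.
have [||||Phi [Ph PE]] := @level_hom _ _ (padic_levels hp) B
  (fun n s => fproj (V n) s).
- by move=> n s; rewrite -Vd; apply: fproj_down.
- by move=> n s t; apply: fprojM.
- by move=> n s; apply: fproj_star.
- by move=> n; apply: fproj_sum.
(* Both [chi n] and [V n] are recovered from their spectral decompositions, which have the same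
   eigenvalues and corresponding projections. *)
exists Phi; split=> // n; rewrite -[chi n]mulr1 -(fproj_sum hp n (chi n))
  mulr_sumr.
rewrite (shom_sum Ph) -[RHS]mulr1 -(fproj_sum hp n (V n)) mulr_sumr.
apply: eq_bigr => s _; rewrite (fproj_eq hp (chi_order n)) (fproj_eq hp (VN n)).
by rewrite (shom_scale Ph) -lind_padic PE.
Qed.

End Hom.
End Characters.

(** * The Haar state and the filtration *)

Section Haar.
Variables (R : realType) (p : nat) (hp : prime p).
Local Notation C := R[i].
Local Notation Zp := (padic hp).
Local Notation L := (padic_levels hp).

(** All fibres are translates of the kernel, so they have a common size c, and p^(n+1) c =
    p^(n+2). *)
Lemma card_zred n (s : 'Z_(p ^ n.+1)) :
  (\sum_(t : 'Z_(p ^ n.+2) | zred t == s) 1)%N = p.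
Proof.
have E u : (\sum_(t : 'Z_(p ^ n.+2) | zred t == u) 1 =
    \sum_(t : 'Z_(p ^ n.+2) | zred t == 0%R) 1)%N.
  have [k <-] : exists k : 'Z_(p ^ n.+2), zred k = u.
    by have [x <-] := residue_surj hp u; exists (residue x n.+1);
      rewrite residueP.
  rewrite (reindex_inj (addrI k)); apply: eq_bigl => t.
  by rewrite (zredD hp) -subr_eq0 addrC addKr.
have : (\sum_(t : 'Z_(p ^ n.+2)) 1 = p ^ n.+2)%N.
  by rewrite sum1_card card_ord Zp_ord.
rewrite (partition_big (@zred p n) predT) //=.
under eq_bigr do rewrite E.
rewrite sum_nat_const card_ord E; move: (\sum_(t | _) 1)%N => c.
by rewrite Zp_ord // (expnSr p n.+1) => /eqP; rewrite eqn_pmul2l ?ppow_gt0 // =>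
  /eqP.
Qed.

(* [level_extension] needs a C*-algebra as its target: the state is obtained
  with
   values in the constants of C(bool). *)
Let B : cstarType R := cfun R bool.
Let v n (s : lfin L n) : B := ((p ^ n.+1)%:R^-1 : C) *: 1.

Lemma haar_v_down n (s : lfin L n) : v s = \sum_(t | ldown t == s :> lfin L n) v
  t.
Proof.
rewrite /v big_const_seq iter_addr_0 -sum1_count (card_zred s) -[RHS]scaler_nat
  scalerA.
congr (_ *: _).
rewrite (expnS p n.+1) natrM invfM mulrA mulfV ?mul1r //.
by have := ppowC_neq0 R hp 1; rewrite expn1.
Qed.

Lemma haar_v_bound n f : cnorm (lsum (@v n) f) <= cnorm f.
Proof.
apply: le_trans (cnorm_sum _ _ _) _.
apply: (@le_trans _ _ (\sum_(s : lfin L n) cnorm f * (p ^ n.+1)%:R^-1)).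
  apply: ler_sum => s _; rewrite /v scalerA cnormZ cnorm1 mulr1 normcM.
  have -> : ((p ^ n.+1)%:R^-1 : C) = ((p ^ n.+1)%:R^-1)%:C.
    by rewrite fmorphV rmorph_nat.
  rewrite normc_real ger0_norm ?invr_ge0 ?ler0n //.
  by rewrite ler_wpM2r ?invr_ge0 ?ler0n ?cfun_le_cnorm.
rewrite sumr_const -mulrnAr -mulr_natr card_ord Zp_ord // mulVf ?mulr1 //.
exact: ppow_neq0.
Qed.

Lemma closed_ge0 (z : C) :
  (forall e : R, 0 < e -> exists2 w : C, 0 <= w & normc (w - z) < e) -> 0 <= z.
Proof.
move=> zc; have zI : complex.Im z = 0.
  apply/eqP; rewrite -normr_eq0 eq_le normr_ge0 andbT.
  apply/ler_addgt0Pr => e e0; rewrite add0r.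
  have [w w0 /ltW] := zc e e0; apply: le_trans.
  apply: le_trans (normc_Im _); rewrite raddfB /=.
  by move: w0; rewrite lecE /= => /andP[/eqP -> _]; rewrite sub0r normrN.
rewrite lecE zI eqxx /= -oppr_le0; apply/ler_addgt0Pr => e e0; rewrite add0r.
have [w w0 /ltW] := zc e e0; apply: le_trans.
apply: le_trans (normc_Re _); apply: le_trans (ler_norm _); rewrite raddfB /=.
by move: w0; rewrite lecE /= => /andP[_ w0]; rewrite lerDr.
Qed.

Lemma haar_exists : exists omega : cfun R Zp -> C, is_haar_state omega /\
  is_faithful omega.
Proof.
have [Phi [Pc Ps]] := level_extension haar_v_down haar_v_bound.
have Pl a f g : Phi (a *: f + g) = a *: Phi f + Phi g.
  apply: (ccvg_uniq (Pc _)).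
  have := ccvgD (ccvgZ a (Pc f)) (Pc g); congr ccvg; apply: funext => n.
  by rewrite lsum_lin.
have P0 : Phi 0 = 0.
  by have := Pl (-1) 0 0; rewrite !scaleN1r oppr0 addr0 addNr.
have PB f g : Phi (f - g) = Phi f - Phi g.
  by rewrite addrC -scaleN1r Pl scaleN1r addrC.
have Pn f : cnorm (Phi f) <= cnorm f.
  by apply: ccvg_cnorm (Pc f) _ => n; exact: haar_v_bound.
have Pind n (s : lfin L n) : Phi (lind R s) = v s.
  rewrite Ps (bigD1 s) //= eqxx scale1r big1 ?addr0 // => t /negPf ->.
  by rewrite scale0r.
(* The values of [Phi] are limits of constant functions on [bool], hence constant; evaluation at
   [true] extracts the scalar. *)
pose om (f : cfun R Zp) : C := Phi f true.
have omZ c f : om (c *: f) = c * om f.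
  by have := Pl c f 0; rewrite !addr0 P0 addr0 /om => ->.
have om_pos (f : cfun R Zp) : (forall x, 0 <= f x) -> 0 <= om f.
  move=> f0; apply: closed_ge0 => e e0; have [N /(_ N (leqnn _)) NP] :=
    Pc f e e0.
  exists (lsum (@v N) f true).
    rewrite /lsum cfun_sumE sumr_ge0 // => s _; rewrite cfunZE mulr_ge0 ?f0 //.
    by rewrite /v cfunZE cfun1E mulr1 invr_ge0 ler0n.
  by apply: le_lt_trans NP; rewrite -cfunBE; exact: cfun_le_cnorm.
have om_st : is_state om.
  split.
  - by move=> c f g; rewrite /om Pl.
  - rewrite /om -(lind_sum R L 0) (_ : Phi _ = \sum_(s : lfin L 0) v s).
      rewrite sumr_const card_ord Zp_ord // -scaler_nat scalerA.
      by rewrite mulfV ?ppowC_neq0 // scale1r.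
    rewrite lind_sum; have -> : (1 : cfun R Zp) = lstep (fun _ : lfin L 0 => 1).
      exact: cfunP.
    by rewrite Ps; apply: eq_bigr => s _; rewrite scale1r.
  - by move=> f; apply: om_pos => x; rewrite cfunME cfun_starE conjc_mul_norm
    ler0c sqr_ge0.
exists om; split.
  split=> // k f g gE.
  have Tc : continuous (fun t : Zp => k + t).
    apply: padic_continuousP => t n; apply: filterS (nbhs_residue t n).
    by move=> s /= ->.
  have Th := cfun_comp_hom R Tc.
  have -> : g = cfun_comp Tc f by apply: cfunP => t; rewrite gE.
  rewrite /om; congr (cfun_fun _ true).
  have H (psi : cfun R Zp -> cfun R Zp) : star_hom psi ->
      ccvg (fun n => Phi (psi (lapprox L n f))) (Phi (psi f)).
    move=> ps e e0; have [N NP] := shom_lapprox L f ps e0; exists N => n /NP.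
    by rewrite -PB; apply: le_lt_trans.
  apply: (ccvg_uniq (H _ Th)).
  have := H _ (@shom_id _ _); congr ccvg; apply: funext => n.
  have Psum (F : lfin L n -> cfun R Zp) : Phi (\sum_s F s) = \sum_s Phi (F s).
    apply: (big_morph _ _ P0) => a b.
    by have := Pl 1 a b; rewrite !scale1r.
  have PZ c a : Phi (c *: a) = c *: Phi a.
    by have := Pl c a 0; rewrite !addr0 P0 addr0.
  rewrite /lapprox lstep_lind (shom_sum Th) !Psum; apply: eq_bigr => s _.
  rewrite (shom_scale Th) !PZ; congr (_ *: _).
  (* Translation permutes the fibres of each level, and these all carry the same weight. *)
  have -> : cfun_comp Tc (lind R s) = @lind R Zp L n (s - residue k n).
    apply: cfunP => x /=; congr (_%:R); congr nat_of_bool.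
    by rewrite [RHS]eq_sym subr_eq eq_sym addrC.
  by rewrite !Pind.
(* Faithfulness: if a(x) is nonzero, then |a|^2 dominates r/2 times the indicator of a whole fibre
   around x, with r = |a(x)|^2, and that indicator has positive integral. *)
move=> a oma; apply: cfunP => x; apply: contrapT => ax.
have r0 : 0 < normc (a x) ^+ 2.
  rewrite exprn_gt0 // lt_neqAle normc_ge0 andbT eq_sym.
  by apply/eqP => /eq0_normc.
set r := normc (a x) ^+ 2 in r0.
have fE y : (star a * a) y = (normc (a y) ^+ 2)%:C.
  by rewrite cfunME cfun_starE conjc_mul_norm.
have r2 : 0 < r / 2 by rewrite divr_gt0.
have [n nP] := cfun_level_uniform L (star a * a) r2.
have := om_pos (star a * a - (r / 2)%:C *: lind R (lproj L n x)).
have -> : om (star a * a - (r / 2)%:C *: lind R (lproj L n x)) =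
    - ((r / 2)%:C * (p ^ n.+1)%:R^-1).
  rewrite addrC -scaleN1r /om Pl cfunDE cfunZE -/(om _) -/(om (star a * a)).
  by rewrite oma addr0 omZ /om Pind /v cfunZE cfun1E mulr1 mulN1r.
suff H y : 0 <= (star a * a - (r / 2)%:C *: lind R (lproj L n x)) y.
  move=> /(_ H); rewrite oppr_ge0 => /le_gtF; rewrite mulr_gt0 ?ltcR //.
  by rewrite invr_gt0 ltr0n ppow_gt0.
rewrite cfunBE fE cfunZE /=.
case: eqP => [xy|_] /=; last by rewrite mulr0 subr0 ler0c sqr_ge0.
have := nP x y (esym xy); rewrite !fE -rmorphB normc_real mulr1 -rmorphB ler0c.
rewrite -/r subr_ge0 => /(le_lt_trans (ler_norm _)).
by rewrite ltrBlDr {1}(splitr r) ltrD2l => /ltW.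
Qed.

End Haar.

Section WordLength.
Variable G : zmodType.
Variable g : G.
Local Notation S := [:: g; - g].

Lemma is_word_pm k t : is_word S k t <->
  exists a b : nat, (a + b = k)%N /\ t = g *+ a - g *+ b.
Proof.
split=> [[w [<- wS <-]]|[a [b [<- ->]]]].
  elim: w wS => [|x w IH] wS; first by exists 0%N, 0%N; rewrite big_nil subrr.
  have [|a [b [ab wE]]] := IH; first by move=> y yw; apply: wS;
    rewrite inE yw orbT.
  have := wS x (mem_head _ _); rewrite !inE big_cons wE => /orP[]/eqP->.
    by exists a.+1, b; rewrite addSn ab mulrS addrA.
  by exists a, b.+1; rewrite addnS ab mulrS opprD addrCA.
exists (nseq a g ++ nseq b (- g)); split.
- by rewrite size_cat !size_nseq.
- move=> x; rewrite mem_cat !mem_nseq !inE.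
  by case/orP => /andP[_ ->] //; rewrite orbT.
- by rewrite big_cat /= !big_nseq !iter_addr_0 mulNrn.
Qed.

(** A shortest word cannot contain both generators, since a cancelling pair could be dropped. *)
Lemma word_length_pm k t : word_length S t k -> t = g *+ k \/ t = - (g *+ k).
Proof.
move=> [/is_word_pm[a [b [abk tE]]] kmin].
case: a b abk tE => [|a] [|b] //= abk tE.
- by left; rewrite -abk tE subrr.
- by right; rewrite -abk tE sub0r add0n.
- by left; rewrite -abk tE subr0 addn0.
have : (k <= a + b)%N.
  apply: kmin; apply/is_word_pm; exists a, b; split=> //.
  by rewrite tE !mulrS opprD addrACA subrr add0r.
by rewrite -abk addnS addSn ltnNge leqnSn.
Qed.

Lemma word_length_opp k t : word_length S t k -> word_length S (- t) k.
Proof.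
have H j s : is_word S j s -> is_word S j (- s).
  move=> /is_word_pm[a [b [<- ->]]]; apply/is_word_pm; exists b, a.
  by rewrite addnC opprB.
by move=> [tk kmin]; split; [exact: H | move=> j /H; rewrite opprK; exact:
  kmin].
Qed.

Lemma word_length_exists a : exists k, word_length S (g *+ a) k.
Proof.
have ex : exists j, `[< is_word S j (g *+ a) >].
  by exists a; apply/asboolP/is_word_pm; exists a, 0%N; rewrite addn0 subr0.
exists (ex_minn ex); case: ex_minnP => k /asboolP ka kmin; split=> // j ja.
by apply: kmin; apply/asboolP.
Qed.

End WordLength.

Section Filtration.
Variables (R : realType) (p : nat) (hp : prime p).
Local Notation C := R[i].
Local Notation Zp := (padic hp).
Local Notation A := (cfun R Zp).
Local Notation chi := (chi R hp).

Lemma lin_eq (V : lmodType C) (S S' : set V) : S `<=` lin S' -> S' `<=` lin S ->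
  lin S = lin S'.
Proof. by move=> SS' S'S; apply/seteqP; split; exact: lin_mono. Qed.

Lemma Zp_val_add n (s t : 'Z_(p ^ n.+1)) :
  nat_of_ord (s + t) = ((s + t) %% p ^ n.+1)%N.
Proof.
transitivity ((s + t) %% (Zp_trunc (p ^ n.+1)).+2)%N; first by [].
by congr (_ %% _)%N; exact: Zp_ord.
Qed.

Lemma chiD n (s t : 'Z_(p ^ n.+1)) : chi n ^+ (s + t)%R = chi n ^+ s * chi n ^+
  t.
Proof. by rewrite Zp_val_add chi_exp_mod exprD. Qed.

Lemma chiX_unitary n k : star (chi n ^+ k) * chi n ^+ k = 1.
Proof.
apply: cfunP => x; rewrite cfunME cfun_starE cfunXE chiE -exprM.
by have := omegaX_conj R p n (residue x n * k); rewrite -[conjc _ ^+ _]rmorphXn.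
Qed.

Lemma chi_opp n (t : 'Z_(p ^ n.+1)) : chi n ^+ (- t)%R = star (chi n ^+ t).
Proof.
have -> : chi n ^+ (- t)%R = star (chi n ^+ t) *
  (chi n ^+ t * chi n ^+ (- t)%R).
  by rewrite mulrA chiX_unitary mul1r.
by rewrite -chiD subrr expr0 mulr1.
Qed.

(** Only t and -t share the word-length of t, and the character of -t is the conjugate of that of
    t. *)
Lemma V_levelE n k (t : 'Z_(p ^ n.+1)) : word_length [:: 1; - 1] t k ->
  @V_level R p hp n k = lin [set` [:: chi n ^+ t; star (chi n ^+ t)]].
Proof.
move=> tk; apply: lin_eq.
  move=> _ [s /= sk <-]; rewrite pullback_chi; apply: lin_subset;
    rewrite /= !inE.
  have [->|->] : s = t \/ s = - t.
    case: (word_length_pm tk) (word_length_pm sk) => -> [] ->; rewrite ?opprK;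
      auto.
    by rewrite eqxx.
  by rewrite chi_opp eqxx orbT.
move=> f /=; rewrite !inE => /orP[] /eqP ->; apply: lin_subset.
  by exists t; rewrite ?pullback_chi.
exists (- t); first exact: word_length_opp.
by rewrite pullback_chi chi_opp.
Qed.

Lemma V_infP (W : set A) : V_inf_subspaces W <->
  exists n (t : 'Z_(p ^ n.+1)), W = lin [set`
    [:: chi n ^+ t; star (chi n ^+ t)]].
Proof.
split=> [[n [k [[t tk] ->]]]|[n [t ->]]].
  by exists n, t; rewrite (V_levelE tk).
have [k] := word_length_exists (1 : 'Z_(p ^ n.+1)) t.
rewrite natr_Zp => tk; exists n, k; split; first by exists t.
by rewrite (V_levelE tk).
Qed.

Lemma V_infE (i : set_type (@V_inf_subspaces R p hp)) :
  exists n (t : 'Z_(p ^ n.+1)),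
    V_inf i = lin [set` [:: chi n ^+ t; star (chi n ^+ t)]].
Proof. by have /V_infP := set_valP i. Qed.

Definition V_span : set A := lin (\bigcup_i @V_inf R p hp i).

Lemma V_span_chi n k : V_span (chi n ^+ k).
Proof.
rewrite -chi_exp_mod -(val_Zp_nat (ppow_gt1 hp n)).
set t : 'Z_(p ^ n.+1) := k%:R.
have WV : V_inf_subspaces (lin [set` [:: chi n ^+ t; star (chi n ^+ t)]]).
  by apply/V_infP; exists n, t.
apply: lin_subset; exists (SigSub (mem_set WV)) => //.
by rewrite /V_inf set_valE; apply: lin_subset; rewrite /= mem_head.
Qed.

Lemma V_span_ind (K : A -> Prop) : K 0 -> (forall x y, K x -> K y -> K (x + y))
  ->
  (forall c x, K x -> K (c *: x)) -> (forall n k, K (chi n ^+ k)) ->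
  forall x, V_span x -> K x.
Proof.
move=> K0 KD KZ KX x; apply: lin_ind => // {}x [i _].
have [n [t ->]] := V_infE i.
apply: lin_ind => // y /=; rewrite !inE => /orP[] /eqP -> //.
by rewrite -chi_opp.
Qed.

Lemma V_span_star x : V_span x -> V_span (star x).
Proof.
move: x; apply: V_span_ind.
- by rewrite star0; exact: lin0.
- by move=> x y; rewrite starD; exact: linD.
- by move=> c x; rewrite starZ; exact: linZ.
- move=> n k; rewrite starX (star_unitary_root hp (chi_order R hp n))
  ?chi_unitary //.
  by rewrite -exprM; exact: V_span_chi.
Qed.

Lemma V_span_mul x y : V_span x -> V_span y -> V_span (x * y).
Proof.
move=> + yV; move: x; apply: V_span_ind.
- by rewrite mul0r; exact: lin0.
- by move=> u v; rewrite mulrDl; exact: linD.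
- by move=> c u; rewrite -scalerAl; exact: linZ.
move=> n k; move: y yV; apply: V_span_ind.
- by rewrite mulr0; exact: lin0.
- by move=> u v; rewrite mulrDr; exact: linD.
- by move=> c u; rewrite -scalerAr; exact: linZ.
(* Characters of different levels are both powers of the one at level n + m. *)
move=> m j; rewrite -(chi_down_iter R hp n m) -(chi_down_iter R hp m n) addnC.
by rewrite -!exprM -exprD; exact: V_span_chi.
Qed.

Lemma V_span_dense : cdense V_span.
Proof.
move=> f e e0; have [N /(_ N (leqnn _)) NP] := lapprox_cvg (padic_levels hp) f
  e0.
exists (lapprox (padic_levels hp) N f); last by rewrite cnormB.
rewrite /lapprox lstep_lind; apply: lin_sum => s _; apply/linZ.
rewrite lind_padic; apply/linZ/lin_sum => i _.
by rewrite exprZn; apply/linZ; exact: V_span_chi.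
Qed.

Lemma chiX_add n k (x y : Zp) : (chi n ^+ k) (x + y) = (chi n ^+ k) x *
  (chi n ^+ k) y.
Proof.
rewrite !cfunXE !chiE -exprMn -exprD.
have -> : residue (x + y) n = residue x n + residue y n by [].
by rewrite Zp_val_add omega_exp_mod.
Qed.

(** Translation by a k with f(k) different from 1 multiplies f by f(k) but does not change its
    integral. *)
Lemma haar_char (omega : A -> C) (f : A) : is_haar_state omega ->
  (forall x y, f (x + y) = f x * f y) -> f != 1 -> omega f = 0.
Proof.
move=> [os oi] fM f1; have [k fk] : exists k, f k != 1.
  apply: contrapT => /forallNP H; case/eqP: f1; apply: cfunP => x.
  by apply/eqP; apply: contrapT => /negP/H.
have := oi k f (f k *: f); rewrite (state_scale os) =>
  /(_ (fun t => esym (fM k t))).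
move=> /eqP; rewrite -subr_eq0 -[X in _ - X]mul1r -mulrBl mulf_eq0 subr_eq0.
by rewrite (negPf fk) => /eqP.
Qed.

Lemma haar_orthogonal_filtration (omega : A -> C) : is_haar_state omega ->
  is_faithful omega -> orthogonal_filtration omega (@V_inf R p hp).
Proof.
move=> oh ofa; have os := oh.1; split => //.
- move=> i; have [n [t tE]] := V_infE i.
  by exists [:: chi n ^+ t; star (chi n ^+ t)].
- have WV : V_inf_subspaces (lin [set` [:: chi 0 ^+ (0%R : 'Z_(p ^ 1));
  star (chi 0 ^+ (0%R : 'Z_(p ^ 1)))]]).
    by apply/V_infP; exists 0%N, 0%R.
  exists (SigSub (mem_set WV)); rewrite /V_inf set_valE /=.
  congr lin; apply/seteqP; split => x /=; rewrite !inE expr0 star1.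
    by case/orP => /eqP.
  by move=> ->; rewrite eqxx.
- move=> i j ij; have [n [t iE]] := V_infE i.
  have [m [s jE]] := V_infE j.
  have neq f g : f \in [:: chi n ^+ t; star (chi n ^+ t)] ->
      g \in [:: chi m ^+ s; star (chi m ^+ s)] -> omega (star f * g) = 0.
    move=> fi gj; apply: haar_char => //.
      have fM x y : f (x + y) = f x * f y.
        move: fi; rewrite !inE => /orP[] /eqP ->; first exact: chiX_add.
        by rewrite !cfun_starE chiX_add rmorphM.
      have gM x y : g (x + y) = g x * g y.
        move: gj; rewrite !inE => /orP[] /eqP ->; first exact: chiX_add.
        by rewrite !cfun_starE chiX_add rmorphM.
      by move=> x y; rewrite !cfunME !cfun_starE fM gM rmorphM mulrACA.
    (* If the product is the trivial character, then g = f and the two subspaces coincide; as the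
       family is indexed by its own members, this means i = j. *)
    apply/eqP => fg1; apply: ij; apply: val_inj.
    have fu : f * star f = 1.
      move: fi; rewrite !inE => /orP[] /eqP ->; rewrite ?starK ?chiX_unitary //.
      by apply: cfunP => x; rewrite cfunME mulrC -cfunME chiX_unitary.
    have gf : g = f by rewrite -[g]mul1r -fu -mulrA fg1 mulr1.
    have sE (u : A) : [set` [:: u; star u]] = [set` [:: star u; star (star u)]].
      by apply/seteqP; split => x /=; rewrite starK !inE orbC.
    rewrite -[LHS]/(V_inf i) -[RHS]/(V_inf j) iE jE; congr lin.
    have H1 : [set` [:: chi n ^+ t; star (chi n ^+ t)]] = [set` [:: f; star f]].
      by move: fi; rewrite !inE => /orP[] /eqP ->.
    have H2 : [set` [:: chi m ^+ s; star (chi m ^+ s)]] = [set` [:: g; star g]].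
      by move: gj; rewrite !inE => /orP[] /eqP ->.
    by rewrite H1 H2 gf.
  move=> a b; rewrite iE jE => ai bj.
  elim/lin_ind: ai => [|x y|c x|x xi].
  + by rewrite star0 mul0r (state_0 os).
  + by rewrite starD mulrDl (state_add os) => -> ->; rewrite addr0.
  + by rewrite starZ -scalerAl (state_scale os) => ->; rewrite mulr0.
  elim/lin_ind: bj => [|z y|c z|z zi].
  + by rewrite mulr0 (state_0 os).
  + by rewrite mulrDr (state_add os) => -> ->; rewrite addr0.
  + by rewrite -scalerAr (state_scale os) => ->; rewrite mulr0.
  exact: neq.
- by split; [exact: V_span_dense | exact: V_span_mul | exact: V_span_star].
Qed.

End Filtration.

(** * Actions preserving the filtration *)

Section TensorTheory.
Variables (R : realType) (A B : cstarType R) (T : mintensor A B).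

Lemma tensDl a a' b : tens T (a + a') b = tens T a b + tens T a' b.
Proof. by have := tens_linl T b 1 a a'; rewrite !scale1r. Qed.

Lemma tensDr a b b' : tens T a (b + b') = tens T a b + tens T a b'.
Proof. by have := tens_linr T a 1 b b'; rewrite !scale1r. Qed.

Lemma tens0l b : tens T 0 b = 0.
Proof. by apply: (@addrI _ (tens T 0 b)); rewrite -tensDl !addr0. Qed.

Lemma tens0r a : tens T a 0 = 0.
Proof. by apply: (@addrI _ (tens T a 0)); rewrite -tensDr !addr0. Qed.

Lemma tensZl c a b : tens T (c *: a) b = c *: tens T a b.
Proof. by have := tens_linl T b c a 0; rewrite addr0 tens0l addr0. Qed.

Lemma tensZr c a b : tens T a (c *: b) = c *: tens T a b.
Proof. by have := tens_linr T a c b 0; rewrite addr0 tens0r addr0. Qed.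

Lemma tensNr a b : tens T a (- b) = - tens T a b.
Proof. by rewrite -scaleN1r tensZr scaleN1r. Qed.

Lemma tens_left_hom (D : cstarType R) (f : D -> A) : star_hom f ->
  star_hom (fun x => tens T (f x) 1).
Proof.
move=> fh; split=> [c x y||x y|x].
- by rewrite (shom_add fh) (shom_scale fh) tensDl tensZl.
- by rewrite (shom1 fh) tens1.
- by rewrite (shom_mul fh) tensM mulr1.
- by rewrite (shom_star fh) tens_star star1.
Qed.

Lemma tens_right_hom (D : cstarType R) (f : D -> B) : star_hom f ->
  star_hom (fun x => tens T 1 (f x)).
Proof.
move=> fh; split=> [c x y||x y|x].
- by rewrite (shom_add fh) (shom_scale fh) tensDr tensZr.
- by rewrite (shom1 fh) tens1.
- by rewrite (shom_mul fh) tensM mulr1.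
- by rewrite (shom_star fh) tens_star star1.
Qed.

(** Extracts the two coefficients from the form in which [preserves] is stated. The vectors f and g
    may be dependent, as for a character of order at most 2, so only existence is claimed. *)
Lemma lin_tens_pair (f g : A) z :
  lin [set tens T w b | w in lin [set` [:: f; g]] & b in [set: B]] z ->
  exists a b, z = tens T f a + tens T g b.
Proof.
move: z; apply: lin_ind.
- by exists 0, 0; rewrite !tens0r addr0.
- move=> _ _ [a [b ->]] [c [d ->]]; exists (a + c), (b + d).
  by rewrite !tensDr addrACA.
- move=> c _ [a [b ->]]; exists (c *: a), (c *: b).
  by rewrite !tensZr scalerDr.
move=> _ [w wl [d _ <-]]; move: w wl; apply: lin_ind.
- by exists 0, 0; rewrite !tens0r addr0 tens0l.
- move=> x y [a [b xE]] [a' [b' yE]]; exists (a + a'), (b + b').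
  by rewrite !tensDr addrACA tensDl xE yE.
- move=> c x [a [b xE]]; exists (c *: a), (c *: b).
  by rewrite !tensZr -scalerDr -xE tensZl.
move=> x /=; rewrite !inE => /orP[] /eqP ->.
  by exists d, 0; rewrite tens0r addr0.
by exists 0, d; rewrite tens0r add0r.
Qed.

End TensorTheory.

Section Independence.
Variables (R : realType) (p : nat) (hp : prime p).
Local Notation C := R[i].
Local Notation Zp := (padic hp).
Local Notation A := (cfun R Zp).
Local Notation chi := (chi R hp).

Lemma chi_inj n (s t : 'Z_(p ^ n.+1)) : chi n ^+ s = chi n ^+ t -> s = t.
Proof.
have [x xE] := residue_surj hp (1 : 'Z_(p ^ n.+1)).
move=> /(congr1 (fun f : A => f x)); rewrite !cfunXE !chiE xE expr1.
by move=> /eqP; rewrite omega_inj // => /eqP.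
Qed.

Lemma chi_free n (c : 'Z_(p ^ n.+1) -> C) :
  \sum_t c t *: chi n ^+ t = 0 -> forall t, c t = 0.
Proof.
have [om [oh _]] := haar_exists R hp; have os := oh.1.
move=> c0 k; have := congr1 (fun f : A => om (star (chi n ^+ k) * f)) c0.
rewrite mulr0 (state_0 os) mulr_sumr (state_sum os) (bigD1 k) //= big1.
  rewrite addr0 -scalerAr (state_scale os) chiX_unitary.
  by case: os => _ -> _; rewrite mulr1.
move=> t tk; rewrite -scalerAr (state_scale os) -chi_opp -chiD.
rewrite (haar_char oh) ?mulr0 //; first exact: chiX_add.
apply: contra_neq tk => E; apply/eqP; rewrite -subr_eq0 addrC; apply/eqP.
exact: chi_inj.
Qed.

Section Tens.
Variables (B : cstarType R) (T : mintensor A B).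

(** The coefficients are extended by 0 to all exponents, so that the linear independence of the full
    family of characters of one level applies. *)
Lemma tens_chi_free n (s : seq 'Z_(p ^ n.+1)) (b : 'Z_(p ^ n.+1) -> B) :
  uniq s -> \sum_(t <- s) tens T (chi n ^+ t) (b t) = 0 ->
  forall t, t \in s -> b t = 0.
Proof.
move=> us sb t ts.
have E : \sum_(t : 'Z_(p ^ n.+1))
    tens T (chi n ^+ t) (if t \in s then b t else 0) = 0.
  apply: etrans sb; rewrite (big_uniq _ us) [RHS]big_mkcond /=.
  by apply: eq_bigr => i _; case: ifP => // _; rewrite tens0r.
by have := tens_free (@chi_free n) E t; rewrite ts.
Qed.

Lemma tens_chi2 n (s t : 'Z_(p ^ n.+1)) (a b a' b' : B) : s != t ->
  tens T (chi n ^+ s) a + tens T (chi n ^+ t) b =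
  tens T (chi n ^+ s) a' + tens T (chi n ^+ t) b' -> a = a' /\ b = b'.
Proof.
move=> st /eqP; rewrite -subr_eq0 opprD addrACA -!tensNr -!tensDr => /eqP E.
pose f w := if w == s then a - a' else b - b'.
have H w : w \in [:: s; t] -> f w = 0.
  apply: tens_chi_free; first by rewrite /= inE st.
  by rewrite !big_cons big_nil addr0 /f eqxx [t == s]eq_sym (negPf st).
have := H s; have := H t; rewrite /f !inE !eqxx ?orbT [t == s]eq_sym (negPf st).
by move=> /(_ isT)/eqP + /(_ isT)/eqP; rewrite !subr_eq0 => /eqP -> /eqP ->.
Qed.

Lemma tens_chi3 n (r s t : 'Z_(p ^ n.+1)) (a b c : B) :
  uniq [:: r; s; t] ->
  tens T (chi n ^+ r) a + tens T (chi n ^+ s) b + tens T (chi n ^+ t) c = 0 ->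
  [/\ a = 0, b = 0 & c = 0].
Proof.
move=> u E; pose f w := if w == r then a else if w == s then b else c.
have := u; rewrite /= !inE negb_or andbT => /andP[/andP[rs rt] st].
have H w : w \in [:: r; s; t] -> f w = 0.
  apply: tens_chi_free => //; rewrite !big_cons big_nil addr0 addrA -{}E /f.
  by rewrite !eqxx [s == r]eq_sym [t == r]eq_sym [t == s]eq_sym
    (negPf rs) (negPf rt) (negPf st).
have := H r; have := H s; have := H t; rewrite /f !inE !eqxx ?orbT.
rewrite [s == r]eq_sym [t == r]eq_sym [t == s]eq_sym (negPf rs) (negPf rt)
  (negPf st).
by move=> -> // -> // -> .
Qed.

Lemma tens1_inj a b : tens T 1 a = tens T 1 b -> a = b.
Proof.
move=> E; have [|//|//] := @tens_chi2 0%N 0 1 a 0 b 0; first by rewrite eq_sym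
  oner_eq0.
by rewrite expr0 E.
Qed.

End Tens.
End Independence.

(** * Algebra of the two coefficients of a character *)

Section Blocks.
Variables (R : realType) (B : cstarType R).

Lemma exprD_orth (x y : B) k : (0 < k)%N -> x * y = 0 -> y * x = 0 ->
  (x + y) ^+ k = x ^+ k + y ^+ k.
Proof.
case: k => // k _ xy yx; elim: k => [|k IH]; first by rewrite !expr1.
rewrite exprS IH mulrDl !mulrDr -!exprS.
by rewrite [in x * _]exprS mulrA xy mul0r addr0 [in y * _]exprS mulrA yx mul0r
  add0r.
Qed.

(* The relations between the coefficients of
   alpha(chi) = chi (x) a + chi^* (x) b. *)
Record blocks (a b : B) : Prop := Blocks {
  blocks_ab : a * b = 0;
  blocks_ba : b * a = 0;
  blocks_asb : star a * b = 0;
  blocks_bsa : star b * a = 0;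
  blocks_abs : a * star b = 0;
  blocks_bas : b * star a = 0;
  blocks_sum : a * star a + b * star b = 1;
  blocks_sum' : star a * a + star b * b = 1 }.

(** From [a * b = - (b * a)] and [star a * b = 0] one gets [star a * (a * b) = 0], so [a * b]
    vanishes by the C*-identity. *)
Lemma blocks_intro (a b : B) :
  a * star a + b * star b = 1 -> star a * a + star b * b = 1 ->
  a * star b = 0 -> star a * b = 0 -> a * b + b * a = 0 -> blocks a b.
Proof.
move=> s1 s2 abs asb anti.
have ab : a * b = 0.
  apply: cnorm0_eq0; apply/eqP; rewrite -sqrf_eq0 -cnorm_starM starM -mulrA.
  have -> : a * b = - (b * a) by apply/eqP; rewrite -addr_eq0 anti.
  by rewrite mulrN [star a * _]mulrA asb mul0r oppr0 mulr0 cnorm0.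
have ba : b * a = 0 by rewrite -anti ab add0r.
split=> //.
- by rewrite -(starK a) -starM asb star0.
- by rewrite -(starK b) -starM abs star0.
Qed.

Section BlocksTheory.
Variables (a b : B).
Hypothesis H : blocks a b.

Lemma blocks_sab : star a * star b = 0.
Proof. by rewrite -starM (blocks_ba H) star0. Qed.
Lemma blocks_sba : star b * star a = 0.
Proof. by rewrite -starM (blocks_ab H) star0. Qed.

(** Both sides equal [a * star a * (star a * a)]: replace one factor by [1 - b * star b] or by
    [1 - star b * b], and use that [star a] and [star b] annihilate each other. *)
Lemma blocks_normal : star a * a = a * star a.
Proof.
have E1 : a * star a * (star a * a) = star a * a.
  have -> : a * star a = 1 - b * star b by rewrite -(blocks_sum H) addrK.
  by rewrite mulrBl mul1r -mulrA [star b * _]mulrA blocks_sba mul0r mulr0 subr0.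
have E2 : a * star a * (star a * a) = a * star a.
  have -> : star a * a = 1 - star b * b by rewrite -(blocks_sum' H) addrK.
  by rewrite mulrBr mulr1 -mulrA [star a * _]mulrA blocks_sab mul0r mulr0 subr0.
by rewrite -E1 E2.
Qed.

Lemma blocks_pa : a * star a * a = a.
Proof.
have -> : a * star a = 1 - b * star b by rewrite -(blocks_sum H) addrK.
by rewrite mulrBl mul1r -mulrA (blocks_bsa H) mulr0 subr0.
Qed.

Lemma blocks_ap : a * (a * star a) = a.
Proof. by rewrite -blocks_normal mulrA blocks_pa. Qed.

Lemma blocks_psa : a * star a * star a = star a.
Proof. by rewrite -[in RHS]blocks_ap !starM starK. Qed.

Lemma blocks_sap : star a * (a * star a) = star a.
Proof. by rewrite -[in RHS]blocks_pa !starM starK. Qed.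

Lemma blocks_unitary : star (star a + b) * (star a + b) = 1.
Proof.
rewrite starD starK mulrDl !mulrDr (blocks_ab H) blocks_sba addr0 add0r.
by rewrite -blocks_normal (blocks_sum' H).
Qed.

Lemma blocks_comm : (star a + b) * (a * star a) = (a * star a) * (star a + b).
Proof.
rewrite mulrDl mulrDr blocks_sap blocks_psa mulrA (blocks_ba H) mul0r.
by rewrite -mulrA (blocks_asb H) mulr0.
Qed.

Lemma blocks_exp k : (0 < k)%N -> (star a + b) ^+ k = star (a ^+ k) + b ^+ k.
Proof.
by move=> k0; rewrite exprD_orth ?starX ?(blocks_asb H) ?(blocks_bas H).
Qed.

Lemma blocks_order k : (0 < k)%N -> a ^+ k + b ^+ k = 1 ->
  (star a + b) ^+ k = 1.
Proof.
(* Multiplying the hypothesis by the support projection of a removes the term in b. *)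
move=> k0 kE; have aE : a ^+ k = a * star a.
  rewrite -[RHS]mulr1 -kE mulrDr; case: k k0 {kE} => // k _.
  rewrite exprS mulrA blocks_pa exprS mulrA -[_ * b]mulrA.
  by rewrite (blocks_asb H) mulr0 mul0r addr0.
by rewrite blocks_exp // aE starM starK -aE.
Qed.

(** A normal partial isometry is unitary on its support, so its powers keep the same range
    projection. *)
Lemma blocks_projX k : (0 < k)%N -> a ^+ k * star (a ^+ k) = a * star a.
Proof.
case: k => // k _; elim: k => [|k IH]; first by rewrite !expr1.
have E : a ^+ k.+1 * (a * star a) = a ^+ k.+1.
  by rewrite exprSr -mulrA blocks_ap.
by rewrite exprSr starM mulrA -[a ^+ _ * a * _]mulrA E.
Qed.

(** Together with [blocks_right] it recovers a and b from the unitary and the projection, so nothing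
    is lost by constructing a homomorphism from these two alone. *)
Lemma blocks_left : star (star a + b) * (a * star a) = a.
Proof. by rewrite starD starK mulrDl blocks_ap mulrA (blocks_bsa H) mul0r addr0.
  Qed.

Lemma blocks_right : (star a + b) * (1 - a * star a) = b.
Proof.
by rewrite mulrBr mulr1 mulrDl blocks_sap mulrA (blocks_ba H) mul0r addr0 addrC
  addKr.
Qed.

End BlocksTheory.
End Blocks.

(** * The semidirect product, its coaction and its coefficient functions *)

Section SemidirectProduct.
Variables (R : realType) (p : nat) (hp : prime p).
Local Notation C := R[i].
Local Notation Zp := (padic hp).
Local Notation SD := (padic_sdprod hp).
Local Notation A := (cfun R Zp).
Local Notation chi := (chi R hp).

Definition sd_act (g : SD) (t : Zp) : Zp := g.1 + flip g.2 t.

(* The right action (t, g) |-> g^-1 . t, which induces the coaction. *)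
Definition sd_coact (u : Zp * SD) : Zp := sd_act (u.2^-1)%g u.1.

Lemma sd_coactE t k e : sd_coact (t, (k, e)) = if e then k - t else t - k.
Proof.
by case: e; rewrite /sd_coact /sd_act /= ?opprK // addrC.
Qed.

Lemma sd_coact_continuous : continuous sd_coact.
Proof.
apply: padic_continuousP => -[t [k e]] n.
exists ([set t' : Zp | residue t' n = residue t n],
        [set g : SD | residue g.1 n = residue k n /\ g.2 = e]).
  by split; [exact: nbhs_residue | exact: (sd_nbhs (k, e) n)].
move=> [t' [k' e']] [/= tt [/= kk ee]].
change (residue (sd_coact (t', (k', e'))) n = residue (sd_coact (t, (k, e))) n).
rewrite ee !sd_coactE {ee}.
by case: e; rewrite /= tt kk.
Qed.

Lemma sd_coactM t (g h : SD) :
  sd_coact (sd_coact (t, g), h) = sd_coact (t, (g * h)%g).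
Proof.
case: g h => [k e] [l f]; rewrite -[(_ * _)%g]/(sd_mul (k, e) (l, f)) /sd_mul
  /=.
rewrite !sd_coactE; case: e f => -[] /=; rewrite ?opprD ?opprK.
- by rewrite addrCA [RHS]addrCA [l + t]addrC.
- by rewrite addrAC.
- by rewrite [RHS]addrAC [k - t]addrC [RHS]addrC.
- by rewrite addrA.
Qed.

Lemma sd_coact1 t : sd_coact (t, 1%g) = t.
Proof. by rewrite -[1%g]/(0, false) sd_coactE subr0. Qed.

Definition sd_cqg : cqg R := @classical_cqg R SD (sd_levels hp).

Definition sd_qaction : qaction A sd_cqg :=
  classical_action R (sd_levels hp) (padic_levels hp) sd_coact_continuous
    sd_coactM sd_coact1.

Definition sd_proj (b : bool) : cfun R bool := @lind R bool bool_levels 0 b.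

(** With [sd_b], the coefficients of the coaction on [chi n], read off from [sd_coactE] by
    multiplicativity of the character on t - k and on k - t. *)
Definition sd_a n : cfun R SD := cfun_tens (star (chi n)) (sd_proj false).
Definition sd_b n : cfun R SD := cfun_tens (chi n) (sd_proj true).

Lemma sd_aE n k e : sd_a n (k, e) = if e then 0 else conjc (chi n k).
Proof. by case: e; rewrite /= ?mulr0 ?mulr1. Qed.

Lemma sd_bE n k e : sd_b n (k, e) = if e then chi n k else 0.
Proof. by case: e; rewrite /= ?mulr0 ?mulr1. Qed.

Lemma conj_chi_mul n x : conjc (chi n x) * chi n x = 1.
Proof. by rewrite -cfun_starE -cfunME chi_unitary. Qed.

Lemma chi_add n (x y : Zp) : chi n (x + y) = chi n x * chi n y.
Proof. by have := chiX_add R n 1 x y; rewrite !expr1. Qed.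

Lemma chi_oppE n (x : Zp) : chi n (- x) = conjc (chi n x).
Proof.
have c0 : chi n x != 0.
  by apply: contra_eq_neq (conj_chi_mul n x) => ->; rewrite mulr0 eq_sym
    oner_eq0.
apply: (mulIf c0); rewrite conj_chi_mul -chi_add addNr chiE /= expr0 //.
Qed.

Lemma sd_qaction_chi n : sd_qaction (chi n) =
  cfun_tens (chi n) (sd_a n) + cfun_tens (star (chi n)) (sd_b n).
Proof.
apply: cfunP => -[t [k e]].
rewrite -[RHS]/(chi n t * sd_a n (k, e) + conjc (chi n t) * sd_b n (k, e)).
rewrite sd_aE sd_bE -[LHS]/(chi n (sd_coact (t, (k, e)))) sd_coactE.
by case: e; rewrite chi_add chi_oppE ?mulr0 ?addr0 ?add0r // mulrC.
Qed.

Lemma conjcM (x y : C) : conjc (x * y) = conjc x * conjc y.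
Proof. exact: (rmorphM (Num.conj : C -> C)). Qed.

Lemma chi_flip n (k l : Zp) e :
  chi n (k + flip e l) = chi n k * (if e then conjc (chi n l) else chi n l).
Proof. by rewrite chi_add; case: e; rewrite // chi_oppE. Qed.

Lemma sd_comul_a n : comul (sd_a n : sd_cqg) =
  cfun_tens (sd_a n) (sd_a n) + cfun_tens (star (sd_b n)) (sd_b n).
Proof.
apply: cfunP => -[[k e] [l f]].
rewrite -[RHS]/(sd_a n (k, e) * sd_a n (l, f) + conjc (sd_b n (k, e)) * sd_b n
  (l, f)).
rewrite -[LHS]/(sd_a n (k + flip e l, e (+) f)) !sd_aE !sd_bE chi_flip conjcM.
move: (chi n k) (chi n l) => x y.
case: e f => -[]; rewrite [_ (+) _]/=; cbv iota;
  by rewrite ?conjcK ?conjc0 ?mulr0 ?mul0r ?addr0 ?add0r.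
Qed.

Lemma sd_comul_b n : comul (sd_b n : sd_cqg) =
  cfun_tens (sd_b n) (sd_a n) + cfun_tens (star (sd_a n)) (sd_b n).
Proof.
apply: cfunP => -[[k e] [l f]].
rewrite -[RHS]/(sd_b n (k, e) * sd_a n (l, f) + conjc (sd_a n (k, e)) * sd_b n
  (l, f)).
rewrite -[LHS]/(sd_b n (k + flip e l, e (+) f)) !sd_aE !sd_bE chi_flip.
move: (chi n k) (chi n l) => x y.
case: e f => -[]; rewrite [_ (+) _]/=; cbv iota;
  by rewrite ?conjcK ?conjc0 ?mulr0 ?mul0r ?addr0 ?add0r.
Qed.

Lemma sd_qaction_preserves : preserves (@V_inf R p hp) sd_qaction.
Proof.
move=> i v; have [n [t ->]] := V_infE i.
set W := lin _; have ah := act_hom sd_qaction.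
pose T := act_tens sd_qaction.
have WP w : W w -> forall b, lin [set tens T w b | w in W & b in setT]
  (tens T w b).
  by move=> Ww b; apply: lin_subset; exists w => //; exists b.
have Wt : W (chi n ^+ t) by apply: lin_subset; rewrite /= mem_head.
have Ws : W (star (chi n ^+ t)) by apply: lin_subset; rewrite /= !inE eqxx orbT.
have [f [g E]] : exists f g, sd_qaction (chi n ^+ t) =
    tens T (chi n ^+ t) f + tens T (star (chi n ^+ t)) g.
  exists (cfun_tens (star (chi n ^+ t)) (sd_proj false)).
  exists (cfun_tens (chi n ^+ t) (sd_proj true)).
  apply: cfunP => -[y [k e]].
  rewrite -[LHS]/((chi n ^+ t) (sd_coact (y, (k, e)))) sd_coactE.
  rewrite -[RHS]/((chi n ^+ t) y * (conjc ((chi n ^+ t) k) * (e == false)%:R) +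
    conjc ((chi n ^+ t) y) * ((chi n ^+ t) k * (e == true)%:R)) !cfunXE.
  case: e; rewrite eqxx ?mulr0 ?addr0 ?add0r ?mulr1 chi_add chi_oppE exprMn.
    by rewrite mulrC; congr (_ * _); rewrite -[conjc _ ^+ _]rmorphXn.
  by congr (_ * _); rewrite -[conjc _ ^+ _]rmorphXn.
move: v; apply: lin_ind.
- by rewrite (shom_0 ah); exact: lin0.
- by move=> x y; rewrite (shom_add ah); exact: linD.
- by move=> c x; rewrite (shom_scale ah); exact: linZ.
move=> x xs; have : x \in [:: chi n ^+ t; star (chi n ^+ t)] := xs.
rewrite !inE => /orP[] /eqP ->; first by rewrite E; apply: linD; exact: WP.
rewrite (shom_star ah) E starD !tens_star starK.
by apply: linD; exact: WP.
Qed.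

(** The coefficients generate: [star (sd_a n) + sd_b n] is [chi n] on the first factor, and
    [star (sd_a n) * sd_a n] is the indicator of [false] on the second. *)
Lemma sd_hom_ext (B : cstarType R) (phi psi : cfun R SD -> B) :
  star_hom phi -> star_hom psi ->
  (forall n, phi (sd_a n.+2) = psi (sd_a n.+2)) ->
  (forall n, phi (sd_b n.+2) = psi (sd_b n.+2)) -> forall f, phi f = psi f.
Proof.
move=> ph qh pa pb.
have fh := cfun_comp_hom R (@fst_cts Zp bool) : star_hom (@cfun_fst R Zp bool).
have sh := cfun_comp_hom R (@snd_cts Zp bool) : star_hom (@cfun_snd R Zp bool).
have p1 := shom_comp ph fh; have q1 := shom_comp qh fh.
have p2 := shom_comp ph sh; have q2 := shom_comp qh sh.
have E1 : forall f, phi (cfun_fst bool f) = psi (cfun_fst bool f).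
  apply: (padic_hom_ext p1 q1) => n /=.
  have -> : cfun_fst bool (chi n.+2) = star (sd_a n.+2) + sd_b n.+2.
    apply: cfunP => -[k e]; rewrite cfunDE cfun_starE sd_aE sd_bE.
    by case: e; rewrite ?rmorph0 ?add0r ?addr0 ?conjcK.
  by rewrite (shom_add ph) (shom_add qh) (shom_star ph) (shom_star qh) pa pb.
have Ef : phi (cfun_snd Zp (sd_proj false)) = psi (cfun_snd Zp (sd_proj false)).
  have -> : cfun_snd Zp (sd_proj false) = star (sd_a 2) * sd_a 2.
    apply: cfunP => -[k e]; rewrite cfunME cfun_starE sd_aE.
    by case: e; rewrite ?mulr0 // conjcK mulrC conj_chi_mul.
  by rewrite (shom_mul ph) (shom_mul qh) (shom_star ph) (shom_star qh) pa.
have E2 : forall f, phi (cfun_snd Zp f) = psi (cfun_snd Zp f).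
  apply: (@shom_level_ext _ _ bool_levels _ _ _ p2 q2) => n [] /=.
    have -> : @lind R bool bool_levels n true = 1 - sd_proj false.
      by apply: cfunP => -[]; rewrite cfunBE /= ?subr0 ?subrr.
    rewrite (shom_sub sh) (shom1 sh) (shom_sub ph) (shom_sub qh).
    by rewrite (shom1 ph) (shom1 qh) Ef.
  have -> : @lind R bool bool_levels n false = sd_proj false by exact: cfunP.
  exact: Ef.
apply: (@shom_prod_ext _ _ _ (padic_levels hp) bool_levels) => // f g.
by rewrite /cfun_tens (shom_mul ph) (shom_mul qh) E1 E2.
Qed.

End SemidirectProduct.

(** * Coefficients of an arbitrary filtration-preserving action, and the universal property *)

Section Universality.
Variables (R : realType) (p : nat) (hp : prime p).
Local Notation C := R[i].
Local Notation Zp := (padic hp).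
Local Notation A := (cfun R Zp).
Local Notation SD := (padic_sdprod hp).
Local Notation chi := (chi R hp).

(* Only characters of order at least 8 are used: the dual of Z/4 has a quantum
   symmetry group that is not classical, since there chi^2 and chi^-2 agree. *)
Lemma Zp_small_neq0 n k : (0 < k < 8)%N -> (k%:R : 'Z_(p ^ n.+3)) != 0.
Proof.
move=> /andP[k0 k8]; apply/eqP => /(congr1 (@nat_of_ord _)).
rewrite val_Zp_nat ?(ppow_gt1 hp) // modn_small.
  by move=> /= kE; rewrite kE in k0.
apply: (leq_trans k8); apply: (@leq_trans (2 ^ n.+3)); last first.
  by rewrite leq_exp2r // prime_gt1.
by rewrite -[8%N]/(2 ^ 3)%N leq_exp2l.
Qed.

Lemma chi_nat n k : chi n ^+ (k%:R : 'Z_(p ^ n.+1))%R = chi n ^+ k.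
Proof. by rewrite val_Zp_nat ?(ppow_gt1 hp) // chi_exp_mod. Qed.

Lemma chi_nat_opp n k : chi n ^+ (- k%:R : 'Z_(p ^ n.+1))%R = star (chi n) ^+ k.
Proof. by rewrite chi_opp chi_nat starX. Qed.

Section TensorChi.
Variables (B : cstarType R) (T : mintensor A B).

Lemma tens_chi_inj n (a b a' b' : B) :
  tens T (chi n.+2) a + tens T (star (chi n.+2)) b =
  tens T (chi n.+2) a' + tens T (star (chi n.+2)) b' -> a = a' /\ b = b'.
Proof.
rewrite -(expr1 (star _)) -chi_nat_opp -{1 4}[chi n.+2]expr1 -(chi_nat n.+2 1).
apply: tens_chi2; rewrite -subr_eq0 opprK -natrD.
exact: Zp_small_neq0.
Qed.

(** The exponents 0, 2 and -2 are distinct modulo p^(n+3) because neither 2 nor 4 vanishes there. *)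
Lemma tens_chi_sq_inj n (a b c a' b' c' : B) :
  tens T 1 a + tens T (chi n.+2 ^+ 2) b + tens T (star (chi n.+2) ^+ 2) c =
  tens T 1 a' + tens T (chi n.+2 ^+ 2) b' + tens T (star (chi n.+2) ^+ 2) c' ->
  [/\ a = a', b = b' & c = c'].
Proof.
move=> /eqP.
rewrite -subr_eq0 !opprD addrACA -!tensNr -tensDr addrACA -!tensDr => /eqP.
have -> : 1 = chi n.+2 ^+ (0%R : 'Z_(p ^ n.+3)) by [].
rewrite -(chi_nat n.+2 2) -chi_nat_opp => E.
have [] := tens_chi3 _ E.
  rewrite !cons_uniq !inE !andbT negb_or ![0 == _]eq_sym oppr_eq0 Zp_small_neq0
    //.
  by rewrite -subr_eq0 opprK -natrD Zp_small_neq0.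
by move=> /eqP + /eqP + /eqP; rewrite !subr_eq0 => /eqP-> /eqP-> /eqP->.
Qed.
End TensorChi.

Variables (G : cqg R) (alpha : qaction A G).
Hypothesis alphaV : preserves (@V_inf R p hp) alpha.
Let T := act_tens alpha.

Lemma action_chi n (t : 'Z_(p ^ n.+1)) : exists a b,
  alpha (chi n ^+ t) = tens T (chi n ^+ t) a + tens T (star (chi n ^+ t)) b.
Proof.
have WV : V_inf_subspaces (lin [set` [:: chi n ^+ t; star (chi n ^+ t)]]).
  by apply/V_infP; exists n, t.
apply: lin_tens_pair; have := @alphaV (SigSub (mem_set WV)) (chi n ^+ t).
rewrite /V_inf set_valE; apply.
by apply: lin_subset; rewrite /= mem_head.
Qed.

Let ah : star_hom alpha := act_hom alpha.

Lemma action_coefs n : exists ab : G * G,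
  blocks ab.1 ab.2 /\
  alpha (chi n.+2) = tens T (chi n.+2) ab.1 + tens T (star (chi n.+2)) ab.2.
Proof.
have [a [b]] := action_chi (1 : 'Z_(p ^ n.+3)); rewrite -[X in chi _ ^+ X]/1%N.
rewrite expr1 => E; exists (a, b); split=> //=.
(* The filtration also constrains the square of the character: its image has components along chi^2
   and chi^-2 only. *)
have [c [d]] := action_chi (2 : 'Z_(p ^ n.+3)).
rewrite -[2]/(2%:R) chi_nat starX => E2.
set u := chi n.+2 in E E2 *; set u' := star u in E E2 *.
have uu : u' * u = 1 by exact: chi_unitary.
have uu' : u * u' = 1 by apply: cfunP => x; rewrite cfunME mulrC -cfunME uu.
have E' : alpha u' = tens T u' (star a) + tens T u (star b).
  by rewrite (shom_star ah) E starD !tens_star starK.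
(* Coefficients along 1, chi^2 and chi^-2 of alpha(u) alpha(u') = 1; the next block does the same
   for the product in the opposite order. *)
have [s1 r1 _] : [/\ a * star a + b * star b = 1, a * star b = 0 &
    b * star a = 0].
  apply: (@tens_chi_sq_inj _ T n); rewrite tensDr !tens0r !addr0 -/u -/u'.
  have := shom_mul ah u u'; rewrite uu' (shom1 ah) E E' mulrDl !mulrDr !tensM.
  rewrite uu uu' -!expr2 -(tens1 T) => ->.
  by rewrite -!addrA; congr (_ + _); rewrite addrC -addrA.
have [s2 r2 _] : [/\ star a * a + star b * b = 1, star b * a = 0 &
    star a * b = 0].
  apply: (@tens_chi_sq_inj _ T n); rewrite tensDr !tens0r !addr0 -/u -/u'.
  have := shom_mul ah u' u; rewrite uu (shom1 ah) E E' mulrDl !mulrDr !tensM.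
  rewrite uu uu' -!expr2 -(tens1 T) => ->.
  rewrite -!addrA; congr (_ + _); rewrite addrA addrC; congr (_ + _).
  exact: addrC.
(* The mixed terms of alpha(u)^2 are its component along 1, which the filtration forbids. *)
have [s3 _ _] : [/\ a * b + b * a = 0, a * a = c & b * b = d].
  apply: (@tens_chi_sq_inj _ T n); rewrite tensDr !tens0r add0r -/u -/u'.
  have := shom_mul ah u u; rewrite -expr2 E E2 mulrDl !mulrDr !tensM.
  rewrite uu uu' -!expr2 => ->.
  by rewrite -!addrA [RHS]addrCA; congr (_ + _); exact: addrCA.
apply: blocks_intro => //.
by rewrite -[b]starK -starM r2 star0.
Qed.

(** The two summands of alpha(chi) annihilate each other, so its powers have no mixed terms. *)
Lemma action_chi_exp n (a b : G) k : (0 < k)%N -> blocks a b ->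
  alpha (chi n.+2) = tens T (chi n.+2) a + tens T (star (chi n.+2)) b ->
  alpha (chi n.+2 ^+ k) = tens T (chi n.+2 ^+ k) (a ^+ k) +
    tens T (star (chi n.+2 ^+ k)) (b ^+ k).
Proof.
move=> k0 ab E; rewrite (shom_exp ah) E exprD_orth //.
- have tX x y j : tens T x y ^+ j = tens T (x ^+ j) (y ^+ j).
    by elim: j => [|j IH]; rewrite ?expr0 ?tens1 // !exprS IH tensM.
  by rewrite !tX starX.
- by rewrite tensM (blocks_ab ab) tens0r.
- by rewrite tensM (blocks_ba ab) tens0r.
Qed.

(** The index is shifted: [coef n] belongs to [chi n.+2], of order p^(n+3). *)
Definition coef n : G * G := projT1 (cid (action_coefs n)).
Let a n := (coef n).1.
Let b n := (coef n).2.

Lemma coef_blocks n : blocks (a n) (b n).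
Proof. by case: (projT2 (cid (action_coefs n))). Qed.

Lemma coefE n :
  alpha (chi n.+2) = tens T (chi n.+2) (a n) + tens T (star (chi n.+2)) (b n).
Proof. by case: (projT2 (cid (action_coefs n))). Qed.

(** Since [chi n.+3 ^+ p = chi n.+2], this is uniqueness of the coefficients combined with
    multiplicativity of alpha. *)
Lemma coef_down n : a n.+1 ^+ p = a n /\ b n.+1 ^+ p = b n.
Proof.
apply: (@tens_chi_inj _ T n); rewrite -coefE -(chi_down R hp n.+2).
by rewrite -action_chi_exp ?prime_gt0 //; [exact: coef_blocks | exact: coefE].
Qed.

Definition unit_coef n : G := star (a n) + b n.

Lemma unit_coef_order n : unit_coef n ^+ (p ^ n.+3) = 1.
Proof.
apply: (blocks_order (coef_blocks n)); first exact: ppow_gt0.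
have := action_chi_exp (ppow_gt0 hp n.+3) (coef_blocks n) (coefE n).
(* At the order N of the character both chi^N and its adjoint are 1, so the two terms merge into 1
   (x) (a^N + b^N) = 1 (x) 1. *)
rewrite chi_order star1 (shom1 ah) -tensDr -(tens1 T).
by move=> /(@tens1_inj R p hp) <-.
Qed.

Lemma unit_coef_down n : unit_coef n.+1 ^+ p = unit_coef n.
Proof.
rewrite /unit_coef -(coef_down n).1 -(coef_down n).2.
by rewrite (blocks_exp (coef_blocks n.+1)) ?prime_gt0.
Qed.

Definition proj_coef : G := a 0 * star (a 0).

(** Each a is the p-th power of the next one, and taking powers keeps the range projection. *)
Lemma proj_coefE n : a n * star (a n) = proj_coef.
Proof.
elim: n => [//|n IH]; rewrite -{}IH -(coef_down n).1.
by rewrite (blocks_projX (coef_blocks n.+1)) ?prime_gt0.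
Qed.

(* The coefficients of the characters of order at most p^2 are recovered as
   powers of those of higher order. *)
Lemma unitary_hom : exists Phi : A -> G,
  star_hom Phi /\ forall n, Phi (chi n.+2) = unit_coef n.
Proof.
have UU n : star (unit_coef n) * unit_coef n = 1.
  exact: blocks_unitary (coef_blocks n).
have UX n k : star (unit_coef n ^+ k) * unit_coef n ^+ k = 1.
  elim: k => [|k IH]; first by rewrite expr0 star1 mulr1.
  by rewrite exprS starM -mulrA [star (unit_coef n) * _]mulrA UU mul1r.
have [|//||Phi [Ph PE]] := @padic_hom R p hp G
  (fun n => unit_coef n ^+ (p ^ 2)).
- by move=> n; rewrite -exprM -expnD unit_coef_order.
- by move=> n; rewrite exprAC unit_coef_down.
exists Phi; split=> // n; rewrite PE expnS expn1 exprM.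
by rewrite !unit_coef_down.
Qed.

(** The point [false] goes to the range projection of a because [sd_a] is supported on that
    component. *)
Lemma proj_hom : exists Psi : cfun R bool -> G,
  star_hom Psi /\ forall n c, Psi (@lind R bool bool_levels n c) =
    if c then 1 - proj_coef else proj_coef.
Proof.
have PP : proj_coef * proj_coef = proj_coef.
  by rewrite /proj_coef mulrA (blocks_pa (coef_blocks 0)).
have Ps : star proj_coef = proj_coef by rewrite /proj_coef starM starK.
pose v (n : nat) (c : bool) := if c then 1 - proj_coef else proj_coef.
have [||||Psi [Ph PE]] := @level_hom R bool bool_levels G v.
- move=> n c; rewrite (big_pred1 c) //.
- move=> n [] [] /=; rewrite /v ?mulrBl ?mulrBr ?mul1r ?mulr1 ?PP ?subrr ?subr0
  //.
- by move=> n [] /=; rewrite ?starB ?star1 Ps.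
- by move=> n; rewrite (bigD1 true) // (big_pred1 false) /= ?subrK // => -[].
by exists Psi; split=> // n c; rewrite PE.
Qed.

Lemma coef_hom : exists gamma : cfun R SD -> G, star_hom gamma /\
  forall n, gamma (sd_a R hp n.+2) = a n /\ gamma (sd_b R hp n.+2) = b n.
Proof.
have [Phi [Ph PE]] := unitary_hom; have [Psi [Qh QE]] := proj_hom.
have UP n : unit_coef n * proj_coef = proj_coef * unit_coef n.
  by rewrite -(proj_coefE n) /unit_coef (blocks_comm (coef_blocks n)).
have PP (f : A) : Phi f * proj_coef = proj_coef * Phi f.
  apply: padic_hom_comm => // n; rewrite -(chi_down_iter R hp n 2)
    (shom_exp Ph).
  rewrite addn2 PE; exact/esym/(commrX _ (esym (UP n))).
have PQ f g : Phi f * Psi g = Psi g * Phi f.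
  symmetry; apply: (@shom_level_commute _ _ bool_levels) => // n c.
  rewrite QE; case: c; last by rewrite PP.
  by rewrite mulrBl mulrBr mul1r mulr1 PP.
have [gamma [gh gE]] := prod_hom (padic_levels hp) bool_levels Ph Qh PQ.
exists gamma; split=> // n; rewrite /sd_a /sd_b !gE !QE (shom_star Ph) PE.
rewrite -(proj_coefE n); split; first exact: blocks_left (coef_blocks n).
exact: blocks_right (coef_blocks n).
Qed.

(** Applied to chi, both sides of coassociativity land in A (x) (G (x) G), where the coefficients
    along chi and its adjoint can be compared. The stars come from expanding alpha of the adjoint of
    chi. *)
Lemma comul_coef n :
  comul (a n) = tens (cqg_tens G) (a n) (a n) + tens (cqg_tens G) (star (b n))
    (b n)
  /\ comul (b n) = tens (cqg_tens G) (b n) (a n) + tens (cqg_tens G)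
    (star (a n)) (b n).
Proof.
have [T3 [S3 [f [g [s [[fh fE] [gh gE] [sh sE] H]]]]]] := act_coassoc alpha.
have := H (chi n.+2).
have E' : alpha (star (chi n.+2)) =
    tens T (star (chi n.+2)) (star (a n)) + tens T (chi n.+2) (star (b n)).
  by rewrite (shom_star ah) coefE starD !tens_star starK.
rewrite coefE (shom_add fh) !fE E' coefE !tensDl !(shom_add sh) !sE
  (shom_add gh) !gE.
move=> E; symmetry in E.
have [] := @tens_chi_inj _ S3 n (comul (a n)) (comul (b n))
  (tens (cqg_tens G) (a n) (a n) + tens (cqg_tens G) (star (b n)) (b n))
  (tens (cqg_tens G) (b n) (a n) + tens (cqg_tens G) (star (a n)) (b n)) => //.
rewrite !tensDr; etransitivity; first exact: E.
by rewrite -!addrA; congr (_ + _); rewrite addrA addrC.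
Qed.

Lemma sd_universal : exists! gamma : sd_cqg R hp -> G,
  cqg_morphism gamma /\ factors_through (sd_qaction R hp) alpha gamma.
Proof.
have [gamma [gh gE]] := coef_hom.
have cE n := comul_coef n.
exists gamma; split; last first.
  move=> gamma' [[gh' _] [h [hh hE] H]].
  (* Uniqueness: the factorization alone prescribes [gamma'] on the coefficient functions, which
     generate. *)
  have aE n : a n = gamma' (sd_a R hp n.+2) /\ b n = gamma' (sd_b R hp n.+2).
    apply: (@tens_chi_inj _ T n); rewrite -coefE H sd_qaction_chi.
    by rewrite (shom_add hh) !hE.
  apply: funext; apply: (sd_hom_ext gh gh') => n.
    by rewrite (gE n).1 (aE n).1.
  by rewrite (gE n).2 (aE n).2.
split.
- split=> //.
  (* gamma (x) gamma exists because the two legs of the tensor product commute, even though G itself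
     may be noncommutative. The intertwining relation is then checked on generators. *)
  have [|g2 [g2h g2E]] := prod_hom (sd_levels hp) (sd_levels hp)
    (tens_left_hom (cqg_tens G) gh) (tens_right_hom (cqg_tens G) gh).
    by move=> f g; rewrite !tensM !mul1r !mulr1.
  have g2T f g : g2 (cfun_tens f g) = tens (cqg_tens G) (gamma f) (gamma g).
    by rewrite g2E tensM mul1r mulr1.
  exists g2; first by split.
  have h1 := shom_comp (comul_hom G) gh.
  have h2 := shom_comp g2h (comul_hom (sd_cqg R hp)).
  apply: (sd_hom_ext h1 h2) => n.
    change (comul (gamma (sd_a R hp n.+2)) = g2
      (comul (sd_a R hp n.+2 : sd_cqg R hp))).
    rewrite sd_comul_a (shom_add g2h) !g2T (shom_star gh) (gE n).1 (gE n).2.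
    by case: (cE n).
  change (comul (gamma (sd_b R hp n.+2)) = g2
    (comul (sd_b R hp n.+2 : sd_cqg R hp))).
  rewrite sd_comul_b (shom_add g2h) !g2T (shom_star gh) (gE n).1 (gE n).2.
  by case: (cE n).
(* id (x) gamma, obtained in the same way; the factorization has to be compared on the characters
   [chi n.+2] only. *)
have [|h [hh hE]] := prod_hom (padic_levels hp) (sd_levels hp)
  (tens_left_hom T (@shom_id R A)) (tens_right_hom T gh).
  by move=> f g; rewrite !tensM !mul1r !mulr1.
have hT f g : h (cfun_tens f g) = tens T f (gamma g).
  by rewrite hE tensM mul1r mulr1.
exists h; first by split.
apply: (padic_hom_ext ah (shom_comp hh (act_hom (sd_qaction R hp)))) => n.
change (alpha (chi n.+2) = h (sd_qaction R hp (chi n.+2))).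
by rewrite sd_qaction_chi (shom_add hh) !hT (gE n).1 (gE n).2 coefE.
Qed.

End Universality.

Theorem theorem4p5 (R : realType) (p : nat) (hp : prime p) :
  (exists2 omega : cfun R (padic hp) -> R[i],
     is_haar_state omega & orthogonal_filtration omega (@V_inf R p hp)) /\
  exists (G : cqg R) (alpha : qaction (cfun R (padic hp)) G)
    (theta : G -> cfun R (padic_sdprod hp))
    (act : padic_sdprod hp -> padic hp -> padic hp),
  [/\ is_quantum_symmetry_group (@V_inf R p hp) alpha,
      is_classical_group theta,
      corresponds_to_action theta act alpha,
      forall k t : padic hp, act (k, false) t = k + t &
      forall k t : padic hp, act (k, true) t = k - t].
Proof.
split.
  have [omega [oh ofa]] := haar_exists R hp.
  by exists omega => //; exact: haar_orthogonal_filtration.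
exists (sd_cqg R hp), (sd_qaction R hp), id, (@sd_act p hp); split=> //.
- split; first exact: sd_qaction_preserves.
  by move=> G alpha; exact: sd_universal.
- exact: classical_cqg_is_classical.
- exact: classical_action_corresponds.
Qed.
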